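(* Let $(\pi,V)=\mathrm{Ind}_B^G(\mu_1\otimes\mu_2)$ with $\mu_1=|\cdot|_E$ and $\mu_2=1$, and let $(\pi_1,V_1)$ be the Steinberg representation of $G$, realized as the unique irreducible subrepresentation of $\pi$. Then a function $f$ in $V(2)$ lies in $V_1(2)$ if and only if $f(1)=-q(q-1)f(\gamma_1)$. In particular, $q(q-1)f_{2,2}-f_{2,1}$ is a newform for the Steinberg representation of $G$ (a non-zero element of $V_1(N_{\pi_1})$, where the conductor is $N_{\pi_1}=2$).
   Context: $F$ is a non-archimedean local field of characteristic zero with odd residual characteristic; $q$ is the cardinality of the residue field of $F$; $E$ is the unramified quadratic extension of $F$, with ring of integers $\mathfrak{o}_E$, maximal ideal $\mathfrak{p}_E$ and normalized absolute value $|\cdot|_E$; $\varpi$ is a uniformizer of $F$ (hence of $E$); $x\mapsto\overline{x}$ is the non-trivial element of $\mathrm{Gal}(E/F)$. $G=\{g\in \mathrm{GL}_3(E) : {}^t\overline{g}Jg=J\}$ with $J=\begin{pmatrix}0&0&1\\0&1&0\\1&0&0\end{pmatrix}$. $E^1$ is the norm-one subgroup of $E^\times$. $B$ is the group of upper triangular elements of $G$, $T$ its diagonal subgroup, $U$ its unipotent radical. $\mu=\mu_1\otimes\mu_2$ is the quasi-character $\mathrm{diag}(a,b,\overline{a}^{-1})\mapsto\mu_1(a)\mu_2(b)$ of $T$ ($a\in E^\times$, $b\in E^1$), extended to $B$ trivially on $U$. $\mathrm{Ind}_B^G\mu$ is the space of locally constant $f:G\to\mathbf{C}$ with $f(bg)=\delta_B(b)^{1/2}\mu(b)f(g)$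 for $b\in B$, $g\in G$ (right translation action), where $\delta_B(\mathrm{diag}(a,b,\overline{a}^{-1}))=|a|_E^2$. For $n\ge 0$ let \[K_n=\begin{pmatrix}\mathfrak{o}_E&\mathfrak{o}_E&\mathfrak{p}_E^{-n}\\ \mathfrak{p}_E^n&1+\mathfrak{p}_E^n&\mathfrak{o}_E\\ \mathfrak{p}_E^n&\mathfrak{p}_E^n&\mathfrak{o}_E\end{pmatrix}\cap G .\] For a smooth representation $(\sigma,X)$, $X(n)$ is the space of $K_n$-fixed vectors; if some $X(n)$ is non-zero, the conductor is $N_\sigma=\min\{n\ge0: X(n)\neq\{0\}\}$ and $X(N_\sigma)$ is the space of newforms. For an integer $i$, $\gamma_i=\begin{pmatrix}1&&\\ \varpi^i&1&\\ -\varpi^{2i}/2&-\varpi^i&1\end{pmatrix}\in G$. For $i\in\{1,2\}$, $f_{2,i}$ denotes the function in $V(2)$ with $f_{2,i}(\gamma_i)=1$ and $\mathrm{supp}\, f_{2,i}=B\gamma_iK_2$; the functions $f_{2,1},f_{2,2}$ form a basis of $V(2)$. *)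

(* Defs.v *)
From HB Require Import structures.
From mathcomp Require Import all_boot all_order all_algebra all_fingroup all_field.
From mathcomp Require Import finmap complex ring.
From mathcomp Require Import boolp classical_sets functions cardinality reals.

Set Implicit Arguments.
Unset Strict Implicit.
Unset Printing Implicit Defensive.

Import Order.TTheory GRing.Theory Num.Theory.

Local Open Scope classical_set_scope.
Local Open Scope complex_scope.
Local Open Scope ring_scope.

(* A normalized discrete valuation; the value at 0 is irrelevant. *)
Record dvaluation (K : fieldType) := DValuation {
  dval :> K -> int;
  dvalM : forall x y, x != 0 -> y != 0 -> dval (x * y) = dval x + dval y;
  dvalD : forall x y, x != 0 -> y != 0 -> x + y != 0 ->
    Num.min (dval x) (dval y) <= dval (x + y);
  dval_surj : exists2 x, x != 0 & dval x = 1
}.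

Section Valued.
Variables (K : fieldType) (v : dvaluation K).

(* The fractional ideal p^n; p^0 is the ring of integers. *)
Definition ppow (n : int) : set K := [set x | x = 0 \/ n <= v x].

(* The residue field o/p, as the set of its cosets x + p. *)
Definition residue_field : set (set K) :=
  [set A | exists2 x, ppow 0 x & A = [set y | ppow 1 (y - x)]].

Definition residue_card : nat := #|` fset_set residue_field|%N.

Definition complete_valuation : Prop := forall u : nat -> K,
  (forall n : int, exists N : nat,
     forall i j, (N <= i)%N -> (N <= j)%N -> ppow n (u i - u j)) ->
  exists l, forall n : int, exists N : nat,
     forall i, (N <= i)%N -> ppow n (u i - l).

Definition nonarch_local_field : Prop :=
  complete_valuation /\ finite_set residue_field.

(* The prime p is the characteristic of o/p: p vanishes in o/p. *)
Definition residue_char (p : nat) : Prop := prime p /\ ppow 1 (p%:R : K).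

(* |x| = #(o/p)^(- v x), the normalized absolute value. *)
Definition normabs (R : realType) (x : K) : R :=
  if x == 0 then 0 else (residue_card%:R : R) ^ (- v x).

End Valued.

(* E is an unramified quadratic extension of F and vE prolongs vF with
   ramification index 1; over a finite residue field the residue extension is
   automatically separable. *)
Definition unramified_quadratic (F : fieldType) (E : fieldExtType F)
    (vF : dvaluation F) (vE : dvaluation E) : Prop :=
  \dim {:E} = 2%N /\ forall x : F, x != 0 -> vE x%:A = vF x.

Definition mx3 (A : Type) (a00 a01 a02 a10 a11 a12 a20 a21 a22 : A) : 'M[A]_3 :=
  \matrix_(i < 3, j < 3)
    nth a00 (nth [::] [:: [:: a00; a01; a02]; [:: a10; a11; a12];
                          [:: a20; a21; a22]] i) j.

Definition J3 (A : pzRingType) : 'M[A]_3 := mx3 0 0 1  0 1 0  1 0 0.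

Section UnitaryGroup.
Variables (F : fieldType) (E : splittingFieldType F) (sigma : gal_of {:E}).

Definition unitary_mx : pred 'M[E]_3 := fun g =>
  (g \in unitmx) && ((map_mx sigma g)^T *m J3 E *m g == J3 E).

Record U3 := MkU3 { U3val :> 'M[E]_3; _ : unitary_mx U3val }.

HB.instance Definition _ := [isSub for U3val].
HB.instance Definition _ := [Choice of U3 by <:].

Lemma unitary_mx1 : unitary_mx 1%:M.
Proof.
by rewrite /unitary_mx unitmx1 map_scalar_mx rmorph1 trmx1 mul1mx mulmx1 eqxx.
Qed.

Lemma unitary_mxM (g h : U3) : unitary_mx (U3val g *m U3val h).
Proof.
case: g h => [g /andP[gu /eqP gJ]] [h /andP[hu /eqP hJ]] /=.
rewrite /unitary_mx unitmx_mul gu hu /= map_mxM trmx_mul.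
rewrite -!mulmxA [_ *m (g *m h)]mulmxA [_ *m (_ *m h)]mulmxA.
by rewrite [_ *m (J3 E *m g)]mulmxA gJ mulmxA hJ.
Qed.

Lemma unitary_mxV (g : U3) : unitary_mx (invmx (U3val g)).
Proof.
case: g => [g /andP[gu /eqP gJ]] /=.
rewrite /unitary_mx unitmx_inv gu /= -{1}gJ !mulmxA -trmx_mul -map_mxM.
by rewrite mulmxV // map_scalar_mx rmorph1 trmx1 mul1mx mulmxK.
Qed.

Definition U3one : U3 := MkU3 unitary_mx1.
Definition U3mul (g h : U3) : U3 := MkU3 (unitary_mxM g h).
Definition U3inv (g : U3) : U3 := MkU3 (unitary_mxV g).

Lemma U3mulA : associative U3mul.
Proof. by move=> g h k; apply: val_inj; rewrite /= mulmxA. Qed.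
Lemma U3mul1 : left_id U3one U3mul.
Proof. by move=> g; apply: val_inj; rewrite /= mul1mx. Qed.
Lemma U3mulr1 : right_id U3one U3mul.
Proof. by move=> g; apply: val_inj; rewrite /= mulmx1. Qed.
Lemma U3mulV : left_inverse U3one U3inv U3mul.
Proof.
by case=> g gP; apply: val_inj; rewrite /= mulVmx //; case/andP: gP.
Qed.
Lemma U3mulrV : right_inverse U3one U3inv U3mul.
Proof.
by case=> g gP; apply: val_inj; rewrite /= mulmxV //; case/andP: gP.
Qed.

HB.instance Definition _ :=
  isGroup.Build U3 U3mulA U3mul1 U3mulr1 U3mulV U3mulrV.

Definition borel : set U3 := [set g | forall i j : 'I_3, (j < i)%N -> g i j = 0].

(* The matrix gamma_i; it is unitary as soon as 2 != 0 (gammaE below), and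
   the default value 1 of insubd is then never used. *)
Definition gamma_mx (varpi : F) (i : int) : 'M[E]_3 :=
  let w : E := varpi%:A in
  mx3 1                       0         0
      (w ^ i)                 1         0
      (- w ^ (2 * i) / 2%:R)  (- w ^ i) 1.

Definition gamma (varpi : F) (i : int) : U3 := insubd U3one (gamma_mx varpi i).

Lemma gammaE varpi i : sigma \in 'Gal({:E} / 1)%g -> (2%:R : E) != 0 ->
  gamma varpi i = gamma_mx varpi i :> 'M[E]_3.
Proof.
move=> sG n2; rewrite /gamma insubdK // unfold_in /unitary_mx.
have sw : sigma (varpi%:A ^ i) = varpi%:A ^ i.
  have s1 : sigma varpi%:A = varpi%:A.
    by apply: (fixed_gal (sub1v _) sG); rewrite memvZ // mem1v.
  by rewrite -[in RHS]s1; exact: fmorphXz.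
have w2 : varpi%:A ^ (2 * i) = varpi%:A ^ i * varpi%:A ^ i :> E.
  by rewrite mulrC -exprz_exp.
have s2 : sigma 2%:R = 2%:R by rewrite rmorph_nat.
have sN : sigma (- varpi%:A ^ i) = - varpi%:A ^ i by rewrite rmorphN /= sw.
have sh : sigma (- varpi%:A ^ (2 * i) / 2%:R)
    = - (varpi%:A ^ i * varpi%:A ^ i) / 2%:R :> E.
  rewrite fmorph_div rmorphN /= s2; congr (- _ / _).
  by rewrite w2 -[in RHS]sw; exact: rmorphM.
have JJ : J3 E *m J3 E = 1%:M.
  by apply/matrixP=> -[[|[|[|//]]] ?] [[|[|[|//]]] ?];
    rewrite !mxE !big_ord_recl big_ord0 !mxE /=; ring.
have gE : (map_mx sigma (gamma_mx varpi i))^T *m J3 E *m gamma_mx varpi i = J3 E.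
  by apply/matrixP=> -[[|[|[|//]]] ?] [[|[|[|//]]] ?];
    rewrite !mxE !big_ord_recl big_ord0 !mxE !big_ord_recl !big_ord0 !mxE /=
      ?sh ?sN ?sw ?w2 ?rmorph1 ?rmorph0; field.
rewrite gE eqxx andbT.
have : J3 E *m ((map_mx sigma (gamma_mx varpi i))^T *m J3 E)
         *m gamma_mx varpi i = 1%:M by rewrite -mulmxA gE.
by case/mulmx1_unit.
Qed.

Section Levels.
Variable v : dvaluation E.

Definition Kgrp (n : nat) : set U3 :=
  [set g | forall i j : 'I_3,
    ppow v (mx3 0     0     (- n%:Z)
                n%:Z  n%:Z  0
                n%:Z  n%:Z  0        i j)
           (g i j - mx3 0 0 0  0 1 0  0 0 0 i j)].

Section Induced.
Variable R : realType.
Implicit Types (f : U3 -> R[i]) (W X : set (U3 -> R[i])).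

(* Local constancy for the topology of G induced by that of E. *)
Definition locally_constant f : Prop :=
  forall g : U3, exists n : int,
    forall h : U3, (forall i j, ppow v n (h i j - g i j)) -> f h = f g.

(* On B = TU, the modulus character depends on the T-component only,
   whose entries are the diagonal entries of b. *)
Definition deltaB (b : U3) : R := normabs v R (b 0 0) ^+ 2.

Definition charB (mu1 mu2 : E -> R[i]) (b : U3) : R[i] :=
  mu1 (b 0 0) * mu2 (b 1 1).

Definition IndB (mu1 mu2 : E -> R[i]) : set (U3 -> R[i]) :=
  [set f | locally_constant f /\
     forall b g, borel b ->
       f (b * g)%g = (Num.sqrt (deltaB b))%:C * charB mu1 mu2 b * f g].

Definition rtrans (h : U3) f : U3 -> R[i] := fun g => f (g * h)%g.

Definition subrepresentation X W : Prop :=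
  [/\ W `<=` X, W (fun=> 0),
      (forall (a : R[i]) f1 f2, W f1 -> W f2 -> W (fun g => a * f1 g + f2 g)) &
      (forall h f, W f -> W (rtrans h f))].

Definition irreducible_subrep X W : Prop :=
  [/\ subrepresentation X W, W <> [set fun=> 0] &
      forall W', subrepresentation W W' -> W' = [set fun=> 0] \/ W' = W].

Definition unique_irreducible_subrep X W : Prop :=
  irreducible_subrep X W /\ forall W', irreducible_subrep X W' -> W' = W.

(* X(n), the space of K_n-fixed vectors. *)
Definition Kfixed X (n : nat) : set (U3 -> R[i]) :=
  [set f | X f /\ forall k, Kgrp n k -> rtrans k f = f].

Definition is_conductor X (N : nat) : Prop :=
  Kfixed X N <> [set fun=> 0] /\
  forall n, (n < N)%N -> Kfixed X n = [set fun=> 0].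

(* The function f_{2,i}, by definite description: the default value of xget is
   used only if no function meets the description. The support is the non-zero
   locus, which is closed since f is locally constant. *)
Definition f2 (X : set (U3 -> R[i])) (varpi : F) (i : int) : U3 -> R[i] :=
  xget (fun=> 0)
    [set f | [/\ Kfixed X 2 f, f (gamma varpi i) = 1 &
      [set g | f g != 0] =
      [set g | exists b k, [/\ borel b, Kgrp 2 k
                             & g = (b * gamma varpi i * k)%g]]]].

End Induced.
End Levels.
End UnitaryGroup.

(* Main.v *)
(* With mu_1 = |.|_E and mu_2 = 1, the functions in V are the functions of the
   bottom row of g (an isotropic vector) that are homogeneous of degree |.|^-2.
   The average over the hyperspecial group K0 is proportional to the average over
   the other maximal compact group K1: both factor through the average over the
   Iwahori subgroup, after which f only matters through f(1) and f(w). Since K0 and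
   K1 generate G, this functional (the mass of f) is G-invariant; if it did not vanish on the
   irreducible V_1, then V_1 would carry the trivial action, which is impossible.
   So V_1 lies in its kernel. The values of a K_0- or K_1-fixed function f are
   positive multiples of f(1), so mass zero forces f = 0; for a K_2-fixed function,
   counting the q+1 and q^3-q isotropic lines over the residue field in the two
   K_2-orbits turns mass zero into f(1) = -q(q-1) f(gamma_1). Conversely V_1 contains
   an Iwahori-fixed function with f(1) <> 0 (contract a small neighbourhood of 1 by
   the torus and average), whose average over K_2 is not 0, and V(2) is determined
   by f(1) and f(gamma_1). *)

Require Import Defs.
From HB Require Import structures.
From mathcomp Require Import all_boot all_order all_algebra all_fingroup all_field.
From mathcomp Require Import finmap complex ring zify.
From mathcomp Require Import boolp classical_sets functions cardinality reals.

Set Implicit Arguments.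
Unset Strict Implicit.
Unset Printing Implicit Defensive.

Import Order.TTheory GRing.Theory Num.Theory.

Local Open Scope classical_set_scope.
Local Open Scope complex_scope.
Local Open Scope ring_scope.

(** * Averages over coset representatives *)

(** Because of its entries in $p^{-2}$, the group $K_2$ of the statement does not lie in [K0].
    Conjugation by the torus element [tel varpi] moves it to the subgroup [K2] of [K0] and
    $\gamma_1$ to [gamma0]; the values of a function at 1 and at $\gamma_1$ are then multiplied by
    the same scalar, so a homogeneous relation between them is unaffected. Haar integrals are
    replaced by averages over finite coset spaces modulo the congruence subgroups [Gam m]. This
    needs one level $m$ valid at all points for a function that is only locally constant, and
    completeness of $E$ supplies it. The average over [K0] gives $f(1)$ and $f(w)$ the weights 1 and
    $q^3$, the average over [K1] gives them $q$ and $q_E^2 = q^4$: the proportionality, hence the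
    invariant functional, is specific to homogeneity of degree $-2$, that is to $\mu_1 = |\cdot|_E$.
    Since [K2] and the Iwahori subgroup are not comparable, the mass of a [K2]-fixed function is
    counted on inverses, where left invariance becomes right invariance. *)

Section Transversals.
Variable G : groupType.
Implicit Types (H I K : set G) (r s : seq G).
Local Open Scope group_scope.

Definition gsimp := (@invgM G, @invg1 G, @invgK G, @mulgA G, @mulVg G, @mulgV G, @mul1g G,
  @mulg1 G, @mulgK G, @mulgVK G).

Definition subgrp H : Prop :=
  [/\ H 1, forall x y, H x -> H y -> H (x * y) & forall x, H x -> H x^-1].

Lemma subgrpVM H x y : subgrp H -> H x -> H y -> H (x^-1 * y).
Proof. by move=> [_ HM HV] Hx Hy; apply: HM => //; apply: HV. Qed.

(** A finite transversal of the left cosets $xH$ in $K$; finiteness of the index is part of the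
    notion. Arbitrary sets are allowed, since it is also applied to conjugates of $H$ and, in an
    induction, to a set $K$ that is not a group. *)
Definition coset_reps K H s : Prop :=
  [/\ uniq s, forall x, x \in s -> K x,
      forall x y, x \in s -> y \in s -> H (x^-1 * y) -> x = y &
      forall k, K k -> exists2 x, x \in s & H (x^-1 * k)].

Lemma coset_reps_map K H s (f : G -> G) (K' H' : set G) :
  coset_reps K H s -> injective f -> (forall x, K x -> K' (f x)) ->
  (forall x y, K x -> K y -> H' ((f x)^-1 * f y) -> H (x^-1 * y)) ->
  (forall k, K' k -> exists k', K k' /\
     forall x, K x -> H (x^-1 * k') -> H' ((f x)^-1 * k)) ->
  coset_reps K' H' (map f s).
Proof.
move=> [us sK sH cov] injf fK fH fcov; split.
- by rewrite map_inj_uniq.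
- by move=> _ /mapP[x xs ->]; apply/fK/sK.
- move=> _ _ /mapP[x xs ->] /mapP[y ys ->] h; congr f.
  by apply: sH => //; apply: fH => //; exact: sK.
move=> k /fcov[k' [Kk' h]]; have [x xs Hx] := cov _ Kk'.
by exists (f x); [exact: map_f | apply: h => //; exact: sK].
Qed.

Lemma coset_reps_lmul K H s k :
  subgrp K -> K k -> coset_reps K H s -> coset_reps K H [seq k * x | x <- s].
Proof.
move=> gK Kk /coset_reps_map; apply.
- exact: mulgI.
- by case: gK => _ KM _ x; apply: KM.
- by move=> x y _ _; rewrite invgM -mulgA mulKg.
move=> k' Kk'; exists (k^-1 * k'); split; first exact: subgrpVM.
by move=> x _; rewrite invgM mulgA.
Qed.

Lemma coset_reps_rmul K H s k :
  subgrp K -> K k -> coset_reps K H s ->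
  coset_reps K [set x | H (k * x * k^-1)] [seq x * k | x <- s].
Proof.
move=> gK Kk /coset_reps_map; apply.
- exact: mulIg.
- by case: gK => _ KM _ x Kx; apply: KM.
- by move=> x y _ _ /=; rewrite !gsimp.
case: gK => _ KM KV k' Kk'; exists (k' * k^-1); split.
  by apply: KM => //; exact: KV.
by move=> x _ /=; rewrite !gsimp.
Qed.

Lemma coset_reps_inv K H s :
  subgrp K -> subgrp H -> (forall k h, K k -> H h -> H (k^-1 * h * k)) ->
  coset_reps K H s -> coset_reps K H [seq x^-1 | x <- s].
Proof.
move=> gK gH nH /coset_reps_map; case: (gK) (gH) => _ KM KV [_ HM HV]; apply.
- exact: invg_inj.
- by move=> x; apply: KV.
- move=> x y Kx Ky; rewrite invgK => Hxy.
  by have := nH _ _ Ky (HV _ Hxy); rewrite invgM invgK mulgA mulVg mul1g.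
move=> k Kk; exists (k^-1); split; first exact: KV.
move=> x Kx; rewrite invgK => Hxk.
by have := nH _ _ Kk (HV _ Hxk); rewrite !gsimp.
Qed.

Lemma coset_reps_mul K I H r s : subgrp I -> I `<=` K -> H `<=` I -> subgrp K ->
  coset_reps K I r -> coset_reps I H s ->
  coset_reps K H [seq x * y | x <- r, y <- s].
Proof.
move=> gI IK HI gK [ur rK rI covr] [us sI sH covs].
case: (gI) (gK) => _ IM IV [_ KM KV].
have key x y x' y' : x \in r -> y \in s -> x' \in r -> y' \in s ->
    H ((x * y)^-1 * (x' * y')) -> x = x' /\ y = y'.
  move=> xr ys xr' ys' h; have xx' : x = x'.
    apply: rI => //; have := IM _ _ (sI _ ys) (IM _ _ (HI _ h) (IV _ (sI _ ys'))).
    by rewrite invgM !mulgA mulgK mulgV mul1g.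
  split=> //; subst x'; apply: sH => //.
  by move: h; rewrite invgM mulgA -[_ * x^-1 * x]mulgA mulVg mulg1.
split.
- apply: allpairs_uniq => // -[x y] [x' y'] /allpairsP[[a b] [/= ar bs [-> ->]]].
  move=> /allpairsP[[a' b'] [/= ar' bs' [-> ->]]] /= e.
  have [|-> -> //] := key _ _ _ _ ar bs ar' bs'.
  (* [H 1] is read off the covering property: the representative of [b'] is [b'] itself. *)
  rewrite e; have := covs _ (sI _ bs') => -[z zs Hz].
  have zb : z = b'.
    apply: sH => //.
  by subst z; move: Hz; rewrite !mulVg.
- by move=> _ /allpairsP[[x y] [/= xr ys ->]]; apply: KM; [exact: rK|exact/IK/sI].
- move=> _ _ /allpairsP[[x y] [/= xr ys ->]] /allpairsP[[x' y'] [/= xr' ys' ->]] h.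
  by have [-> ->] := key _ _ _ _ xr ys xr' ys' h.
move=> k Kk; have [x xr Ix] := covr _ Kk; have [y ys Hy] := covs _ Ix.
by exists (x * y); [exact: allpairs_f | rewrite invgM -mulgA].
Qed.

Lemma coset_reps_sub K I H s : I `<=` K -> H `<=` I -> subgrp I ->
  coset_reps K H s -> coset_reps I H [seq x <- s | `[< I x >]].
Proof.
move=> IK HI gI [us sK sH cov]; split; first exact: filter_uniq.
- by move=> x; rewrite mem_filter => /andP[/asboolP].
- by move=> x y; rewrite !mem_filter => /andP[_ xs] /andP[_ ys]; apply: sH.
move=> k Ik; have [x xs Hx] := cov _ (IK _ Ik); exists x => //.
rewrite mem_filter xs andbT; apply/asboolP; case: gI => _ IM IV.
have := IM _ _ Ik (IV _ (HI _ Hx)); by rewrite invgM invgK mulVKg.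
Qed.

(** Greedy choice: a head lying in $K$ is kept, and the tail then has to cover only what is left of
    $K$ outside its coset. For this reason the induction generalises the set $K$. *)
Lemma coset_reps_cover K H (l : seq G) : subgrp H ->
  (forall k, K k -> exists2 x, x \in l & K x /\ H (x^-1 * k)) ->
  exists s, coset_reps K H s.
Proof.
move=> [H1 HM HV]; elim: l K => [|a l IH] K cov.
  exists [::]; split=> // k /cov[x]; by rewrite inE.
have [Ka|nKa] := pselect (K a); last first.
  apply: IH => k /cov[x]; rewrite inE => /predU1P[->|xl] [Kx Hx] //.
  by exists x.
have [|s [us sK sH scov]] := IH [set k | K k /\ ~ H (a^-1 * k)].
  move=> k [Kk nHk]; have [x] := cov _ Kk.
  rewrite inE => /predU1P[-> [//]|xl [Kx Hx]]; exists x => //; split=> //; split=> //.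
  by move=> Hax; apply: nHk; have := HM _ _ Hax Hx; rewrite !gsimp.
exists (a :: s); split.
- rewrite /= us andbT; apply/negP => /sK[_]; by rewrite mulVg.
- by move=> x; rewrite inE => /predU1P[->//|/sK[]].
- move=> x y; rewrite !inE => /predU1P[->|xs] /predU1P[->|ys] // h.
  + by have [_ /(_ h)] := sK _ ys.
  + by have [_ []] := sK _ xs; have := HV _ h; rewrite invgM invgK.
  + exact: sH.
move=> k Kk; have [h|h] := pselect (H (a^-1 * k)).
  by exists a; rewrite ?mem_head.
by have [x xs Hx] := scov _ (conj Kk h); exists x; rewrite // inE xs orbT.
Qed.

(** Sending each element of [s] to the element of [s'] in the same coset turns one list into a
    permutation of the other. This makes averages independent of the chosen transversal. *)
Lemma coset_reps_sum (V : nmodType) K H s s' (f : G -> V) : subgrp H ->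
  coset_reps K H s -> coset_reps K H s' ->
  (forall x h, K x -> H h -> f (x * h) = f x) ->
  (\sum_(x <- s) f x = \sum_(x <- s') f x)%R.
Proof.
move=> [H1 HM HV] [us sK sH scov] [us' sK' sH' scov'] fH.
pose e x := xget x [set y | y \in s' /\ H (y^-1 * x)].
have eP x : x \in s -> e x \in s' /\ H ((e x)^-1 * x).
  move=> xs; have [y ys' Hy] := scov' _ (sK _ xs).
  exact: (@xgetPex _ x [set y | y \in s' /\ H (y^-1 * x)]) (ex_intro _ y (conj ys' Hy)).
have -> : (\sum_(x <- s) f x = \sum_(x <- map e s) f x)%R.
  rewrite big_map big_seq [RHS]big_seq; apply: eq_bigr => x xs.
  have [es' Hex] := eP _ xs.
  by rewrite -[in LHS](mulVKg (e x) x) fH //; exact: sK'.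
apply: perm_big; apply: uniq_perm => //.
- rewrite map_inj_in_uniq // => x y xs ys exy; apply: sH => //.
  have [_ hx] := eP _ xs; have [_ hy] := eP _ ys.
  have := HM _ _ (HV _ hx) hy; by rewrite exy !gsimp.
move=> y; apply/mapP/idP => [[x xs ->]|ys']; first by case: (eP _ xs).
have [x xs Hx] := scov _ (sK' _ ys'); exists x => //.
have [es' Hex] := eP _ xs; apply: sH' => //.
have := HM _ _ (HV _ Hx) (HV _ Hex); by rewrite !gsimp.
Qed.

Lemma coset_reps_neq0 K H s : subgrp K -> coset_reps K H s -> (0 < size s)%N.
Proof. by move=> [K1 _ _] [_ _ _ /(_ _ K1)[x]]; case: s. Qed.

End Transversals.

Section Average.
Variables (G : groupType) (C : numFieldType).
Implicit Types (H I K : set G) (r s : seq G) (f : G -> C).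
Local Open Scope group_scope.

Definition rinv_on K H f := forall x h, K x -> H h -> f (x * h) = f x.

(* The default value of xget is used only if H has infinite index in K. *)
Definition avg K H f : C :=
  let s := xget [::] (coset_reps K H) in
  ((size s)%:R^-1 * \sum_(x <- s) f x)%R.

Lemma avgE K H s f : subgrp H -> coset_reps K H s -> rinv_on K H f ->
  avg K H f = ((size s)%:R^-1 * \sum_(x <- s) f x)%R.
Proof.
move=> gH ts fH; rewrite /avg; set s' := xget _ _.
have ts' : coset_reps K H s' by apply: xgetPex; exists s.
rewrite (coset_reps_sum gH ts' ts fH); congr (_^-1 * _)%R.
by rewrite -!sum1_size (coset_reps_sum gH ts' ts (f := fun=> 1%N)).
Qed.

(** Both averages run over the same list, since [avg] picks its transversal from [K] and [H] alone;
    linearity thus holds for functions without any invariance. *)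
Lemma avg_lin K H a f1 f2 :
  avg K H (fun x => a * f1 x + f2 x)%R = (a * avg K H f1 + avg K H f2)%R.
Proof.
rewrite /avg big_split /= mulrDr; congr (_ + _)%R.
by rewrite -mulr_sumr mulrCA.
Qed.

Lemma eq_avg K H s f1 f2 : coset_reps K H s ->
  (forall x, K x -> f1 x = f2 x) -> avg K H f1 = avg K H f2.
Proof.
move=> ts e; rewrite /avg; congr (_ * _)%R; set s' := xget _ _.
have [_ sK _ _] : coset_reps K H s' by apply: xgetPex; exists s.
by rewrite big_seq [RHS]big_seq; apply: eq_bigr => x /sK /e.
Qed.

Lemma avg_const K H s c : subgrp K -> coset_reps K H s -> avg K H (fun=> c) = c.
Proof.
move=> gK ts; rewrite /avg; set s' := xget _ _.
have ts' : coset_reps K H s' by apply: xgetPex; exists s.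
rewrite big_const_seq count_predT iter_addr addr0 -[(c *+ _)%R]mulr_natl mulKf //.
by rewrite pnatr_eq0 -lt0n (coset_reps_neq0 gK ts').
Qed.

Lemma avg_lmul K H s k f : subgrp K -> subgrp H -> coset_reps K H s -> K k ->
  rinv_on K H f -> avg K H (fun x => f (k * x)) = avg K H f.
Proof.
move=> gK gH ts Kk fH.
have fkH : rinv_on K H (fun x => f (k * x)).
  by case: gK => _ KM _ x h Kx Hh; rewrite mulgA [LHS]fH //; exact: KM.
rewrite (avgE gH ts fkH) (avgE gH (coset_reps_lmul gK Kk ts) fH).
by rewrite size_map big_map.
Qed.

Lemma avg_iter K I H r s f : subgrp K -> subgrp I -> subgrp H ->
  I `<=` K -> H `<=` I -> coset_reps K I r -> coset_reps K H s ->
  rinv_on K H f ->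
  avg K H f = ((size r)%:R^-1 * \sum_(x <- r) avg I H (fun i => f (x * i)%g))%R.
Proof.
move=> gK gI gH IK HI tr ts fH.
have ts' := coset_reps_sub IK HI gI ts; set s' := filter _ _ in ts'.
have trs := coset_reps_mul gI IK HI gK tr ts'.
rewrite (avgE gH trs fH) size_allpairs natrM invfM -mulrA; congr (_ * _)%R.
rewrite big_allpairs_dep mulr_sumr big_seq [RHS]big_seq; apply: eq_bigr => x xr.
rewrite (avgE gH ts') // => y h Iy Hh; rewrite mulgA [LHS]fH //.
by case: gK => _ KM _; apply: KM; [case: tr => _ /(_ _ xr)|exact: IK].
Qed.

Lemma avg_refine K I H r s f : subgrp K -> subgrp I -> subgrp H ->
  I `<=` K -> H `<=` I -> coset_reps K I r -> coset_reps K H s ->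
  rinv_on K I f -> avg K H f = avg K I f.
Proof.
move=> gK gI gH IK HI tr ts fI.
have fH : rinv_on K H f by move=> x h Kx /HI; apply: fI.
rewrite (avg_iter gK gI gH IK HI tr ts fH) (avgE gI tr fI); congr (_ * _)%R.
rewrite big_seq [RHS]big_seq; apply: eq_bigr => x xr.
have ts' := coset_reps_sub IK HI gI ts.
rewrite (eq_avg (f2 := fun=> f x) ts') ?(avg_const _ gI ts') // => i Ii.
by rewrite fI //; case: tr => _ /(_ _ xr).
Qed.

(** Right translation by $k$ turns a transversal of $K/H'$ into one of $K/k^{-1}H'k$, and $k^{-1}H'k
    \subseteq H$ is fine enough for [f]. Two levels occur because an element of [K1] need not
    normalise a congruence subgroup. *)
Lemma avg_rmul K H H' r s k f : subgrp K -> subgrp H -> subgrp H' ->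
  H `<=` K -> coset_reps K H r -> coset_reps K H' s -> K k ->
  (forall h, H' h -> H (k^-1 * h * k)) ->
  rinv_on K H f -> avg K H' (fun x => f (x * k)) = avg K H f.
Proof.
move=> gK gH gH' HK tr ts Kk kH fH; case: (gK) (gH') => K1 KM KV [H'1 H'M H'V].
have fkH : rinv_on K H' (fun x => f (x * k)).
  move=> x h Kx /kH Hh; have := fH _ _ (KM _ _ Kx Kk) Hh.
  by rewrite !gsimp.
have tsk := coset_reps_rmul gK Kk ts; set H'' := [set x | _] in tsk.
have gH'' : subgrp H''.
  split; rewrite /H'' /=; first by rewrite mulg1 mulgV.
  - move=> x y hx hy; have := H'M _ _ hx hy.
    by rewrite !gsimp.
  - by move=> x /H'V; rewrite !gsimp.
have HH'' : H'' `<=` H.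
  by move=> x /kH; rewrite !gsimp.
rewrite -(avg_refine gK gH gH'' HK HH'' tr tsk fH).
have fH'' : rinv_on K H'' f by move=> x h Kx /HH''; apply: fH.
by rewrite (avgE gH' ts fkH) (avgE gH'' tsk fH'') size_map big_map.
Qed.

Lemma avg_inv K H s f : subgrp K -> subgrp H ->
  (forall k h, K k -> H h -> H (k^-1 * h * k)) -> coset_reps K H s ->
  rinv_on K H f -> avg K H (fun x => f x^-1) = avg K H f.
Proof.
move=> gK gH nH ts fH; case: (gK) (gH) => K1 KM KV [H1 HM HV].
have fVH : rinv_on K H (fun x => f x^-1).
  move=> x h Kx Hh; rewrite invgM.
  have := nH _ _ (KV _ Kx) (HV _ Hh); rewrite invgK => /(fH _ _ (KV _ Kx)).
  by rewrite !gsimp.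
rewrite (avgE gH ts fVH) (avgE gH (coset_reps_inv gK gH nH ts) fH).
by rewrite size_map big_map.
Qed.

End Average.


(** * Discrete valuations *)

Section Valuation.
Variables (K : fieldType) (v : dvaluation K).
Implicit Types (x y : K) (m n : int).

Lemma dval1 : v 1 = 0.
Proof.
have := dvalM v (oner_neq0 K) (oner_neq0 K); rewrite mulr1 => /eqP.
by rewrite -subr_eq subrr => /eqP.
Qed.

Lemma dvalN x : v (- x) = v x.
Proof.
have [->|x0] := eqVneq x 0; first by rewrite oppr0.
have n1 : (-1 : K) != 0 by rewrite oppr_eq0 oner_neq0.
have h : v (-1) = 0.
  have := dvalM v n1 n1; rewrite mulrNN mulr1 dval1 => /esym/eqP.
  by rewrite -mulr2n mulrn_eq0 => /eqP.
by rewrite -mulN1r dvalM // h add0r.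
Qed.

Lemma dvalV x : x != 0 -> v x^-1 = - v x.
Proof.
move=> x0; apply/eqP; rewrite -addr_eq0 addrC -dvalM ?invr_eq0 //.
by rewrite divff // dval1.
Qed.

Lemma dval_div x y : x != 0 -> y != 0 -> v (x / y) = v x - v y.
Proof. by move=> x0 y0; rewrite dvalM ?invr_eq0 // dvalV. Qed.

Lemma dvalXz x m : x != 0 -> v (x ^ m) = m * v x.
Proof.
move=> x0; have hn (n : nat) : v (x ^+ n) = n%:Z * v x.
  elim: n => [|n IH]; first by rewrite expr0 dval1 mul0r.
  by rewrite exprS dvalM ?expf_neq0 // IH -addn1 PoszD mulrDl mul1r addrC.
case: m => n; first exact: hn.
rewrite NegzE -exprnN dvalV ?expf_neq0 // hn mulNr //.
Qed.

Lemma ppowP n x : x != 0 -> ppow v n x <-> n <= v x.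
Proof.
by move=> x0; split=> [[/eqP|//]|]; [rewrite (negPf x0) | right].
Qed.

Lemma ppow0 n : ppow v n 0. Proof. by left. Qed.

Lemma ppow1 : ppow v 0 1. Proof. by right; rewrite dval1. Qed.

Lemma ppowW m n x : m <= n -> ppow v n x -> ppow v m x.
Proof. by move=> mn [->|nx]; [left | right; apply: le_trans nx]. Qed.

Lemma ppowN n x : ppow v n x -> ppow v n (- x).
Proof. by case=> [->|h]; [rewrite oppr0; left | right; rewrite dvalN]. Qed.

Lemma ppowD n x y : ppow v n x -> ppow v n y -> ppow v n (x + y).
Proof.
have [->|x0] := eqVneq x 0; first by rewrite add0r.
have [->|y0] := eqVneq y 0; first by rewrite addr0.
have [->|xy0] := eqVneq (x + y) 0; first by left.
move=> /(ppowP _ x0) nx /(ppowP _ y0) ny; right.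
by apply: le_trans (dvalD v x0 y0 xy0); rewrite le_min nx.
Qed.

Lemma ppowB n x y : ppow v n x -> ppow v n y -> ppow v n (x - y).
Proof. by move=> hx /ppowN; apply: ppowD. Qed.

Lemma ppowBC n x y : ppow v n (x - y) -> ppow v n (y - x).
Proof. by move=> /ppowN; rewrite opprB. Qed.

Lemma ppowBt n x y z : ppow v n (x - y) -> ppow v n (y - z) -> ppow v n (x - z).
Proof. by move=> hx hy; have := ppowD hx hy; rewrite addrA subrK. Qed.

Lemma ppowM m n x y : ppow v m x -> ppow v n y -> ppow v (m + n) (x * y).
Proof.
have [->|x0] := eqVneq x 0; first by rewrite mul0r; left.
have [->|y0] := eqVneq y 0; first by rewrite mulr0; left.
move=> /(ppowP _ x0) nx /(ppowP _ y0) ny; right.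
by rewrite dvalM // lerD.
Qed.

Lemma ppowMl n x y : ppow v 0 x -> ppow v n y -> ppow v n (x * y).
Proof. by move=> hx hy; have := ppowM hx hy; rewrite add0r. Qed.

Lemma ppowMr n x y : ppow v n x -> ppow v 0 y -> ppow v n (x * y).
Proof. by move=> hx hy; rewrite mulrC; apply: ppowMl. Qed.

Lemma ppow_sum n (I : Type) (r : seq I) (f : I -> K) :
  (forall i, ppow v n (f i)) -> ppow v n (\sum_(i <- r) f i).
Proof. by move=> h; elim/big_rec: _ => [|i x _]; [left | apply: ppowD]. Qed.

Lemma ppow_unit_neq0 n x : ~ ppow v n x -> x != 0.
Proof. by move=> h; apply/eqP => x0; apply: h; left. Qed.

Lemma ppow1_unit x y : ~ ppow v 1 x -> ppow v 1 y -> ~ ppow v 1 (x + y).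
Proof. by move=> nx hy hxy; apply: nx; have := ppowB hxy hy; rewrite addrK. Qed.

Lemma dval_unit x : ppow v 0 x -> ~ ppow v 1 x -> x != 0 /\ v x = 0.
Proof.
move=> h0 h1; have x0 := ppow_unit_neq0 h1; split=> //.
move/(ppowP _ x0): h0 => h0; apply/eqP; rewrite eq_le h0 andbT leNgt.
by apply/negP => h; apply: h1; right.
Qed.

Lemma unit_ppow x : x != 0 -> v x = 0 -> ppow v 0 x /\ ~ ppow v 1 x.
Proof. by move=> x0 vx; split; [right; rewrite vx | move/(ppowP _ x0); rewrite vx]. Qed.

Lemma ppow_eq0 x : (forall n : nat, ppow v n%:Z x) -> x = 0.
Proof.
move=> h; apply/eqP; apply/negPn/negP => x0.
have /(ppowP _ x0) := h `|v x|%N.+1.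
rewrite leNgt; move/negP; apply; rewrite (le_lt_trans (ler_norm _)) //.
by rewrite -abszE ltz_nat.
Qed.

Definition residue_reps (s : seq K) : Prop :=
  [/\ uniq s, forall x, x \in s -> ppow v 0 x,
      forall x y, x \in s -> y \in s -> ppow v 1 (x - y) -> x = y &
      forall x, ppow v 0 x -> exists2 y, y \in s & ppow v 1 (x - y)].

Let coset x : set K := [set y | ppow v 1 (y - x)].

Lemma cosetE x y : ppow v 1 (x - y) -> coset x = coset y.
Proof.
move=> xy; apply/seteqP; split=> z /= h; first exact: ppowBt h xy.
exact: ppowBt h (ppowBC xy).
Qed.

Lemma residue_repsP s : residue_reps s ->
  finite_set (residue_field v) /\ residue_card v = size s.
Proof.
move=> [us s0 s1 cov].
have h : residue_field v = [set` [fset x in map coset s]%fset].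
  apply/seteqP; split=> A /=.
    move=> [x x0 ->]; have [y ys xy] := cov _ x0.
    by rewrite inE; apply/mapP; exists y => //; apply: cosetE.
  rewrite inE => /mapP[x xs ->]; exists x => //; exact: s0.
split; first by rewrite h; exact: finite_fset.
rewrite /residue_card h set_fsetK card_fseq undup_id ?size_map //.
rewrite map_inj_in_uniq // => x y xs ys cxy; apply: s1 => //.
have : coset x x by rewrite /coset /= subrr; left.
by rewrite cxy.
Qed.

Lemma residue_reps_exist : finite_set (residue_field v) ->
  exists s, residue_reps s.
Proof.
move=> fin; pose rep (A : set K) : K := xget 0 [set x | ppow v 0 x /\ A = coset x].
have repP A : residue_field v A -> ppow v 0 (rep A) /\ A = coset (rep A).
  move=> [x x0 eA]; apply: (xgetPex 0 (P := [set x | ppow v 0 x /\ A = coset x])).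
  by exists x.
have memP A : A \in fset_set (residue_field v) -> residue_field v A.
  by rewrite in_fset_set // inE.
exists (map rep (fset_set (residue_field v))); split.
- rewrite map_inj_in_uniq ?fset_uniq // => A B /memP/repP[_ eA] /memP/repP[_ eB] e.
  by rewrite eA eB e.
- by move=> _ /mapP[A /memP/repP[? _] ->].
- move=> _ _ /mapP[A /memP/repP[? eA] ->] /mapP[B /memP/repP[? eB] ->] h.
  by rewrite (_ : A = B) // eA eB; apply: cosetE.
move=> x x0; have Rx : residue_field v (coset x) by exists x.
exists (rep (coset x)); first by apply: map_f; rewrite in_fset_set // inE.
have [_ e] := repP _ Rx.
have cx : coset x x by rewrite /coset /= subrr; left.
suff : coset (rep (coset x)) x by [].
by rewrite -e.
Qed.

End Valuation.


(** * The unramified quadratic extension *)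

(** Division by $x$ reduces this to $1 + y/x$, a unit since $y/x$ lies in the maximal ideal. *)
Lemma dval_dom (K : fieldType) (v : dvaluation K) (x y : K) :
  x != 0 -> ppow v (v x + 1) y -> x + y != 0 /\ v (x + y) = v x.
Proof.
move=> x0 hy; have h1 : ppow v 1 (y / x).
  have := ppowM hy (_ : ppow v (- v x) x^-1); rewrite addrAC subrr add0r; apply.
  by right; rewrite dvalV.
have [||z0 vz] := @dval_unit _ v (1 + y / x).
- by apply: ppowD; [exact: ppow1 | apply: ppowW h1].
- apply: ppow1_unit => //; have [] // := unit_ppow (oner_neq0 K) (dval1 v).
have e : x + y = x * (1 + y / x) by field.
by split; [rewrite e mulf_neq0 | rewrite e dvalM // vz addr0].
Qed.

(** Everything used later about $E/F$. The element [delta] is a unit of trace zero, and by [un_anti]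
    the elements of trace zero form the line $F\delta$; [un_reps] and [un_repsE] say that the
    residue fields have $q$ and $q^2$ elements. *)
Record unram (F : fieldType) (E : splittingFieldType F) (vF : dvaluation F)
    (vE : dvaluation E) (sigma : gal_of {:E}) (varpi : F) (delta : E) : Prop := Unram {
  un_sigmaV : forall x, vE (sigma x) = vE x;
  un_sigmaK : forall x, sigma (sigma x) = x;
  un_sigmaF : forall a : F, sigma a%:A = a%:A;
  un_two : (2%:R : E) != 0 /\ vE 2%:R = 0;
  un_varpi : (varpi%:A : E) != 0 /\ vE varpi%:A = 1;
  un_delta : [/\ delta != 0, vE delta = 0 & sigma delta = - delta];
  un_anti : forall d, sigma d = - d -> exists s : F, d = s%:A * delta;
  un_vF : forall (n : int) (a : F), ppow vE n a%:A <-> ppow vF n a;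
  un_reps : exists s : seq F, residue_reps vF s /\ size s = residue_card vF;
  un_repsE : exists s : seq E, residue_reps vE s /\ size s = (residue_card vF ^ 2)%N;
  un_complete : complete_valuation vE
}.

Section UnramifiedQuadratic.
Variables (F : fieldType) (E : splittingFieldType F)
  (vF : dvaluation F) (vE : dvaluation E) (sigma : gal_of {:E})
  (p : nat) (varpi : F).
Hypothesis localF : nonarch_local_field vF.
Hypothesis res_p : residue_char vF p.
Hypothesis odd_p : odd p.
Hypothesis unramE : unramified_quadratic vF vE.
Hypothesis sigma_neq1 : sigma != 1%g.
Hypothesis varpi_neq0 : varpi != 0.
Hypothesis varpi_unif : vF varpi = 1.

Let dimE : \dim {:E} = 2%N := proj1 unramE.
Let vFE (x : F) : x != 0 -> vE x%:A = vF x := @proj2 _ _ unramE x.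

Let algF_eq0 (a : F) : (a%:A == 0 :> E) = (a == 0).
Proof. by rewrite scaler_eq0 oner_eq0 orbF. Qed.

Let ppowF n (a : F) : ppow vE n a%:A <-> ppow vF n a.
Proof.
have [->|a0] := eqVneq a 0; first by rewrite scale0r; split=> _; exact: ppow0.
by rewrite !ppowP ?algF_eq0 // vFE.
Qed.

Let two_unit : (2%:R : F) != 0 /\ vF 2%:R = 0.
Proof.
have p2 : ppow vF 0 (2%:R : F) by apply: ppowD; exact: ppow1.
apply: dval_unit => // h; case: res_p => _ hp.
have [_] := unit_ppow (oner_neq0 F) (dval1 vF); apply.
(* As $p$ is odd, 1 is an integral combination of $p$ and 2, so 2 cannot lie in the maximal ideal
   along with $p$. *)
have -> : (1 : F) = p%:R - p./2%:R * 2%:R.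
  rewrite -[p in p%:R]odd_double_half odd_p natrD -muln2 natrM /=.
  by rewrite addrK.
apply: ppowB => //; apply: ppowMl => //.
by elim: p./2 => [|n IH]; [exact: ppow0 | rewrite -natr1; apply: ppowD => //; exact: ppow1].
Qed.

Let twoE : (2%:R : E) = (2%:R : F)%:A. Proof. by rewrite scaler_nat. Qed.

Let two0 : (2%:R : E) != 0. Proof. by rewrite twoE algF_eq0; case: two_unit. Qed.

Let sigmaF (a : F) : sigma a%:A = a%:A.
Proof. by rewrite linearZ /= rmorph1. Qed.

Let fixed_dim : #|<[sigma]>%g| = 2%N /\ \dim (fixedField <[sigma]>%g) = 1%N.
Proof.
have h := dim_fixedField <[sigma]>%G.
have c1 : (1 < #|<[sigma]>%g|)%N by rewrite cardG_gt1 cycle_eq1.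
rewrite dimE in h; rewrite h in c1 *.
move: c1; case: (\dim (fixedField <[sigma]>%g)) => [|[|[|d]]] //.
Qed.

Let sigmaK x : sigma (sigma x) = x.
Proof.
have h : (sigma * sigma = 1)%g.
  by have [e _] := fixed_dim; have := expg_order sigma; rewrite orderE e.
by have := galM sigma sigma (memvf x); rewrite h gal_id => <-.
Qed.

Let fixedF x : sigma x = x -> exists a : F, x = a%:A.
Proof.
move=> sx; have [_ d1] := fixed_dim.
have e : (1%AS : {vspace E}) = fixedField <[sigma]>%g.
  by apply/eqP; rewrite eqEdim sub1v d1 dimv1.
have : x \in fixedField <[sigma]>%g.
  apply/fixedFieldP; first exact: memvf.
  move=> y /cycleP[n ->]; elim: n => [|n IH]; first by rewrite expg0 gal_id.
  by rewrite expgS galM ?memvf // sx IH.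
by rewrite -e => /vlineP[a ->]; exists a.
Qed.

(** The element $x - \sigma(x)$ has trace zero. A power of [varpi] turns it into a unit, because
    [varpi] is fixed by $\sigma$ and remains a uniformizer of $E$. *)
Let exists_delta : exists2 delta : E, delta != 0 & vE delta = 0 /\ sigma delta = - delta.
Proof.
have [x sx] : exists x, sigma x != x.
  apply/not_existsP => h; move/eqP: sigma_neq1; apply.
  apply/eqP/gal_eqP => x _; rewrite gal_id; apply/eqP/negPn/negP; exact: h.
pose y := x - sigma x; have y0 : y != 0 by rewrite subr_eq0 eq_sym.
have sy : sigma y = - y by rewrite rmorphB /= sigmaK opprB.
have w0 : (varpi%:A : E) != 0 by rewrite algF_eq0.
exists (y * varpi%:A ^ (- vE y)); first by rewrite mulf_neq0 // expfz_neq0.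
split; last by rewrite rmorphM fmorphXz /= sigmaF sy mulNr.
by rewrite dvalM ?expfz_neq0 // dvalXz // vFE // varpi_unif mulr1 addrN.
Qed.

Section Coordinates.
Variable delta : E.
Hypothesis delta0 : delta != 0.
Hypothesis vdelta : vE delta = 0.
Hypothesis sdelta : sigma delta = - delta.

Let anti d : sigma d = - d -> exists s : F, d = s%:A * delta.
Proof.
move=> sd; have [|s hs] := @fixedF (d / delta); last by exists s; rewrite -hs divfK.
by rewrite fmorph_div /= sd sdelta invrN mulrNN.
Qed.

Let coord x : exists a b : F, x = a%:A + b%:A * delta.
Proof.
have [|a ha] := @fixedF ((x + sigma x) / 2%:R).
  by rewrite fmorph_div rmorphD rmorph_nat /= sigmaK addrC.
have [|b hb] := @anti ((x - sigma x) / 2%:R).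
  by rewrite fmorph_div rmorphB rmorph_nat /= sigmaK -mulNr opprB.
by exists a, b; rewrite -ha -hb; field.
Qed.

(* If delta were congruent to an element of F, Newton's iteration for its
   square root would converge to delta in F. *)
Lemma delta_notin_oF (c : F) : ~ ppow vE 1 (delta - c%:A).
Proof.
move=> hc; have [|d hd] := @fixedF (delta * delta).
  by rewrite rmorphM /= sdelta mulrNN.
have [_ ndelta] := unit_ppow delta0 vdelta.
pose u n := iter n (fun c => (c + d / c) / 2%:R) c.
have uS n : u n.+1 = (u n + d / u n) / 2%:R by [].
have [two_neq0 vtwo] := two_unit.
have unit_c x : ppow vE 1 (delta - x%:A) -> x != 0 /\ vF x = 0.
  move=> hx; have nx : ~ ppow vE 1 x%:A.
    by move=> h; apply: ndelta; have := ppowD hx h; rewrite subrK.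
  apply: dval_unit; rewrite -ppowF //.
  have h : ppow vE 0 delta by right; rewrite vdelta.
  by have := ppowB h (ppowW ler01 hx); rewrite subKr.
have hu n : ppow vE n.+1%:Z (delta - (u n)%:A).
  elim: n => [|n IH]; first exact: hc.
  have [un0 vun] : u n != 0 /\ vF (u n) = 0 by apply: unit_c; apply: ppowW IH.
  have Un0 : ((u n)%:A : E) != 0 by rewrite algF_eq0.
  have -> : delta - (u n.+1)%:A =
      - ((delta - (u n)%:A) * (delta - (u n)%:A) / (2%:R * (u n)%:A)).
    rewrite uS; have -> : (((u n + d / u n) / 2%:R)%:A : E) =
        ((u n)%:A + delta * delta / (u n)%:A) / 2%:R.
      by rewrite hd twoE -!in_algE fmorph_div rmorphD fmorph_div.
    by field; rewrite two0 Un0.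
  apply: ppowN; apply: ppowMr; last first.
    right; rewrite dvalV ?mulf_neq0 // dvalM // twoE !vFE // vtwo vun.
    by rewrite addr0 oppr0.
  apply: ppowW (ppowM IH IH); rewrite -PoszD lez_nat; lia.
have [l hl] : exists l, forall n : int, exists N : nat,
    forall i, (N <= i)%N -> ppow vF n (u i - l).
  case: localF => cplt _; apply: cplt => n; exists `|n|%N => i j ni nj.
  rewrite -ppowF scalerBl.
  apply: (@ppowBt _ _ _ _ delta); first apply: ppowBC; apply: ppowW (hu _);
    by rewrite (le_trans (ler_norm _)) // -abszE lez_nat; lia.
have dl : delta = l%:A.
  apply/eqP; rewrite -subr_eq0; apply/eqP/(@ppow_eq0 _ vE) => n.
  have [N hN] := hl n; pose k := maxn n N.
  apply: (@ppowBt _ _ _ _ (u k)%:A); first by apply: ppowW (hu _); rewrite lez_nat; lia.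
  by rewrite -scalerBl ppowF; apply: hN; rewrite leq_maxr.
move: sdelta; rewrite dl sigmaF => /eqP; rewrite -addr_eq0 -mulr2n -mulr_natl.
by rewrite mulf_eq0 (negPf two0) -dl (negPf delta0).
Qed.

(** For non-zero $c$ in $F$ the valuation of $\delta + c$ is $\min(0, v(c))$; the case of a unit $c$
    is [delta_notin_oF]. This is even in $c$, while conjugation takes $b(\delta + c)$ to $-b(\delta
    - c)$. *)
Let sigmaV x : vE (sigma x) = vE x.
Proof.
have [a [b ->]] := coord x.
rewrite rmorphD rmorphM /= !sigmaF sdelta mulrN.
have [->|b0] := eqVneq b 0; first by rewrite scale0r mul0r subr0 addr0.
have B0 : (b%:A : E) != 0 by rewrite algF_eq0.
have h c : delta + c%:A != 0 /\ vE (delta + c%:A) = Num.min 0 (vE c%:A) \/ c = 0.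
  have [->|c0] := eqVneq c 0; [by right | left].
  have C0 : (c%:A : E) != 0 by rewrite algF_eq0.
  have [vc|vc] := leP 0 (vE c%:A).
    apply: dval_unit.
      by apply: ppowD; right; rewrite ?vdelta.
    rewrite -[c]opprK scaleNr; exact: delta_notin_oF.
  rewrite addrC; apply: dval_dom => //; right; rewrite vdelta lezD1 //.
have -> : (a%:A : E) + b%:A * delta = b%:A * (delta + (a / b)%:A).
  by rewrite -!in_algE fmorph_div /=; field.
have -> : (a%:A : E) - b%:A * delta = - (b%:A * (delta + (- (a / b))%:A)).
  by rewrite -!in_algE rmorphN fmorph_div /=; field.
rewrite dvalN; have [[x0 e1]|->] := h (a / b); last by rewrite oppr0.
have [[y0 e2]|/eqP] := h (- (a / b)).
  by rewrite !dvalM // e1 e2 scaleNr dvalN.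
by rewrite oppr_eq0 => /eqP ->; rewrite oppr0.
Qed.

Let ppow_sigma n x : ppow vE n x -> ppow vE n (sigma x).
Proof. by case=> [->|h]; [rewrite rmorph0; left | right; rewrite sigmaV]. Qed.

(** The coordinates are recovered from $x \pm \sigma(x)$ by dividing by the units 2 and $\delta$.
    Residue classes and limits in $E$ can then be handled coordinatewise. *)
Let ppow_coord n (a b : F) : ppow vE n (a%:A + b%:A * delta) <->
  ppow vF n a /\ ppow vF n b.
Proof.
have h2 : ppow vE 0 (2%:R : E)^-1.
  by right; rewrite dvalV // twoE vFE; case: two_unit => // _ ->.
have hd : ppow vE 0 delta by right; rewrite vdelta.
have hdV : ppow vE 0 delta^-1 by right; rewrite dvalV // vdelta.
split=> [h|[ha hb]]; last first.
  by apply: ppowD; [rewrite ppowF | apply: ppowMr => //; rewrite ppowF].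
have := ppow_sigma h; rewrite rmorphD rmorphM /= !sigmaF sdelta mulrN => h'.
split; rewrite -ppowF.
  have := ppowMr (ppowD h h') h2; by congr ppow; field.
have := ppowMr (ppowMr (ppowB h h') h2) hdV; congr ppow; field; exact/andP.
Qed.

Lemma unram_coordinates : unram vF vE sigma varpi delta.
Proof.
have w0 : (varpi%:A : E) != 0 by rewrite algF_eq0.
case: localF => cplt fin; have [s rs] := residue_reps_exist fin.
have [_ cs] := residue_repsP rs.
split=> //.
- by split=> //; rewrite twoE vFE; case: two_unit.
- by rewrite vFE.
- by exists s.
- case: (rs) => us s0 s1 cov.
  have key a b a' b' : ppow vE 1 ((a%:A + b%:A * delta) - (a'%:A + b'%:A * delta)) ->
      ppow vF 1 (a - a') /\ ppow vF 1 (b - b').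
    by move=> h; apply/ppow_coord; move: h; rewrite !scalerBl; congr ppow; ring.
  exists [seq a%:A + b%:A * delta | a <- s, b <- s]; split; last first.
    by rewrite size_allpairs cs.
  split.
  + apply: allpairs_uniq => // -[a b] [a' b'] /allpairsP[[x y] [/= xs ys [-> ->]]].
    move=> /allpairsP[[x' y'] [/= xs' ys' [-> ->]]] e.
    have [|ha hb] := key x y x' y'; first by rewrite e subrr; left.
    by rewrite (s1 x x') // (s1 y y').
  + move=> _ /allpairsP[[x y] [/= xs ys ->]]; apply/ppow_coord.
    by split; apply: s0.
  + move=> _ _ /allpairsP[[x y] [/= xs ys ->]] /allpairsP[[x' y'] [/= xs' ys' ->]].
    by move=> /key[ha hb]; rewrite (s1 x x') // (s1 y y').
  move=> x; have [a [b ->]] := coord x => /ppow_coord[ha hb].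
  have [a' as' ha'] := cov _ ha; have [b' bs' hb'] := cov _ hb.
  exists (a'%:A + b'%:A * delta); first exact: allpairs_f.
  have : ppow vE 1 ((a - a')%:A + (b - b')%:A * delta) by apply/ppow_coord.
  by rewrite !scalerBl; congr ppow; ring.
move=> u cu; have [a ha] := choice (fun i => coord (u i)); have [b hab] := choice ha.
have hu i j n : ppow vE n (u i - u j) -> ppow vF n (a i - a j) /\ ppow vF n (b i - b j).
  move=> h; apply/ppow_coord; move: h.
  by rewrite !hab !scalerBl; congr ppow; ring.
have [|la hla] := cplt a.
  by move=> n; have [N hN] := cu n; exists N => i j ni nj; case: (hu i j n (hN _ _ ni nj)).
have [|lb hlb] := cplt b.
  by move=> n; have [N hN] := cu n; exists N => i j ni nj; case: (hu i j n (hN _ _ ni nj)).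
exists (la%:A + lb%:A * delta) => n.
have [Na ha'] := hla n; have [Nb hb'] := hlb n; exists (maxn Na Nb) => i.
rewrite geq_max => /andP[/ha' h1 /hb' h2].
have : ppow vE n ((a i - la)%:A + (b i - lb)%:A * delta) by apply/ppow_coord.
by rewrite hab !scalerBl; congr ppow; ring.
Qed.

End Coordinates.

Lemma unram_exists : exists delta, unram vF vE sigma varpi delta.
Proof.
have [delta d0 [vd sd]] := exists_delta.
by exists delta; apply: unram_coordinates.
Qed.

End UnramifiedQuadratic.


(** * The unitary group in three variables *)

Lemma ord3P (P : 'I_3 -> Prop) : P 0 -> P 1 -> P 2%:R -> forall i, P i.
Proof.
move=> h0 h1 h2 [[|[|[|//]]] h]; [move: h0|move: h1|move: h2];
  by congr P; apply: val_inj.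
Qed.

Lemma sum3 (V : nmodType) (f : 'I_3 -> V) : \sum_j f j = f 0 + f 1 + f 2%:R.
Proof.
by rewrite !big_ord_recl big_ord0 addr0 addrA; congr (f _ + f _ + f _); apply: val_inj.
Qed.

Lemma mx3E (A : Type) (a00 a01 a02 a10 a11 a12 a20 a21 a22 : A) :
  let M := mx3 a00 a01 a02 a10 a11 a12 a20 a21 a22 in
  ((M 0 0 = a00) * (M 0 1 = a01) * (M 0 2%:R = a02) *
  (M 1 0 = a10) * (M 1 1 = a11) * (M 1 2%:R = a12) *
  (M 2%:R 0 = a20) * (M 2%:R 1 = a21) * (M 2%:R 2%:R = a22))%type.
Proof. by do !split; rewrite mxE. Qed.

Lemma rev3 : ((rev_ord (0 : 'I_3) = 2%:R) * (rev_ord (1 : 'I_3) = 1) *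
  (rev_ord (2%:R : 'I_3) = 0))%type.
Proof. by do !split; apply: val_inj. Qed.

Section UnitaryElements.
Variables (F : fieldType) (E : splittingFieldType F) (sigma : gal_of {:E}).
Hypothesis sigmaK : forall x, sigma (sigma x) = x.
Implicit Types (g h : U3 sigma) (y z a c : E).

Lemma U3M g h i j :
  (g * h)%g i j = g i 0 * h 0 j + g i 1 * h 1 j + g i 2%:R * h 2%:R j.
Proof. by rewrite -(sum3 (fun k => g i k * h k j)) [LHS]mxE. Qed.

Lemma U3_1 i j : (1%g : U3 sigma) i j = (i == j)%:R.
Proof. by rewrite [LHS]mxE. Qed.

(** This is $g^{-1} = J\,{}^t\overline{g}J$. No determinant occurs, and $g^{-1}$ satisfies the same
    integrality bounds as $g$ up to reflection in the antidiagonal. *)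
Lemma U3V g i j : (g^-1)%g i j = sigma (g (rev_ord j) (rev_ord i)).
Proof.
pose A : 'M[E]_3 := \matrix_(i, j) sigma (g (rev_ord j) (rev_ord i)).
suff -> : U3val (g^-1)%g = A by rewrite mxE.
have -> : U3val (g^-1)%g = invmx g by [].
have gu : U3val g \in unitmx by case: g @A => g /= /andP[].
suff e : A *m g = 1%:M by rewrite -[A]mulmx1 -(mulmxV gu) mulmxA e mul1mx.
have /eqP/matrixP gJ : (map_mx sigma g)^T *m J3 E *m g == J3 E.
  by case: g @A gu => g /= /andP[].
apply/matrixP => k; have := gJ (rev_ord k); move: k; apply: ord3P => hk;
  apply: ord3P; [have := hk 0|have := hk 1|have := hk 2%:R|have := hk 0|
  have := hk 1|have := hk 2%:R|have := hk 0|have := hk 1|have := hk 2%:R];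
  rewrite !mxE !sum3 !mxE !sum3 !mxE !rev3 /= => e; apply: (etrans _ e); ring.
Qed.

Lemma col_rel g i j : sigma (g 2%:R (rev_ord i)) * g 0 j +
  sigma (g 1 (rev_ord i)) * g 1 j + sigma (g 0 (rev_ord i)) * g 2%:R j = (i == j)%:R.
Proof. by rewrite -U3_1 -(mulVg g) U3M !U3V !rev3. Qed.

Lemma row_rel g i j : g i 0 * sigma (g (rev_ord j) 2%:R) +
  g i 1 * sigma (g (rev_ord j) 1) + g i 2%:R * sigma (g (rev_ord j) 0) = (i == j)%:R.
Proof. by rewrite -U3_1 -(mulgV g) U3M !U3V !rev3. Qed.

Lemma U3P g h : (forall i j, g i j = h i j) -> g = h.
Proof. by move=> e; apply: val_inj; apply/matrixP. Qed.

Lemma U3insub (M : 'M[E]_3) : (map_mx sigma M)^T *m J3 E *m M = J3 E ->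
  U3val (insubd (U3one sigma) M) = M.
Proof.
move=> e; rewrite insubdK // unfold_in /unitary_mx e eqxx andbT.
have JJ : J3 E *m J3 E = 1%:M.
  by apply/matrixP; apply: ord3P; apply: ord3P; rewrite !mxE !sum3 !mxE /=; ring.
have : J3 E *m ((map_mx sigma M)^T *m J3 E) *m M = 1%:M by rewrite -mulmxA e.
by case/mulmx1_unit.
Qed.

(** Unipotent, Weyl and torus elements. The default value of [insubd] is avoided under the
    conditions of [nlowE], [nupE], [welE] and [telE]; for the unipotents the condition [isotropic]
    says that $(z, -\overline{y}, 1)$ is an isotropic row. *)
Definition nlow y z : U3 sigma := insubd (U3one sigma) (mx3 1 0 0 y 1 0 z (- sigma y) 1).
Definition nup y z : U3 sigma := insubd (U3one sigma) (mx3 1 (- sigma y) z 0 1 y 0 0 1).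
Definition wel c : U3 sigma := insubd (U3one sigma) (mx3 0 0 c^-1 0 1 0 c 0 0).
Definition tel a : U3 sigma := insubd (U3one sigma) (mx3 a 0 0 0 1 0 0 0 (sigma a)^-1).

Definition isotropic y z : Prop := z + sigma z + y * sigma y = 0.

Let conj1 : sigma 1 = 1. Proof. exact: rmorph1. Qed.
Let conj0 : sigma 0 = 0. Proof. exact: rmorph0. Qed.

Lemma nlowE y z : isotropic y z ->
  nlow y z = mx3 1 0 0 y 1 0 z (- sigma y) 1 :> 'M[E]_3.
Proof.
move=> yz; have sz : sigma z = - z - y * sigma y.
  by rewrite -[RHS]add0r -yz; ring.
apply: U3insub; apply/matrixP; apply: ord3P; apply: ord3P;
  rewrite !mxE !sum3 !mxE !sum3 !mxE /= ?conj1 ?conj0 ?rmorphN /= ?sigmaK ?sz; ring.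
Qed.

Lemma nupE y z : isotropic y z ->
  nup y z = mx3 1 (- sigma y) z 0 1 y 0 0 1 :> 'M[E]_3.
Proof.
move=> yz; have sz : sigma z = - z - y * sigma y.
  by rewrite -[RHS]add0r -yz; ring.
apply: U3insub; apply/matrixP; apply: ord3P; apply: ord3P;
  rewrite !mxE !sum3 !mxE !sum3 !mxE /= ?conj1 ?conj0 ?rmorphN /= ?sigmaK ?sz; ring.
Qed.

Lemma welE c : c != 0 -> sigma c = c ->
  wel c = mx3 0 0 c^-1 0 1 0 c 0 0 :> 'M[E]_3.
Proof.
move=> c0 sc; apply: U3insub; apply/matrixP; apply: ord3P; apply: ord3P;
  rewrite !mxE !sum3 !mxE !sum3 !mxE /= ?conj1 ?conj0 ?fmorphV /= ?sc; by field.
Qed.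

Lemma telE a : a != 0 ->
  tel a = mx3 a 0 0 0 1 0 0 0 (sigma a)^-1 :> 'M[E]_3.
Proof.
move=> a0; have sa0 : sigma a != 0 by rewrite fmorph_eq0.
apply: U3insub; apply/matrixP; apply: ord3P; apply: ord3P;
  rewrite !mxE !sum3 !mxE !sum3 !mxE /= ?conj1 ?conj0 ?fmorphV /= ?sigmaK;
  field; rewrite ?a0 ?sa0 //.
Qed.

Lemma tel_mull a g j : a != 0 -> (((tel a * g)%g 0 j = (a * g 0 j)%R) *
  ((tel a * g)%g 1 j = g 1 j) * ((tel a * g)%g 2%:R j = ((sigma a)^-1 * g 2%:R j)%R))%type.
Proof. by move=> a0; rewrite !U3M !telE // !mx3E !mul0r !mul1r !addr0 !add0r. Qed.

Lemma tel_mulr a g i : a != 0 -> (((g * tel a)%g i 0 = (g i 0 * a)%R) *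
  ((g * tel a)%g i 1 = g i 1) * ((g * tel a)%g i 2%:R = (g i 2%:R * (sigma a)^-1)%R))%type.
Proof. by move=> a0; rewrite !U3M !telE // !mx3E !mulr0 !mulr1 !addr0 !add0r. Qed.

Lemma telM a c : a != 0 -> c != 0 -> (tel a * tel c)%g = tel (a * c).
Proof.
move=> a0 c0; apply: U3P => i; apply: ord3P; rewrite tel_mulr // !telE ?mulf_neq0 //;
  move: i; apply: ord3P; rewrite !mx3E ?mul0r ?mul1r //.
by rewrite rmorphM /= invfM.
Qed.

Lemma welM c a : c != 0 -> sigma c = c -> a != 0 -> sigma a = a ->
  (wel c * wel a)%g = tel (c^-1 * a).
Proof.
move=> c0 sc a0 sa; apply: U3P; apply: ord3P; apply: ord3P;
  rewrite U3M !welE // telE ?mulf_neq0 ?invr_eq0 // !mx3E ?mul0r ?mulr0 ?mulr1 ?addr0 ?add0r //.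
by rewrite rmorphM fmorphV /= sc sa invfM invrK.
Qed.

Lemma row2_isotropic g : g 2%:R 0 * sigma (g 2%:R 2%:R) +
  g 2%:R 1 * sigma (g 2%:R 1) + g 2%:R 2%:R * sigma (g 2%:R 0) = 0.
Proof. by have := row_rel g 2%:R 0; rewrite !rev3. Qed.

Lemma row2_neq0 g : ~ (forall j, g 2%:R j = 0).
Proof.
move=> h; have := row_rel g 2%:R 2%:R; rewrite !h !mul0r !addr0 eqxx.
by move/eqP; rewrite eq_sym oner_eq0.
Qed.

(** $B$ is the stabiliser of the isotropic line of $(0,0,1)$: orthogonality of rows kills the
    remaining entry below the diagonal. *)
Lemma borel_row2 g : g 2%:R 0 = 0 -> g 2%:R 1 = 0 ->
  [/\ borel g, g 2%:R 2%:R != 0 & g 0 0 = (sigma (g 2%:R 2%:R))^-1].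
Proof.
move=> g0 g1; have g2 : g 2%:R 2%:R != 0.
  by apply/eqP => g2; apply: (@row2_neq0 g); apply: ord3P.
have sg2 : sigma (g 2%:R 2%:R) != 0 by rewrite fmorph_eq0.
split=> //.
  have := row_rel g 2%:R 1; rewrite !rev3 g0 g1 !mul0r !add0r /= => /eqP.
  rewrite mulf_eq0 (negPf g2) fmorph_eq0 => /= /eqP g10.
  by apply: ord3P; apply: ord3P => //=.
have := row_rel g 0 0; rewrite !rev3 g1 g0 rmorph0 !mulr0 !addr0 eqxx => e.
by apply: (mulIf sg2); rewrite mulVf.
Qed.

Lemma borel_entries g : borel g -> [/\ g 1 0 = 0, g 2%:R 0 = 0 & g 2%:R 1 = 0].
Proof. by move=> b; split; apply: b. Qed.

(** Allows cosets $Bg$ to be replaced by isotropic lines; the torus entry found here determines the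
    factor by which a function of the induced representation changes. *)
Lemma row2_prop g h c : c != 0 -> (forall j, g 2%:R j = c * h 2%:R j) ->
  borel (g * h^-1)%g /\ (g * h^-1)%g 0 0 = (sigma c)^-1.
Proof.
move=> c0 e; have r j : (g * h^-1)%g 2%:R j = c * (2%:R == j)%:R.
  by rewrite -U3_1 -(mulgV h) !U3M !e; ring.
have [| | b _] := @borel_row2 (g * h^-1)%g; try by rewrite r mulr0.
by rewrite r mulr1.
Qed.

End UnitaryElements.


(** * Compact open subgroups *)

Section CongruenceSubgroups.
Variables (F : fieldType) (E : splittingFieldType F) (vF : dvaluation F)
  (v : dvaluation E) (sigma : gal_of {:E}) (varpi : F) (delta : E).
Hypothesis un : unram vF v sigma varpi delta.
Implicit Types (g h k : U3 sigma) (M N : 'M[E]_3) (m n : int).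

Local Notation w := (varpi%:A : E).
Let sigmaK := un_sigmaK un.
Let sigmaF := un_sigmaF un.
Let sigmaV := un_sigmaV un.
Let w_neq0 : w != 0 := proj1 (un_varpi un).
Let vw : v w = 1 := proj2 (un_varpi un).
Let two0 : (2%:R : E) != 0 := proj1 (un_two un).
Let conj1 : sigma 1 = 1. Proof. exact: rmorph1. Qed.

Lemma ppow_half n x : ppow v n x -> ppow v n (x / 2%:R).
Proof. by move=> h; apply: ppowMr => //; right; rewrite dvalV // (proj2 (un_two un)). Qed.

Lemma ppow_conj n x : ppow v n (sigma x) <-> ppow v n x.
Proof.
have h y : ppow v n y -> ppow v n (sigma y).
  by case=> [->|h]; [rewrite rmorph0; left | right; rewrite sigmaV].
by split=> [/h|/h //]; rewrite sigmaK.
Qed.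

(** The valuation of $x\overline{x}$ is the even number $2v(x)$, so a lower bound for it may be
    rounded up; hence the [+ 1]. *)
Lemma norm_ppow m n x : ppow v n (x * sigma x) -> 2 * m <= n + 1 -> ppow v m x.
Proof.
have [->|x0] := eqVneq x 0; first by left.
have sx0 : sigma x != 0 by rewrite fmorph_eq0.
rewrite !ppowP ?mulf_neq0 // dvalM // sigmaV => h1 h2.
by rewrite -(@ler_pM2l _ 2) //; lia.
Qed.

Lemma ppow_varpi n : ppow v n (w ^ n).
Proof. by right; rewrite dvalXz // vw mulr1. Qed.

Lemma conj_varpi n : sigma (w ^ n) = w ^ n.
Proof. by rewrite fmorphXz /= sigmaF. Qed.

Lemma ppow_delta n (s : F) : ppow v n (s%:A * delta) <-> ppow vF n s.
Proof.
have [d0 vd _] := un_delta un; rewrite -(un_vF un); split=> h.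
  rewrite -[s%:A](mulfK d0); apply: ppowMr => //; right; rewrite dvalV // vd //.
by apply: ppowMr => //; right; rewrite vd.
Qed.

Lemma isotropicN y z : isotropic sigma y z -> sigma z = - z - y * sigma y.
Proof. by move=> yz; rewrite -[RHS]add0r -yz; ring. Qed.

Definition mxpow n M : Prop := forall i j, ppow v n (M i j).

Lemma mxpowW m n M : m <= n -> mxpow n M -> mxpow m M.
Proof. by move=> mn h i j; apply: ppowW (h i j). Qed.

Lemma mxpowD n M N : mxpow n M -> mxpow n N -> mxpow n (M + N).
Proof. by move=> hM hN i j; rewrite mxE; apply: ppowD. Qed.

Lemma mxpowN n M : mxpow n M -> mxpow n (- M).
Proof. by move=> hM i j; rewrite mxE; apply: ppowN. Qed.

Lemma mxpowM m n M N : mxpow m M -> mxpow n N -> mxpow (m + n) (M *m N).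
Proof. by move=> hM hN i j; rewrite mxE; apply: ppow_sum => k; apply: ppowM. Qed.

Lemma mxpow_conjT n M : mxpow n M -> mxpow n (map_mx sigma M)^T.
Proof. by move=> h i j; rewrite !mxE ppow_conj. Qed.

Lemma mxpow1 : mxpow 0 (1%:M : 'M[E]_3).
Proof. by move=> i j; rewrite mxE; case: (i == j); [exact: ppow1 | exact: ppow0]. Qed.

Lemma mxpow_inv n g : mxpow n g -> mxpow n (g^-1)%g.
Proof. by move=> h i j; rewrite U3V // ppow_conj. Qed.

Lemma mxpow_bound M : exists n : nat, mxpow (- n%:Z) M.
Proof.
exists (\max_(ij : 'I_3 * 'I_3) `|v (M ij.1 ij.2)|)%N => i j; right.
have : (`|v (M i j)| <= \max_(ij : 'I_3 * 'I_3) `|v (M ij.1 ij.2)|)%N.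
  exact: (@leq_bigmax _ (fun ij : 'I_3 * 'I_3 => `|v (M ij.1 ij.2)|%N) (i, j)).
lia.
Qed.

Definition Kexp (e : 'M[int]_3) : set (U3 sigma) :=
  [set g | forall i j, ppow v (e i j) (g i j)].

(** The three conditions give the identity, products, and inverses in the form of [U3V]. *)
Lemma Kexp_subgrp (e : 'M[int]_3) : (forall i, e i i <= 0) ->
  (forall i j l, e i l <= e i j + e j l) ->
  (forall i j, e i j <= e (rev_ord j) (rev_ord i)) -> subgrp (Kexp e).
Proof.
move=> e0 eM eV; split=> [i j|g h Kg Kh i j|g Kg i j].
- rewrite U3_1; have [->|_] := eqVneq i j; last exact: ppow0.
  exact: ppowW (ppow1 v).
- rewrite U3M; do 2 ?apply: ppowD; exact: ppowW (ppowM (Kg _ _) (Kh _ _)).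
- by rewrite U3V // ppow_conj; apply: ppowW (Kg _ _).
Qed.

Definition K0 : set (U3 sigma) := [set g | mxpow 0 g].
(* The Iwahori subgroup, and a maximal compact subgroup containing K_1. *)
Definition Iw := Kexp (mx3 0 0 0  1 0 0  1 1 0).
Definition K1 := Kexp (mx3 0 0 (-1)  1 0 0  1 1 0).
(* The conjugate of K_2 by diag(varpi, 1, varpi^-1), a subgroup of K0. *)
Definition K2 : set (U3 sigma) :=
  [set g | Kexp (mx3 0 1 0  1 0 1  0 1 0) g /\ ppow v 2 (g 1 1 - 1)].
Definition Gam (m : nat) : set (U3 sigma) := [set g | mxpow m%:Z (U3val g - 1%:M)].

Lemma K0_subgrp : subgrp K0.
Proof.
split=> [|g h hg hh|g]; [exact: mxpow1 | | exact: mxpow_inv].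
by have := mxpowM hg hh; rewrite add0r.
Qed.

Lemma Iw_subgrp : subgrp Iw.
Proof.
by apply: Kexp_subgrp; do ?apply: ord3P; rewrite !mxE.
Qed.

Lemma K1_subgrp : subgrp K1.
Proof.
by apply: Kexp_subgrp; do ?apply: ord3P; rewrite !mxE.
Qed.

Lemma K2_subgrp : subgrp K2.
Proof.
have [k1 kM kV] : subgrp (Kexp (mx3 0 1 0  1 0 1  0 1 0)).
  by apply: Kexp_subgrp; do ?apply: ord3P; rewrite !mxE.
split.
- by split=> //; rewrite U3_1 subrr; left.
- move=> g h [Kg g1] [Kh h1]; split; first exact: kM.
  rewrite U3M; have -> : g 1 0 * h 0 1 + g 1 1 * h 1 1 + g 1 2%:R * h 2%:R 1 - 1 =
    g 1 0 * h 0 1 + g 1 2%:R * h 2%:R 1 + ((g 1 1 - 1) * h 1 1 + (h 1 1 - 1)) by ring.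
  have p11 : 1 + 1 = 2 :> int by [].
  apply: ppowD; last apply: ppowD => //.
    by apply: ppowD; [have := ppowM (Kg 1 0) (Kh 0 1) | have := ppowM (Kg 1 2%:R) (Kh 2%:R 1)];
      rewrite !mx3E p11.
  by apply: ppowMr => //; have := Kh 1 1; rewrite mx3E.
- move=> g [Kg g1]; split; first exact: kV.
  by rewrite U3V // !rev3 (_ : sigma _ - 1 = sigma (g 1 1 - 1)) ?ppow_conj // rmorphB rmorph1.
Qed.

Lemma GamE (m : nat) g : Gam m g <->
  forall i j, ppow v m%:Z (g i j - (i == j)%:R).
Proof.
by split=> h i j; have := h i j; rewrite !mxE.
Qed.

Lemma Gam_subgrp (m : nat) : subgrp (Gam m).
Proof.
split.
- by move=> i j; rewrite subrr mxE; left.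
- move=> g h hg hh; rewrite /Gam /= (_ : U3val (g * h)%g - 1%:M =
    (U3val g - 1%:M) *m (U3val h - 1%:M) + (U3val g - 1%:M) + (U3val h - 1%:M)).
    do 2 ?apply: mxpowD => //; apply: mxpowW (mxpowM hg hh); lia.
  rewrite (_ : U3val (g * h)%g = U3val g *m U3val h) //.
  rewrite mulmxBl !mulmxBr !mul1mx !mulmx1; apply/matrixP => i j; rewrite !mxE; ring.
- move=> g /GamE hg; apply/GamE => i j; rewrite U3V //.
  rewrite -(rmorph_nat sigma) -rmorphB ppow_conj.
  by have := hg (rev_ord j) (rev_ord i); rewrite (inj_eq rev_ord_inj) eq_sym.
Qed.

Lemma GamW (m n : nat) : (m <= n)%N -> Gam n `<=` Gam m.
Proof. by move=> mn g; apply: mxpowW; rewrite lez_nat. Qed.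

Lemma Gam_close (m : nat) (a : int) g h : mxpow a g ->
  mxpow (m%:Z - a) (U3val h - U3val g) -> Gam m (g^-1 * h)%g.
Proof.
move=> ga hg; rewrite /Gam /=.
have -> : U3val (g^-1 * h)%g - 1%:M = U3val (g^-1)%g *m (U3val h - U3val g).
  rewrite mulmxBr; congr (_ - _); have -> : (1%:M : 'M[E]_3) = U3val (g^-1 * g)%g by rewrite mulVg.
  by [].
have := mxpowM (mxpow_inv ga) hg; by rewrite addrC subrK.
Qed.

(** By [U3V] both $g$ and $g^{-1}$ have entries in $p^{-a}$, whence a loss of $2a$ levels. *)
Lemma Gam_conj (m m' : nat) (a : int) g h : mxpow (- a) g -> Gam m h ->
  m'%:Z + 2 * a <= m%:Z -> Gam m' (g^-1 * h * g)%g.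
Proof.
move=> ga hh am; rewrite /Gam /=.
have -> : U3val (g^-1 * h * g)%g - 1%:M = U3val (g^-1)%g *m (U3val h - 1%:M) *m U3val g.
  rewrite mulmxBr mulmxBl mulmx1; congr (_ - _).
  have -> : (1%:M : 'M[E]_3) = U3val (g^-1 * g)%g by rewrite mulVg.
  by [].
apply: mxpowW (mxpowM (mxpowM (mxpow_inv ga) hh) ga); lia.
Qed.

Lemma Gam_normal (m : nat) g h : K0 g -> Gam m h -> Gam m (g^-1 * h * g)%g.
Proof. by move=> Kg /(@Gam_conj m m 0 g h); rewrite oppr0; apply=> //; lia. Qed.

Lemma Gam_K0 (m : nat) : Gam m `<=` K0.
Proof.
move=> g /GamE h i j; rewrite -[g i j](subrK (i == j)%:R).
apply: ppowD; first by apply: ppowW (h i j).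
by case: (i == j); [exact: ppow1 | exact: ppow0].
Qed.

Lemma Iw_K0 : Iw `<=` K0.
Proof.
move=> g h i j; apply: ppowW (h i j); move: i j.
by apply: ord3P; apply: ord3P; rewrite mxE.
Qed.

Lemma Iw_K1 : Iw `<=` K1.
Proof.
move=> g h i j; apply: ppowW (h i j); move: i j.
by apply: ord3P; apply: ord3P; rewrite !mxE.
Qed.

Lemma K2_K0 : K2 `<=` K0.
Proof.
move=> g [h _] i j; apply: ppowW (h i j); move: i j.
by apply: ord3P; apply: ord3P; rewrite !mxE.
Qed.

Lemma Gam_Iw (m : nat) : (0 < m)%N -> Gam m `<=` Iw.
Proof.
move=> m0 g Gg; have g1 := Gam_K0 Gg; move/GamE: Gg => Gg.
apply: ord3P; apply: ord3P; rewrite mx3E; (try exact: g1).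
- by have := Gg 1 0; rewrite subr0; apply: ppowW; lia.
- by have := Gg 2%:R 0; rewrite subr0; apply: ppowW; lia.
- by have := Gg 2%:R 1; rewrite subr0; apply: ppowW; lia.
Qed.

Lemma Gam_K2 (m : nat) : (1 < m)%N -> Gam m `<=` K2.
Proof.
move=> m0 g Gg; have g1 := Gam_K0 Gg; move/GamE: Gg => Gg; split; last first.
  by have := Gg 1 1; apply: ppowW; lia.
apply: ord3P; apply: ord3P; rewrite mx3E; (try exact: g1).
- by have := Gg 0 1; rewrite subr0; apply: ppowW; lia.
- by have := Gg 1 0; rewrite subr0; apply: ppowW; lia.
- by have := Gg 1 2%:R; rewrite subr0; apply: ppowW; lia.
- by have := Gg 2%:R 1; rewrite subr0; apply: ppowW; lia.
Qed.

Lemma oE_cover (m : nat) : exists S : seq E,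
  forall x, ppow v 0 x -> exists2 y, y \in S & ppow v m%:Z (x - y).
Proof.
have [s [[_ _ _ cov] _]] := un_repsE un.
elim: m => [|m [S hS]]; first by exists [:: 0] => x hx; exists 0; rewrite ?inE ?subr0.
exists [seq y + w ^ m%:Z * z | y <- S, z <- s] => x /hS[y yS hy].
have h0 : ppow v 0 ((x - y) * w ^ (- m%:Z)).
  by have := ppowM hy (ppow_varpi (- m%:Z)); rewrite subrr.
have [z zs hz] := cov _ h0; exists (y + w ^ m%:Z * z); first exact: allpairs_f.
have := ppowM (ppow_varpi m%:Z) hz.
rewrite mulrBr mulrCA -expfzDr // subrr expr0z mulr1 -addn1 PoszD.
by congr ppow; ring.
Qed.

Lemma K0_Gam_coset_reps (m : nat) : exists s, coset_reps K0 (Gam m) s.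
Proof.
have [S hS] := oE_cover m.
(* A matrix [c] of residues modulo $p^m$ need not come from a unitary matrix. If [P c] is empty,
   [xget] returns 1, a harmless extra member of the covering list. *)
pose P (c : {ffun 'I_3 * 'I_3 -> 'I_(size S)}) : set (U3 sigma) :=
  [set k | K0 k /\ forall i j, ppow v m%:Z (k i j - nth 0 S (c (i, j)))].
apply: (@coset_reps_cover _ _ _
  [seq xget 1%g (P c) | c <- enum {: {ffun 'I_3 * 'I_3 -> 'I_(size S)}}]).
  exact: Gam_subgrp.
move=> k Kk; have : forall ij : 'I_3 * 'I_3, exists n : 'I_(size S),
    ppow v m%:Z (k ij.1 ij.2 - nth 0 S n).
  move=> [i j]; have [y yS hy] := hS _ (Kk i j).
  by exists (Ordinal (etrans (index_mem y S) yS)); rewrite /= nth_index.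
move=> /fin_all_exists[c hc]; have Pk : P (finfun c) k.
  by split=> // i j; rewrite ffunE; exact: (hc (i, j)).
exists (xget 1%g (P (finfun c))).
  by apply: map_f; rewrite mem_enum.
have [Kx hx] : P (finfun c) (xget 1%g (P (finfun c))) by apply: xgetPex; exists k.
split=> //; apply: (@Gam_close m 0) => //; rewrite subr0 => i j; rewrite !mxE.
have [_ hk] := Pk; apply: ppowBt (hk i j) (ppowBC (hx i j)).
Qed.

Lemma Gam_coset_reps (m : nat) (K : set (U3 sigma)) : subgrp K ->
  K `<=` K0 -> Gam m `<=` K -> exists s, coset_reps K (Gam m) s.
Proof.
move=> gK KK0 GK; have [s ts] := K0_Gam_coset_reps m.
by eexists; apply: coset_reps_sub ts.
Qed.

Lemma nlow_K0 y z : isotropic sigma y z -> ppow v 0 y -> ppow v 0 z -> K0 (nlow sigma y z).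
Proof.
move=> yz hy hz; rewrite /K0 /= nlowE //; apply: ord3P; apply: ord3P; rewrite mx3E //;
  (try exact: ppow0); (try exact: ppow1).
by apply: ppowN; rewrite ppow_conj.
Qed.

Lemma nup_K0 y z : isotropic sigma y z -> ppow v 0 y -> ppow v 0 z -> K0 (nup sigma y z).
Proof.
move=> yz hy hz; rewrite /K0 /= nupE //; apply: ord3P; apply: ord3P; rewrite mx3E //;
  (try exact: ppow0); (try exact: ppow1).
by apply: ppowN; rewrite ppow_conj.
Qed.

Lemma wel1E : wel sigma 1 = mx3 0 0 1 0 1 0 1 0 0 :> 'M[E]_3.
Proof. by rewrite welE ?invr1 // oner_neq0. Qed.

Lemma wel1_K0 : K0 (wel sigma 1).
Proof.
rewrite /K0 /= wel1E; apply: ord3P; apply: ord3P; rewrite mx3E;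
  (try exact: ppow0); exact: ppow1.
Qed.

Lemma welwE : wel sigma w = mx3 0 0 w^-1 0 1 0 w 0 0 :> 'M[E]_3.
Proof. by rewrite welE. Qed.

Lemma welw_K1 : K1 (wel sigma w).
Proof.
have hw := ppow_varpi 1; have hwV := ppow_varpi (-1).
rewrite /K1 /Kexp /= welwE; apply: ord3P; apply: ord3P; rewrite !mx3E //;
  (try exact: ppow0); exact: ppow1.
Qed.

(* For given y, the solutions z of isotropic y z, parametrized by s in F. *)
Definition zpar y (s : F) : E := - (y * sigma y) / 2%:R + s%:A * delta.

Lemma isotropic_zpar y s : isotropic sigma y (zpar y s).
Proof.
have [_ _ sd] := un_delta un.
rewrite /isotropic /zpar rmorphD fmorph_div rmorphN !rmorphM rmorph_nat /= sigmaK.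
by rewrite sigmaF sd; field.
Qed.

Lemma zpar_ex y z : isotropic sigma y z -> exists s, z = zpar y s.
Proof.
move=> yz; have [|s hs] := un_anti un (d := z + y * sigma y / 2%:R).
  rewrite rmorphD fmorph_div !rmorphM rmorph_nat /= sigmaK (isotropicN yz); by field.
by exists s; rewrite /zpar -hs; field.
Qed.

Lemma zpar_ppow y s : ppow v 0 y -> ppow vF 0 s -> ppow v 0 (zpar y s).
Proof.
move=> hy hs; apply: ppowD; last by rewrite ppow_delta.
by apply/ppow_half/ppowN/ppowMl; rewrite ?ppow_conj.
Qed.

(** Membership in the Iwahori subgroup can be read off the first column: $g_{00}$ is a unit, as
    otherwise the whole column would lie in $p$, and orthogonality of columns 0 and 1 then puts
    $g_{21}$ in $p$. *)
Lemma Iw_col0 g : K0 g -> ppow v 1 (g 1 0) -> ppow v 1 (g 2%:R 0) -> Iw g.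
Proof.
move=> Kg g10 g20; have unit0 : ~ ppow v 1 (g 0 0).
  move=> g00; have [_] := unit_ppow (oner_neq0 E) (dval1 v); apply.
  have := col_rel g 0 0; rewrite rev3 eqxx mulr1n => <-.
  do 2?apply: ppowD; apply: ppowMl => //; rewrite ?ppow_conj //.
have [g0 v0] := dval_unit (Kg 0 0) unit0.
have sg0 : sigma (g 0 0) != 0 by rewrite fmorph_eq0.
apply: ord3P; apply: ord3P; rewrite mx3E //.
have -> : g 2%:R 1 = - (sigma (g 2%:R 0) * g 0 1 + sigma (g 1 0) * g 1 1) / sigma (g 0 0).
  have := col_rel g 2%:R 1; rewrite rev3 => e.
  apply: (mulIf sg0); rewrite divfK // -[RHS]add0r -[X in X - _]e; ring.
apply: ppowMr; last by right; rewrite dvalV // sigmaV v0.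
by apply: ppowN; apply: ppowD; apply: ppowMr => //; rewrite ppow_conj.
Qed.

(** Modulo $p$ the first columns are isotropic lines over the residue field of $E$: affine points
    $(1,y,z)$, with $q^2$ choices of $y$ and $q$ of the trace-zero part of $z$, and the point
    $(0,0,1)$ at infinity, represented by the Weyl element. *)
Lemma K0_Iw_coset_reps sE sF : residue_reps v sE -> residue_reps vF sF ->
  coset_reps K0 Iw (wel sigma 1 :: [seq nlow sigma y (zpar y s) | y <- sE, s <- sF]).
Proof.
move=> [uE oE dE covE] [uF oF dF covF].
have nE y s := nlowE sigmaK (isotropic_zpar y s).
have one1 : ~ ppow v 1 1 by case: (unit_ppow (oner_neq0 E) (dval1 v)).
have [d0 _ _] := un_delta un.
have zinj y s s' : zpar y s = zpar y s' -> s = s'.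
  by move/addrI/(mulIf d0)/(fmorph_inj (GRing.in_alg E)).
have key y s k : (((nlow sigma y (zpar y s))^-1 * k)%g 1 0 = k 1 0 - y * k 0 0) *
    (((nlow sigma y (zpar y s))^-1 * k)%g 2%:R 0 =
     sigma (zpar y s) * k 0 0 + sigma y * k 1 0 + k 2%:R 0).
  split; rewrite U3M !U3V // !rev3 nE !mx3E ?rmorphN ?rmorph1 ?rmorph0 /= ?sigmaK; ring.
have wkey k : (((wel sigma 1)^-1 * k)%g 1 0 = k 1 0) *
   (((wel sigma 1)^-1 * k)%g 2%:R 0 = k 0 0).
  split; rewrite U3M !U3V // !rev3 wel1E !mx3E ?rmorph1 ?rmorph0 /=; ring.
split.
- rewrite /=; apply/andP; split.
    apply/negP => /allpairsP[[y s] [/= _ _ /(congr1 (fun g : U3 sigma => g 0 0))]].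
    by rewrite wel1E nE !mx3E => /eqP; rewrite eq_sym oner_eq0.
  apply: allpairs_uniq => // -[y s] [y' s'] _ _ /= e.
  have yy : y = y' by move/(congr1 (fun g : U3 sigma => g 1 0)): e; rewrite !nE !mx3E.
  subst y'; move/(congr1 (fun g : U3 sigma => g 2%:R 0)): e; rewrite !nE !mx3E.
  by move/zinj => ->.
- move=> x; rewrite inE => /predU1P[->|]; first exact: wel1_K0.
  move=> /allpairsP[[y s] [/= ys ss ->]]; apply: nlow_K0; first exact: isotropic_zpar.
    exact: oE.
  by apply: zpar_ppow; [exact: oE | exact: oF].
- move=> x x'; rewrite !inE => /predU1P[->|/allpairsP[[y s] [/= ys ss ->]]]
    /predU1P[->|/allpairsP[[y' s'] [/= ys' ss' ->]]] // h.
  + by have := h 2%:R 0; rewrite wkey nE !mx3E => /one1.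
  + by have := h 2%:R 0; rewrite key wel1E !mx3E !mulr0 !add0r => /one1.
  have yy : y = y'.
    by apply: dE => //; apply: ppowBC; have := h 1 0; rewrite key nE !mx3E mulr1.
  subst y'; rewrite (dF s s') //; apply: ppowBC.
  have := h 2%:R 0; rewrite key nE !mx3E (isotropicN (isotropic_zpar y s)).
  by rewrite -ppow_delta scalerBl; congr ppow; rewrite /zpar; ring.
move=> k Kk; have [a1|a1] := pselect (ppow v 1 (k 0 0)).
  exists (wel sigma 1); first exact: mem_head.
  apply: Iw_col0; rewrite ?wkey //.
    by case: K0_subgrp => _ KM KV; apply: KM => //; apply: KV wel1_K0.
  apply: (norm_ppow (n := 1)) => //; have := col_rel k 2%:R 0; rewrite rev3 => e.
  have -> : k 1 0 * sigma (k 1 0) = - (sigma (k 2%:R 0) * k 0 0 + sigma (k 0 0) * k 2%:R 0).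
    by rewrite -[RHS]add0r -[X in X - _]e; ring.
  apply: ppowN; apply: ppowD; first by apply: ppowMl => //; rewrite ppow_conj.
  by apply: ppowMr => //; rewrite ppow_conj.
have [a0 va] := dval_unit (Kk 0 0) a1.
have sa0 : sigma (k 0 0) != 0 by rewrite fmorph_eq0.
have aV : ppow v 0 (k 0 0)^-1 by right; rewrite dvalV // va.
pose b := k 1 0 / k 0 0; pose c := k 2%:R 0 / k 0 0.
have ob : ppow v 0 b by apply: ppowMl.
have oc : ppow v 0 c by apply: ppowMl.
have ibc : isotropic sigma b c.
  have := col_rel k 2%:R 0; rewrite rev3 => e.
  rewrite /isotropic; have -> : (0 : E) = 0 / (k 0 0 * sigma (k 0 0)) by rewrite mul0r.
  rewrite -[X in X / _]e /b /c !fmorph_div /=; field; exact/andP.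
have [s0 es0] := zpar_ex ibc.
have [y ys hy] := covE _ ob.
have os0 : ppow vF 0 s0.
  rewrite -ppow_delta; have -> : s0%:A * delta = c + b * sigma b / 2%:R.
    by rewrite es0 /zpar; field.
  by apply: ppowD => //; apply/ppow_half/ppowMl; rewrite ?ppow_conj.
have [s ss hs] := covF _ os0.
exists (nlow sigma y (zpar y s)).
  by rewrite inE (allpairs_f (fun y s => nlow sigma y (zpar y s)) ys ss) orbT.
have e1 : k 1 0 = b * k 0 0 by rewrite divfK.
have e2 : k 2%:R 0 = c * k 0 0 by rewrite divfK.
have oy := oE _ ys.
apply: Iw_col0; rewrite ?key.
- case: K0_subgrp => _ KM KV; apply: KM => //; apply: KV; apply: nlow_K0 => //.
    exact: isotropic_zpar.
  by apply: zpar_ppow => //; exact: oF.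
- by rewrite e1 -mulrBl; apply: ppowMr.
rewrite e1 e2 es0 (isotropicN (isotropic_zpar y s)) /zpar.
(* The difference of the two norm terms is split so that each summand contains $s_0 - s$, $b - y$ or
   the conjugate of the latter, all lying in the maximal ideal. *)
have -> : (- (- (y * sigma y) / 2%:R + s%:A * delta) - y * sigma y) * k 0 0 +
   sigma y * (b * k 0 0) + (- (b * sigma b) / 2%:R + s0%:A * delta) * k 0 0 =
   ((s0 - s)%:A * delta + ((b - y) * sigma y +
     b * (sigma y - sigma b)) / 2%:R) * k 0 0.
  by rewrite scalerBl; field.
apply: ppowMr => //; apply: ppowD; first by rewrite ppow_delta.
apply/ppow_half/ppowD; first by apply: ppowMr; rewrite ?ppow_conj.
by apply: ppowMl => //; rewrite -rmorphB ppow_conj; apply: ppowBC.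
Qed.

End CongruenceSubgroups.

Arguments Kexp {F E} v {sigma} e _.
Arguments K0 {F E} v {sigma} _.
Arguments Iw {F E} v {sigma} _.
Arguments K1 {F E} v {sigma} _.
Arguments K2 {F E} v {sigma} _.
Arguments Gam {F E} v {sigma} m _.


(** * Iwasawa decomposition and generation of $G$ by compact subgroups *)

Section Decompositions.
Variables (F : fieldType) (E : splittingFieldType F) (vF : dvaluation F)
  (v : dvaluation E) (sigma : gal_of {:E}) (varpi : F) (delta : E).
Hypothesis un : unram vF v sigma varpi delta.
Implicit Types (g h k : U3 sigma) (m n : int).

Local Notation w := (varpi%:A : E).
Let sigmaK := un_sigmaK un.
Let sigmaF := un_sigmaF un.
Let sigmaV := un_sigmaV un.
Let w_neq0 : w != 0 := proj1 (un_varpi un).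
Let vw : v w = 1 := proj2 (un_varpi un).
Let two0 : (2%:R : E) != 0 := proj1 (un_two un).
Let conj1 : sigma 1 = 1. Proof. exact: rmorph1. Qed.
Let conj0 : sigma 0 = 0. Proof. exact: rmorph0. Qed.

(** Inside [K1] the Iwahori subgroup is cut out by integrality of the upper right entry. This gives
    $q + 1$ cosets, the points of a projective line over the residue field of $F$. *)
Lemma K1_Iw_coset_reps sF : residue_reps vF sF ->
  coset_reps (K1 v) (Iw v)
    (wel sigma w :: [seq nup sigma 0 (s%:A / w * delta) | s <- sF]).
Proof.
move=> [uF oF dF covF]; have [d0 vd sd] := un_delta un.
have iso s : isotropic sigma 0 (s%:A / w * delta).
  by rewrite /isotropic rmorphM fmorph_div /= !sigmaF sd; ring.
have nE s := nupE sigmaK (iso s).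
have wVp : ~ ppow v 0 w^-1.
  by rewrite ppowP ?invr_eq0 // dvalV // vw.
have key s k : ((nup sigma 0 (s%:A / w * delta))^-1 * k)%g 0 2%:R =
    k 0 2%:R - (s%:A / w * delta) * k 2%:R 2%:R.
  rewrite U3M !U3V // !rev3 nE !mx3E ?conj1 ?conj0 rmorphM fmorph_div /= !sigmaF sd; ring.
have wkey k : ((wel sigma w)^-1 * k)%g 0 2%:R = w^-1 * k 2%:R 2%:R.
  by rewrite U3M !U3V // !rev3 (welwE un) !mx3E ?conj1 ?conj0 fmorphV /= sigmaF; ring.
have ppow_s n (s : F) : ppow v n (s%:A / w * delta) <-> ppow vF (n + 1) s.
  rewrite -(un_vF un); split=> h.
    rewrite (_ : s%:A = s%:A / w * delta * (w / delta)); last by field; exact/andP.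
    by apply: ppowM => //; right; rewrite dval_div // vw vd.
  rewrite -(addrK 1 n) -mulrA; apply: ppowM => //; right.
  by rewrite dvalM ?invr_eq0 // dvalV // vd vw addr0.
have Iw_of g : K1 v g -> ppow v 0 (g 0 2%:R) -> Iw v g.
  move=> Kg h; apply: ord3P; apply: ord3P; [have := Kg 0 0 | have := Kg 0 1 |
    have := Kg 0 2%:R | have := Kg 1 0 | have := Kg 1 1 | have := Kg 1 2%:R |
    have := Kg 2%:R 0 | have := Kg 2%:R 1 | have := Kg 2%:R 2%:R]; by rewrite !mx3E.
have nup_K1 s : ppow vF 0 s -> K1 v (nup sigma 0 (s%:A / w * delta)).
  move=> os; rewrite /K1 /Kexp /= nE; apply: ord3P; apply: ord3P;
    rewrite !mx3E ?conj0 ?oppr0 //; (try exact: ppow0); (try exact: ppow1).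
  by rewrite ppow_s.
have K1g := K1_subgrp un.
split.
- rewrite /= map_inj_uniq ?uF ?andbT.
    apply/negP => /mapP[s _ /(congr1 (fun g : U3 sigma => g 0 0))].
    by rewrite (welwE un) nE !mx3E => /eqP; rewrite eq_sym oner_eq0.
  move=> s s' /(congr1 (fun g : U3 sigma => g 0 2%:R)); rewrite !nE !mx3E.
  by move/(mulIf d0)/(divIf w_neq0)/(fmorph_inj (GRing.in_alg E)).
- move=> x; rewrite inE => /predU1P[->|/mapP[s ss ->]]; first exact: (welw_K1 un).
  by apply: nup_K1; exact: oF.
- move=> x x'; rewrite !inE => /predU1P[->|/mapP[s ss ->]]
    /predU1P[->|/mapP[s' ss' ->]] // h.
  + by have := h 0 2%:R; rewrite wkey nE !mx3E mulr1 => /wVp.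
  + by have := h 0 2%:R; rewrite key (welwE un) !mx3E mulr0 subr0 => /wVp.
  rewrite (dF s s') //; apply: ppowBC.
  have := h 0 2%:R; rewrite key nE !mx3E mulr1 => h2.
  by apply/(ppow_s 0); move: h2; rewrite scalerBl; congr ppow; ring.
move=> k Kk; have o22 : ppow v 0 (k 2%:R 2%:R) by have := Kk 2%:R 2%:R; rewrite mx3E.
have o12 : ppow v 0 (k 1 2%:R) by have := Kk 1 2%:R; rewrite mx3E.
have [a1|a1] := pselect (ppow v 1 (k 2%:R 2%:R)).
  exists (wel sigma w); first exact: mem_head.
  apply: Iw_of; first exact: (subgrpVM K1g (welw_K1 un)).
  rewrite wkey -(addNr 1); apply: ppowM => //.
  by right; rewrite dvalV // vw.
have [a0 va] := dval_unit o22 a1.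
have sa0 : sigma (k 2%:R 2%:R) != 0 by rewrite fmorph_eq0.
have aV : ppow v 0 (k 2%:R 2%:R)^-1 by right; rewrite dvalV // va.
pose b := k 1 2%:R / k 2%:R 2%:R; pose c := k 0 2%:R / k 2%:R 2%:R.
have ob : ppow v 0 b by apply: ppowMl.
have oc : ppow v (-1) c.
  by apply: ppowMr => //; have := Kk 0 2%:R; rewrite mx3E.
have ibc : isotropic sigma b c.
  have := col_rel k 0 2%:R; rewrite rev3 => e.
  rewrite /isotropic.
  have -> : (0 : E) = 0 / (k 2%:R 2%:R * sigma (k 2%:R 2%:R)) by rewrite mul0r.
  rewrite -[X in X / _]e /b /c !fmorph_div /=; field; exact/andP.
have [s0 es0] := zpar_ex un ibc.
(* Only the trace-zero part of $c = -b\overline{b}/2 + s_0\delta$ can have a pole, since $b$ is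
   integral; an element of $F$ is therefore enough to remove it. *)
have nb : ppow v 0 (b * sigma b / 2%:R).
  by apply: (ppow_half un); apply: ppowMl; rewrite ?(ppow_conj un).
have os0 : ppow vF (-1) s0.
  rewrite -(ppow_delta un); have -> : s0%:A * delta = c + b * sigma b / 2%:R.
    by rewrite es0 /zpar; field.
  by apply: ppowD => //; apply: ppowW nb.
have os1 : ppow vF 0 (s0 * varpi).
  have w1 : ppow vF 1 varpi by rewrite -(un_vF un); right; rewrite vw.
  by have := ppowM os0 w1; rewrite addNr.
have [s ss hs] := covF _ os1.
exists (nup sigma 0 (s%:A / w * delta)).
  by rewrite inE (map_f (fun s => nup sigma 0 (s%:A / w * delta)) ss) orbT.
apply: Iw_of; first by apply: (subgrpVM K1g) => //; apply: nup_K1; exact: oF.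
have e2 : k 0 2%:R = c * k 2%:R 2%:R by rewrite divfK.
rewrite key e2 -mulrBl; apply: ppowMr => //.
have -> : c - s%:A / w * delta =
    - (b * sigma b / 2%:R) + (s0 * varpi - s)%:A / w * delta.
  have e3 : (s0 * varpi)%:A = s0%:A * w by rewrite -!in_algE rmorphM.
  by rewrite es0 /zpar scalerBl e3; field; exact/andP.
by apply: ppowD; [exact: ppowN | rewrite ppow_s].
Qed.

Lemma row2_nlow g : g 2%:R 2%:R != 0 ->
  let y := - sigma (g 2%:R 1 / g 2%:R 2%:R) in let z := g 2%:R 0 / g 2%:R 2%:R in
  isotropic sigma y z /\ forall j, g 2%:R j = g 2%:R 2%:R * nlow sigma y z 2%:R j.
Proof.
have := row2_isotropic g.
set X := g 2%:R 0; set Y := g 2%:R 1; set Z := g 2%:R 2%:R => iso Z0 y z.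
have sZ0 : sigma Z != 0 by rewrite fmorph_eq0.
have i1 : isotropic sigma y z.
  rewrite /isotropic rmorphN /= sigmaK.
  have -> : (0 : E) = 0 / (Z * sigma Z) by rewrite mul0r.
  rewrite -[X in X / _]iso /y /z !fmorph_div /=; field; exact/andP.
split=> //; apply: ord3P; rewrite nlowE // !mx3E ?rmorphN /= ?sigmaK ?opprK ?mulr1 //;
  by rewrite -/X -/Y mulrC divfK.
Qed.

Lemma row2_nup g : g 2%:R 0 != 0 ->
  let y := - sigma (g 2%:R 1 / g 2%:R 0) in let z := g 2%:R 2%:R / g 2%:R 0 in
  isotropic sigma y z /\ forall j, g 2%:R j = g 2%:R 0 * nup sigma y z 0 j.
Proof.
have := row2_isotropic g.
set X := g 2%:R 0; set Y := g 2%:R 1; set Z := g 2%:R 2%:R => iso X0 y z.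
have sX0 : sigma X != 0 by rewrite fmorph_eq0.
have i1 : isotropic sigma y z.
  rewrite /isotropic rmorphN /= sigmaK.
  have -> : (0 : E) = 0 / (X * sigma X) by rewrite mul0r.
  rewrite -[X in X / _]iso /y /z !fmorph_div /=; field; exact/andP.
split=> //; apply: ord3P; rewrite nupE // !mx3E ?rmorphN /= ?sigmaK ?opprK ?mulr1 //;
  by rewrite -/Y -/Z mulrC divfK.
Qed.

Lemma isotropic_ppow n m y z : isotropic sigma y z -> ppow v n z -> 2 * m <= n + 1 ->
  ppow v m y.
Proof.
move=> yz hz; apply: (norm_ppow un).
have -> : y * sigma y = - z - sigma z by rewrite (isotropicN yz); ring.
by apply: ppowB; [exact: ppowN | rewrite (ppow_conj un)].
Qed.

(** Either the ratio of the outer coordinates lies in $p^n$, or its inverse lies in $p^{1-n}$;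
    isotropy bounds the middle coordinate. The case $n = 0$ serves the Iwasawa decomposition for
    [K0], the case $n = 1$ the functions fixed by $K_1$. *)
Lemma row2_split n g : 0 <= n -> n <= 1 ->
  (exists c y z, [/\ c != 0, isotropic sigma y z, ppow v n y, ppow v n z &
     forall j, g 2%:R j = c * nlow sigma y z 2%:R j]) \/
  (exists c y z, [/\ c != 0, isotropic sigma y z, ppow v (1 - n) y, ppow v (1 - n) z &
     forall j, g 2%:R j = c * nup sigma y z 0 j]).
Proof.
move=> n0 n1; have h2 : 2 * (1 - n) <= 1 - n + 1 by lia.
have h1 : 2 * n <= n + 1 by lia.
have [Z0|Z0] := eqVneq (g 2%:R 2%:R) 0.
  have X0 : g 2%:R 0 != 0.
    apply/eqP => X0; apply: (@row2_neq0 _ _ _ g); apply: ord3P => //; apply/eqP.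
    have /eqP := row2_isotropic g; rewrite X0 Z0 !mul0r addr0 add0r.
    by rewrite mulf_eq0 fmorph_eq0 orbb.
  have [iso e] := row2_nup X0; right; do 3 eexists; split; first exact: X0.
  - exact: iso.
  - by apply: isotropic_ppow iso _ h2; rewrite Z0 mul0r; left.
  - by rewrite Z0 mul0r; left.
  - exact: e.
have [h|h] := pselect (ppow v n (g 2%:R 0 / g 2%:R 2%:R)).
  have [iso e] := row2_nlow Z0; left; do 3 eexists; split; first exact: Z0.
  - exact: iso.
  - exact: isotropic_ppow iso h h1.
  - exact: h.
  - exact: e.
have X0 : g 2%:R 0 != 0 by apply/eqP => X0; apply: h; rewrite X0 mul0r; left.
have hz : ppow v (1 - n) (g 2%:R 2%:R / g 2%:R 0).
  right; move: h; rewrite ppowP ?mulf_neq0 ?invr_eq0 // !dval_div // => /negP.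
  by rewrite -ltNge; lia.
have [iso e] := row2_nup X0; right; do 3 eexists; split; first exact: X0.
- exact: iso.
- exact: isotropic_ppow iso hz h2.
- exact: hz.
- exact: e.
Qed.

Lemma wel1_mul_row2 h j : (wel sigma 1 * h)%g 2%:R j = h 0 j.
Proof. by rewrite U3M wel1E !mx3E; ring. Qed.

Lemma Iwasawa g : exists b k, [/\ borel b, K0 v k & g = (b * k)%g].
Proof.
have h k c : K0 v k -> c != 0 -> (forall j, g 2%:R j = c * k 2%:R j) ->
    exists b k, [/\ borel b, K0 v k & g = (b * k)%g].
  move=> Kk c0 /(row2_prop c0)[bb _]; exists (g * k^-1)%g, k; split=> //.
  by rewrite mulgVK.
have [[c [y [z [c0 iso hy hz e]]]]|[c [y [z [c0 iso hy hz e]]]]] :=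
    @row2_split 0 g isT isT.
  by apply: h c0 e; apply: (nlow_K0 un).
apply: (h (wel sigma 1 * nup sigma y z)%g c) => //.
  by case: (K0_subgrp un) => _ KM _; apply: KM;
    [exact: wel1_K0 | apply: (nup_K0 un) => //; [apply: ppowW hy|apply: ppowW hz]].
by move=> j; rewrite wel1_mul_row2.
Qed.

Lemma tel_wM m n : (tel sigma (w ^ m) * tel sigma (w ^ n))%g = tel sigma (w ^ (m + n)).
Proof. by rewrite telM ?expfz_neq0 // -expfzDr. Qed.

Lemma tel_w0 : tel sigma (w ^ 0) = 1%g.
Proof.
apply: U3P; apply: ord3P; apply: ord3P;
  by rewrite U3_1 telE ?expfz_neq0 // !mx3E ?expr0z ?conj1 ?invr1.
Qed.

(** Only products are available in [P]; both signs of torus powers come from multiplying the two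
    Weyl elements in either order. *)
Lemma generation (P : set (U3 sigma)) : (forall g h, P g -> P h -> P (g * h)%g) ->
  K0 v `<=` P -> P (wel sigma w) -> forall g, P g.
Proof.
move=> PM K0P Pw; have P1 := K0P _ (wel1_K0 v sigma).
have tw1 : tel sigma (w ^ 1) = (wel sigma 1 * wel sigma w)%g.
  by rewrite welM ?oner_neq0 // invr1 mul1r expr1z.
have twN1 : tel sigma (w ^ (-1)) = (wel sigma w * wel sigma 1)%g.
  by rewrite welM ?oner_neq0 // mulr1 exprN1.
have Ptn (n : nat) : P (tel sigma (w ^ n%:Z)) /\ P (tel sigma (w ^ (- n%:Z))).
  elim: n => [|n [IH1 IH2]].
    by have [one _ _] := K0_subgrp un; rewrite oppr0 tel_w0; split; apply: K0P.
  rewrite -addn1 PoszD opprD -!tel_wM tw1 twN1.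
  by split; apply: (PM _ _) => //; apply: (PM _ _).
have Pt n : P (tel sigma (w ^ n)).
  by case: (intP n) => [|m|m]; [have [] := Ptn 0%N|have [] := Ptn m.+1|have [] := Ptn m.+1].
move=> g; have [b [k [bb Kk ->]]] := Iwasawa g; apply: (PM _ _ _ (K0P _ Kk)).
have [b10 b20 b21] := borel_entries bb.
have [_ b22 b00] := borel_row2 b20 b21.
have sb22 : sigma (b 2%:R 2%:R) != 0 by rewrite fmorph_eq0.
have [N hN] := mxpow_bound un b.
(* The power $w^{-i}$ makes the diagonal of $b$ integral, and a large $j$ contracts its unipotent
   part: $j$ and $j - i$ both exceed the bound $N$ on the denominators. *)
pose i := v (b 0 0); pose j : int := N%:Z + `|i|.
have vb22 : v (b 2%:R 2%:R) = - i by rewrite /i b00 dvalV // sigmaV opprK.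
have b11 : ppow v 0 (b 1 1).
  apply: (norm_ppow un (n := 0)) => //; have := col_rel b 1 1.
  rewrite rev3 b21 conj0 mul0r mulr0 addr0 add0r mulrC => ->; exact: ppow1.
pose b' := (tel sigma (w ^ (j - i)) * b * tel sigma (w ^ (- j)))%g.
have -> : b = (tel sigma (w ^ (i - j)) * b' * tel sigma (w ^ j))%g.
  by rewrite /b' !mulgA tel_wM subrKA addrN tel_w0 mul1g -mulgA tel_wM addNr tel_w0 mulg1.
apply: (PM _ _ _ (Pt _)); apply: (PM _ _ (Pt _)); apply: K0P => r c.
have h n x : ppow v (- n) x -> forall e, n <= e -> ppow v 0 (w ^ e * x).
  move=> hx e ne; apply: (@ppowW _ v _ (e - n)); first by rewrite subr_ge0.
  exact: ppowM (ppow_varpi un _) hx.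
have Nj : N%:Z <= j by rewrite lerDl.
have Nji : N%:Z <= j - i by rewrite -addrA lerDl subr_ge0 ler_norm.
have j0 : 0 <= j by rewrite (le_trans _ Nj).
have b00n : b 0 0 != 0 by rewrite b00 invr_eq0.
have wn0 n : w ^ n != 0 by rewrite expfz_neq0.
have wM n n' x : w ^ n * x * w ^ n' = w ^ (n + n') * x by rewrite mulrAC -expfzDr.
move: r c; apply: ord3P; apply: ord3P; rewrite /b' tel_mulr // tel_mull //;
  rewrite ?(conj_varpi un) ?invr_expz ?opprK ?wM.
- by apply: (h (- i)); [right; rewrite opprK | rewrite addrAC subrr add0r].
- by apply: h (hN 0 1) _ _.
- by apply: h (hN 0 2%:R) _ _; rewrite (le_trans Nji) // lerDl.
- by rewrite b10 mul0r; left.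
- by rewrite mulrC; apply: h (hN 1 2%:R) _ _.
- by rewrite b20 mulr0; left.
- by rewrite b21 mulr0; left.
- by apply: (h i); [right; rewrite vb22 | rewrite opprB subrK].
Qed.

End Decompositions.


(** * The induced representation *)

Section HomogeneousFunctions.
Variables (R : realType) (F : fieldType) (E : splittingFieldType F) (vF : dvaluation F)
  (v : dvaluation E) (sigma : gal_of {:E}) (varpi : F) (delta : E).
Hypothesis un : unram vF v sigma varpi delta.
Implicit Types (g h k : U3 sigma) (m : nat) (f : U3 sigma -> R[i]).

Local Notation w := (varpi%:A : E).
Let sigmaV := un_sigmaV un.

Local Notation q := (residue_card vF).
Local Notation Q := ((residue_card v)%:R : R[i]).

Lemma residue_cardE : residue_card v = (q ^ 2)%N.
Proof. by have [s [/residue_repsP[_ ->] ->]] := un_repsE un. Qed.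

Lemma residue_card_gt1 : (1 < q)%N.
Proof.
have [s [[us so s1 cov] <-]] := un_reps un.
have [a as_ ha] := cov 0 (ppow0 vF 0); have [b bs hb] := cov 1 (ppow1 vF).
have ab : a != b.
  apply/eqP => ab; subst b; have [_] := unit_ppow (oner_neq0 F) (dval1 vF); apply.
  by have := ppowB hb ha; congr ppow; ring.
have : (size [:: a; b] <= size s)%N.
  apply: uniq_leq_size; first by rewrite /= inE ab.
  by move=> x; rewrite !inE => /orP[]/eqP->.
by [].
Qed.

Lemma Q_gt0 : 0 < Q.
Proof. by rewrite ltr0n residue_cardE expn_gt0 (ltn_trans _ residue_card_gt1). Qed.

Let Q0 : Q != 0. Proof. by rewrite gt_eqF ?Q_gt0. Qed.

(* The elements of the induced representation are the functions of the bottom row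
   that are homogeneous of degree |.|^-2. *)
Definition rowhom f : Prop := forall c g h, c != 0 ->
  (forall j, g 2%:R j = c * h 2%:R j) -> f g = Q ^ (2 * v c) * f h.

Local Notation V := (IndB (sigma := sigma) v (fun a => (normabs v R a)%:C) (fun=> 1)).

(** Both $\delta_B^{1/2}$ and $\mu_1$ are $|\cdot|_E$ of the upper left entry, whence the exponent
    2. The sign changes in [rowhom], which uses the bottom right entry $\overline{b_{00}}^{-1}$. *)
Lemma modulusE (b : U3 sigma) : b 0 0 != 0 ->
  (Num.sqrt (deltaB v R b))%:C * charB (fun a => (normabs v R a)%:C) (fun=> 1) b =
  Q ^ (2 * - v (b 0 0)).
Proof.
move=> b0; rewrite /deltaB /charB sqrtr_sqr mulr1 /normabs (negPf b0).
rewrite ger0_norm ?exprz_ge0 ?ler0n //.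
rewrite fmorphXz /= rmorph_nat -expfzDr //; congr (_ ^ _); ring.
Qed.

Lemma IndB_rowhom f : V f -> rowhom f.
Proof.
move=> [_ hf] c g h c0 /(row2_prop c0)[bb b00].
have sc0 : sigma c != 0 by rewrite fmorph_eq0.
rewrite -[g in LHS](mulgVK h) hf // modulusE b00 ?invr_eq0 //.
by rewrite dvalV // opprK sigmaV.
Qed.

Lemma rowhom_IndB f : rowhom f -> locally_constant v f -> V f.
Proof.
move=> hf lf; split=> // b g bb; have [b10 b20 b21] := borel_entries bb.
have [_ b22 b00] := borel_row2 b20 b21.
have sb22 : sigma (b 2%:R 2%:R) != 0 by rewrite fmorph_eq0.
rewrite modulusE b00 ?invr_eq0 // dvalV // opprK sigmaV; apply: hf => // j.
by rewrite U3M b20 b21 !mul0r !add0r.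
Qed.

Lemma rowhom_rtrans f h : rowhom f -> rowhom (rtrans h f).
Proof. by move=> hf c g k c0 e; apply: hf => // j; rewrite !U3M !e; ring. Qed.

Lemma rowhom_eq f g h : rowhom f -> (forall j, g 2%:R j = h 2%:R j) -> f g = f h.
Proof.
move=> hf e; rewrite (hf 1 g h) ?oner_neq0 //; last by move=> j; rewrite mul1r.
by rewrite dval1 mulr0 expr0z mul1r.
Qed.

Lemma rowhom_unit f c g h : rowhom f -> c != 0 -> v c = 0 ->
  (forall j, g 2%:R j = c * h 2%:R j) -> f g = f h.
Proof. by move=> hf c0 vc e; rewrite (hf c g h) // vc mulr0 expr0z mul1r. Qed.

(** One level for all [g] at once, whereas in [locally_constant] the level depends on the point. *)
Definition Gfix m f : Prop := forall g h, Gam v m h -> f (g * h)%g = f g.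

Lemma GfixW m m' f : (m <= m')%N -> Gfix m f -> Gfix m' f.
Proof. by move=> mm hf g h hh; apply: hf; apply: GamW hh. Qed.

Lemma Gfix_rinv m f K : Gfix m f -> rinv_on K (Gam v m) f.
Proof. by move=> hf g h _; apply: hf. Qed.

Lemma Gfix_locally_constant m f : Gfix m f -> locally_constant v f.
Proof.
move=> hf g; have [N hN] := mxpow_bound un g.
exists (m%:Z + N%:Z) => h hgh; rewrite -[h](mulVKg g); apply: hf.
apply: (Gam_close un (a := - N%:Z)) => //; rewrite opprK => i j.
by rewrite !mxE.
Qed.

(** Limits are taken entry by entry; the limit matrix is again unitary because its defect lies in
    every power of $p$. *)
Lemma K0_limit (u : nat -> U3 sigma) : (forall n, K0 v (u n)) ->
  (forall n, Gam v n ((u n)^-1 * u n.+1)%g) ->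
  exists2 k, K0 v k & forall n, Gam v n ((u n)^-1 * k)%g.
Proof.
move=> Ku cu.
have cl n m : (n <= m)%N -> Gam v n ((u n)^-1 * u m)%g.
  have [G1 GM _] := Gam_subgrp un (sigma := sigma) n.
  elim: m => [|m IH]; first by rewrite leqn0 => /eqP n0; subst n; rewrite mulVg.
  rewrite leq_eqVlt => /predU1P[<-|nm]; first by rewrite mulVg.
  have -> : ((u n)^-1 * u m.+1 = ((u n)^-1 * u m) * ((u m)^-1 * u m.+1))%g.
    by rewrite !mulgA mulgK.
  by apply: GM; [exact: IH | apply: GamW (cu m)].
have diff n m : (n <= m)%N -> mxpow v n%:Z (U3val (u m) - U3val (u n)).
  move=> nm; have -> : U3val (u m) - U3val (u n) =
      U3val (u n) *m (U3val ((u n)^-1 * u m)%g - 1%:M).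
    rewrite mulmxBr mulmx1; congr (_ - _).
    by rewrite -[u m in LHS](mulVKg (u n)).
  by have := mxpowM (Ku n) (cl _ _ nm); rewrite add0r.
have hl (ij : 'I_3 * 'I_3) : exists l, forall n : nat, ppow v n%:Z (l - u n ij.1 ij.2).
  have [|l hl] := un_complete un (u := fun n : nat => u n ij.1 ij.2).
    move=> n; exists `|n|%N => i j ni nj; apply: (@ppowW _ v _ `|n|%N%:Z); first lia.
    have hi := diff _ i ni ij.1 ij.2; have hj := diff _ _ nj ij.1 ij.2.
    by rewrite !mxE in hi hj; apply: ppowBt hi (ppowBC hj).
  exists l => n; have [N hN] := hl n%:Z.
  have := hN (maxn n N) (leq_maxr _ _); have := diff _ _ (leq_maxl n N) ij.1 ij.2.
  by rewrite !mxE => h1 h2; apply: ppowBt (ppowBC h2) h1.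
have [l {}hl] := choice hl; pose M : 'M[E]_3 := \matrix_(i, j) l (i, j).
have hM n : mxpow v n%:Z (M - U3val (u n)) by move=> i j; rewrite !mxE; exact: (hl (i, j)).
have MK : mxpow v 0 M.
  by rewrite -[M](subrK (U3val (u 0%N))); apply: mxpowD; [exact: (hM 0%N) | exact: Ku].
have uJ : (map_mx sigma M)^T *m J3 E *m M = J3 E.
  apply/eqP; rewrite -subr_eq0; apply/eqP/matrixP => i j; rewrite [RHS]mxE.
  apply: (@ppow_eq0 _ v) => n.
  have JK : mxpow v 0 (J3 E).
    by apply: ord3P; apply: ord3P; rewrite mx3E; (try exact: ppow0); exact: ppow1.
  pose D := M - U3val (u n).
  have uu : (map_mx sigma (U3val (u n)))^T *m J3 E *m U3val (u n) = J3 E.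
    by case: (u n) => x /= /andP[_ /eqP].
  have -> : (map_mx sigma M)^T *m J3 E *m M - J3 E =
      (map_mx sigma M)^T *m J3 E *m D + (map_mx sigma D)^T *m J3 E *m U3val (u n).
    have -> : (map_mx sigma D)^T = (map_mx sigma M)^T - (map_mx sigma (U3val (u n)))^T.
      by rewrite map_mxB linearB.
    by rewrite -[X in _ - X = _]uu /D mulmxBr !mulmxBl addrA subrK.
  move: i j; apply: mxpowD.
    by have := mxpowM (mxpowM (mxpow_conjT un MK) JK) (hM n); rewrite !add0r.
  by have := mxpowM (mxpowM (mxpow_conjT un (hM n)) JK) (Ku n); rewrite !addr0.
have kM := U3insub uJ; exists (insubd (U3one sigma) M); first by rewrite /K0 /= kM.
move=> n; apply: (Gam_close un (a := 0)); first exact: Ku.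
by rewrite kM subr0; exact: hM.
Qed.

(* If f were fixed by no Gam m, nested cosets k_n Gam_n on which this fails
   would shrink to a point at which f is not locally constant. *)
Lemma IndB_smooth f : V f -> exists m, Gfix m f.
Proof.
move=> Vf; have hf := IndB_rowhom Vf; case: (Vf) => lf _.
pose good n k := exists m, forall k' h, Gam v n (k^-1 * k')%g -> Gam v m h ->
  f (k' * h)%g = f k'.
suff [m hm] : good 0%N 1%g.
  exists m => g h hh; have [b [k [bb Kk ->]]] := Iwasawa un g.
  have [b10 b20 b21] := borel_entries bb.
  have [_ b22 _] := borel_row2 b20 b21.
  have bE x j : (b * x)%g 2%:R j = b 2%:R 2%:R * x 2%:R j.
    by rewrite U3M b20 b21 !mul0r !add0r.
  rewrite -mulgA !(hf _ _ _ b22 (bE _)) hm //.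
  by rewrite invg1 mul1g; apply: mxpowD => //; apply: mxpowN; exact: mxpow1.
apply: contrapT => bad0.
have step n k : K0 v k -> ~ good n k ->
    exists k', [/\ K0 v k', Gam v n (k^-1 * k')%g & ~ good n.+1 k'].
  move=> Kk bad; apply: contrapT => hno; apply: bad.
  have [s [us sK _ cov]] := K0_Gam_coset_reps un (sigma := sigma) n.+1.
  have [m hm] : exists m : U3 sigma -> nat, forall x, x \in s -> Gam v n (k^-1 * x)%g ->
      forall k' h, Gam v n.+1 (x^-1 * k')%g -> Gam v (m x) h -> f (k' * h)%g = f k'.
    have hx x : exists m, x \in s -> Gam v n (k^-1 * x)%g ->
        forall k' h, Gam v n.+1 (x^-1 * k')%g -> Gam v m h -> f (k' * h)%g = f k'.
      have [[xs hx]|nx] := pselect (x \in s /\ Gam v n (k^-1 * x)%g); last first.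
        by exists 0%N => xs hx; case: nx.
      have [[m hm]|bad] := pselect (good n.+1 x); first by exists m.
      by case: hno; exists x; split=> //; exact: sK.
    by have [m hm] := choice hx; exists m => x xs hxx; exact: hm.
  exists (\max_(x <- s) m x)%N => k' h hk' hh.
  have Kk' : K0 v k'.
    rewrite -[k'](mulVKg k); case: (K0_subgrp un (sigma := sigma)) => _ KM _.
    by apply: KM => //; apply: Gam_K0 hk'.
  have [x xs hx] := cov _ Kk'; apply: (hm x) => //; last first.
    by apply: GamW hh; apply: leq_bigmax_seq.
  case: (Gam_subgrp un (sigma := sigma) n) => _ GM GV.
  have -> : (k^-1 * x = (k^-1 * k') * (x^-1 * k')^-1)%g.
    by rewrite invgM invgK !mulgA mulgK.
  by apply: GM => //; apply: GV; apply: GamW hx.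
have [K1 _ _] := K0_subgrp un (sigma := sigma).
pose nxt n k := xget k [set k' | [/\ K0 v k', Gam v n (k^-1 * k')%g & ~ good n.+1 k']].
pose u := fix u n := if n is n'.+1 then nxt n' (u n') else 1%g.
have hu n : K0 v (u n) /\ ~ good n (u n).
  elim: n => [//|n [Ku bu]]; have [|] := @xgetPex _ (u n)
    [set k' | [/\ K0 v k', Gam v n ((u n)^-1 * k')%g & ~ good n.+1 k']].
    by have [k' hk'] := step _ _ Ku bu; exists k'.
  by rewrite -/(nxt n (u n)) => h1 _ h2.
have hu' n : Gam v n ((u n)^-1 * u n.+1)%g.
  have [Ku bu] := hu n; have [|] := @xgetPex _ (u n)
    [set k' | [/\ K0 v k', Gam v n ((u n)^-1 * k')%g & ~ good n.+1 k']].
    by have [k' hk'] := step _ _ Ku bu; exists k'.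
  by rewrite -/(nxt n (u n)).
have [k Kk hk] := K0_limit (fun n => proj1 (hu n)) hu'.
have [N hN] := lf k; pose n := `|N|%N.
have fconst x : Gam v n ((u n)^-1 * x)%g -> f x = f k.
  move=> hx; apply: hN => i j.
  case: (Gam_subgrp un (sigma := sigma) n) => _ GM GV.
  have hkx : Gam v n (k^-1 * x)%g.
    have -> : (k^-1 * x = ((u n)^-1 * k)^-1 * ((u n)^-1 * x))%g.
      by rewrite invgM invgK !mulgA mulgK.
    by apply: GM => //; exact: GV.
  have : mxpow v n%:Z (U3val x - U3val k).
    have -> : U3val x - U3val k = U3val k *m (U3val (k^-1 * x)%g - 1%:M).
      by rewrite mulmxBr mulmx1; congr (_ - _); rewrite -[x in LHS](mulVKg k).
    by have := mxpowM Kk hkx; rewrite add0r.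
  by move=> /(_ i j); rewrite !mxE; apply: ppowW; rewrite /n; lia.
have [_] := hu n; apply; exists n => k' h hk' hh; rewrite !fconst //.
case: (Gam_subgrp un (sigma := sigma) n) => _ GM _.
by rewrite mulgA; apply: GM.
Qed.

End HomogeneousFunctions.


(** * The invariant functional *)

Section InvariantFunctional.
Variables (R : realType) (F : fieldType) (E : splittingFieldType F) (vF : dvaluation F)
  (v : dvaluation E) (sigma : gal_of {:E}) (varpi : F) (delta : E).
Hypothesis un : unram vF v sigma varpi delta.
Implicit Types (g h k : U3 sigma) (m n : nat) (f : U3 sigma -> R[i]).

Local Notation w := (varpi%:A : E).
Let sigmaK := un_sigmaK un.
Let sigmaF := un_sigmaF un.
Let w_neq0 : w != 0 := proj1 (un_varpi un).
Let vw : v w = 1 := proj2 (un_varpi un).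

Local Notation q := (residue_card vF).
Local Notation Q := ((residue_card v)%:R : R[i]).

Let gK0 : subgrp (K0 v (sigma := sigma)) := K0_subgrp un.
Let gK1 : subgrp (K1 v (sigma := sigma)) := K1_subgrp un.
Let gIw : subgrp (Iw v (sigma := sigma)) := Iw_subgrp un.
Let gGam m : subgrp (Gam v (sigma := sigma) m) := Gam_subgrp un m.

Definition avgf (K H : set (U3 sigma)) f : U3 sigma -> R[i] :=
  fun g => avg K H (fun k => f (g * k)%g).

Lemma rowhom_avgf K H f : rowhom v f -> rowhom v (avgf K H f).
Proof.
move=> hf c g h c0 e; rewrite /avgf /avg mulrCA; congr (_ * _); rewrite mulr_sumr.
by apply: eq_bigr => k _; apply: hf => // j; rewrite !U3M !e; ring.
Qed.

Lemma avgf_rinv K m f g k : subgrp K -> (exists s, coset_reps K (Gam v m) s) ->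
  Gfix v m f -> K k -> avgf K (Gam v m) f (g * k)%g = avgf K (Gam v m) f g.
Proof.
move=> gK [s ts] hf Kk; rewrite /avgf -[RHS](avg_lmul gK (gGam m) ts Kk); last first.
  by move=> x h _ hh; rewrite mulgA; apply: hf.
by apply: (eq_avg ts) => x _; rewrite mulgA.
Qed.

(** By isotropy of the first column, $k_{20}$ in $p$ forces the norm of $k_{10}$ into $p$, hence
    $k_{10}$ itself. *)
Lemma K0_Iw k : K0 v k -> ppow v 1 (k 2%:R 0) -> Iw v k.
Proof.
move=> Kk k20; apply: (Iw_col0 un) => //; apply: (norm_ppow un (n := 1)) => //.
have -> : k 1 0 * sigma (k 1 0) = - (sigma (k 2%:R 0) * k 0 0 + sigma (k 0 0) * k 2%:R 0).
  by have := col_rel k 2%:R 0; rewrite rev3 => e; rewrite -[RHS]add0r -[X in X - _]e; ring.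
by apply/ppowN/ppowD; [apply: ppowMr | apply: ppowMl] => //; rewrite (ppow_conj un).
Qed.

Definition Iw_fixed f : Prop := forall g i, Iw v i -> f (g * i)%g = f g.

(** The Bruhat decomposition modulo $p$ has two cells: outside [Iw] the entry $k_{20}$ is a unit,
    and up to this unit the bottom row is that of the Weyl element times an element of [Iw]. *)
Lemma Iw_values f k : rowhom v f -> Iw_fixed f -> K0 v k -> ~ Iw v k ->
  f k = f (wel sigma 1).
Proof.
move=> hf fI Kk nIk; have hX : ~ ppow v 1 (k 2%:R 0) by move=> h; apply/nIk/K0_Iw.
have [X0 vX] := dval_unit (Kk 2%:R 0) hX.
have [iso e] := row2_nup un X0.
set y := - _ in iso e; set z := _ / _ in iso e.
have hz : ppow v 0 z by apply: ppowMr => //; right; rewrite dvalV // vX.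
have hy : ppow v 0 y by exact: (isotropic_ppow un iso hz).
rewrite -(fI (wel sigma 1) (nup sigma y z)); last first.
  apply: (Iw_col0 un); rewrite ?nupE // ?mx3E; try exact: ppow0.
  exact: (nup_K0 un).
by apply: (rowhom_unit hf X0 vX) => j; rewrite wel1_mul_row2.
Qed.

Lemma sum_const_seq (T : Type) (r : seq T) (c : R[i]) : \sum_(x <- r) c = (size r)%:R * c.
Proof. by rewrite big_const_seq count_predT iter_addr addr0 mulr_natl. Qed.

Lemma avg_K0_Iw f : rowhom v f -> Iw_fixed f ->
  (q ^ 3 + 1)%:R * avg (K0 v) (Iw v) f = f 1%g + (q ^ 3)%:R * f (wel sigma 1).
Proof.
move=> hf fI; have [sF [rF sizeF]] := un_reps un; have [sE [rE sizeE]] := un_repsE un.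
have [r tr sr] : exists2 r, coset_reps (K0 v (sigma := sigma)) (Iw v) r &
    size r = (q ^ 3 + 1)%N.
  eexists; first exact: (K0_Iw_coset_reps un rE rF).
  by rewrite /= size_allpairs sizeF sizeE -expnSr addn1.
rewrite (avgE gIw tr) => [|x i _ Ii]; last exact: fI.
have [ur rK rI cov] := tr.
rewrite sr mulVKf ?pnatr_eq0 ?addn1 //.
have [one _ _] := gK0; have [_ IM IV] := gIw.
have [x0 x0r hx0] := cov _ one; rewrite mulg1 in hx0.
have Ix0 : Iw v x0 by rewrite -[x0]invgK; apply: IV.
rewrite (big_rem _ x0r) /= -[x0 in f x0]mul1g fI //; congr (_ + _).
rewrite big_seq (eq_bigr (fun=> f (wel sigma 1))) => [|x].
  by rewrite -big_seq sum_const_seq (size_rem x0r) sr addn1.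
rewrite mem_rem_uniq // inE => /andP[/eqP xx0 xr].
apply: Iw_values => //; first exact: rK.
by move=> Ix; apply: xx0; apply: rI => //; apply: IM => //; apply: IV.
Qed.

(** The $q$ unipotent representatives have the bottom row of 1, and that of [wel varpi] is [varpi]
    times that of [wel 1], whence $q_E^2 = q^4$. The result is $q$ times the combination of
    [avg_K0_Iw]. *)
Lemma avg_K1_Iw f : rowhom v f -> Iw_fixed f ->
  (q + 1)%:R * avg (K1 v) (Iw v) f = q%:R * f 1%g + (q ^ 4)%:R * f (wel sigma 1).
Proof.
move=> hf fI; have [sF [rF sizeF]] := un_reps un.
have [_ _ sd] := un_delta un.
have := K1_Iw_coset_reps un rF; set r := _ :: _ => tr.
have sr : size r = (q + 1)%N by rewrite /= size_map sizeF addn1.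
rewrite (avgE gIw tr) => [|x i _ Ii]; last exact: fI.
rewrite sr mulVKf ?pnatr_eq0 ?addn1 // big_cons big_map addrC; congr (_ + _).
  rewrite (eq_bigr (fun=> f 1%g)) => [|s _]; first by rewrite sum_const_seq sizeF.
  apply: (rowhom_eq hf) => j; rewrite nupE //; last first.
    by rewrite /isotropic rmorphM fmorph_div /= !sigmaF sd; ring.
  by move: j; apply: ord3P; rewrite mx3E U3_1.
rewrite (hf w _ (wel sigma 1)) //; last first.
  by apply: ord3P; rewrite (welwE un) wel1E !mx3E ?mulr1 ?mulr0.
by rewrite vw mulr1 -exprnP (residue_cardE un) -natrX -expnM.
Qed.

Lemma Iw_Gam_coset_reps m : (0 < m)%N ->
  exists s, coset_reps (Iw v (sigma := sigma)) (Gam v m) s.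
Proof.
move=> m0; apply: (Gam_coset_reps un) => //; [exact: Iw_K0 | exact: (Gam_Iw un)].
Qed.

Lemma K1_Gam_coset_reps m : (0 < m)%N ->
  exists s, coset_reps (K1 v (sigma := sigma)) (Gam v m) s.
Proof.
move=> m0; have [sF [rF _]] := un_reps un; have [s ts] := Iw_Gam_coset_reps m0.
eexists; apply: coset_reps_mul gIw _ _ gK1 (K1_Iw_coset_reps un rF) ts.
  exact: Iw_K1.
exact: (Gam_Iw un).
Qed.

(* Independent of m as soon as f is fixed by Gam m; see mass_refine. *)
Definition mass m f := avg (K0 v) (Gam v m) f.

Lemma avg_avgf K m r s f : subgrp K -> Iw v `<=` K -> (0 < m)%N -> Gfix v m f ->
  coset_reps K (Iw v) r -> coset_reps K (Gam v m) s ->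
  avg K (Gam v m) f = avg K (Iw v) (avgf (Iw v) (Gam v m) f).
Proof.
move=> gK IK m0 hf tr ts.
rewrite (avg_iter gK gIw (gGam m) IK (Gam_Iw un m0) tr ts (Gfix_rinv hf)).
rewrite (avgE gIw tr) // => x i _ Ii.
by apply: avgf_rinv => //; exact: Iw_Gam_coset_reps.
Qed.

Lemma avg_K1_mass m f : rowhom v f -> (0 < m)%N -> Gfix v m f ->
  (q + 1)%:R * avg (K1 v) (Gam v m) f = (q * (q ^ 3 + 1))%:R * mass m f.
Proof.
move=> hf m0 fm; have [sF [rF _]] := un_reps un; have [sE [rE _]] := un_repsE un.
have [s0 ts0] := K0_Gam_coset_reps un (sigma := sigma) m.
have [s1 ts1] := K1_Gam_coset_reps m0.
have hF := rowhom_avgf (Iw v) (Gam v m) hf.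
have FI : Iw_fixed (avgf (Iw v) (Gam v m) f).
  by move=> g i Ii; apply: avgf_rinv => //; exact: Iw_Gam_coset_reps.
rewrite (avg_avgf gK1 (@Iw_K1 _ _ _ _) m0 fm (K1_Iw_coset_reps un rF) ts1) avg_K1_Iw //.
rewrite /mass (avg_avgf gK0 (@Iw_K0 _ _ _ _) m0 fm (K0_Iw_coset_reps un rE rF) ts0).
by rewrite natrM -mulrA avg_K0_Iw // !natrX; ring.
Qed.

Lemma mass_refine m m' f : (m <= m')%N -> Gfix v m f -> mass m' f = mass m f.
Proof.
move=> mm fm; have [s ts] := K0_Gam_coset_reps un (sigma := sigma) m.
have [s' ts'] := K0_Gam_coset_reps un (sigma := sigma) m'.
apply: (avg_refine gK0 (gGam m) (gGam m') _ _ ts ts' (Gfix_rinv fm)).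
  exact: Gam_K0.
exact: GamW.
Qed.

(* On K0 the invariance is that of an average over a group; for the Weyl element
   wel varpi of K1 it comes from the proportionality of the averages over K0
   and K1. *)
Lemma mass_invariant g f m : rowhom v f -> (0 < m)%N -> Gfix v m f ->
  exists m', [/\ (0 < m')%N, Gfix v m' (rtrans g f) & mass m' (rtrans g f) = mass m f].
Proof.
pose P g := forall f m, rowhom v f -> (0 < m)%N -> Gfix v m f ->
  exists m', [/\ (0 < m')%N, Gfix v m' (rtrans g f) & mass m' (rtrans g f) = mass m f].
move: f m; apply: (generation un (P := P)) g => [g h Pg Ph|k Kk|] f m hf m0 fm.
- have [m1 [m10 fm1 <-]] := Ph f m hf m0 fm.
  have [m2 [m20 fm2 <-]] := Pg _ _ (rowhom_rtrans h hf) m10 fm1.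
  have -> : rtrans (g * h)%g f = rtrans g (rtrans h f).
    by apply: funext => x; rewrite /rtrans mulgA.
  by exists m2.
- have [s ts] := K0_Gam_coset_reps un (sigma := sigma) m.
  exists m; split=> //.
    move=> x h hh; rewrite /rtrans -(fm (x * k)%g (k^-1 * h * k)%g); last exact: (Gam_normal un).
    by rewrite !mulgA mulgK.
  apply: (avg_rmul gK0 (gGam m) (gGam m) _ ts ts Kk _ (Gfix_rinv fm)).
    exact: Gam_K0.
  by move=> h; apply: (Gam_normal un).
have m20 : (0 < m + 2)%N by rewrite addn2.
have wbd : mxpow v (- 1) (wel sigma w).
  rewrite (welwE un); apply: ord3P; apply: ord3P; rewrite mx3E; (try exact: ppow0).
  - exact: (ppow_varpi un).
  - by apply: ppowW (ppow1 v).
  - by apply: ppowW (ppow_varpi un 1).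
have conjG h : Gam v (m + 2) h -> Gam v m ((wel sigma w)^-1 * h * wel sigma w)%g.
  by move=> hh; apply: (Gam_conj un wbd hh); rewrite mulr1 PoszD.
have fm2 : Gfix v (m + 2) (rtrans (wel sigma w) f).
  move=> x h /conjG hh; rewrite /rtrans -(fm (x * wel sigma w)%g _ hh).
  by rewrite !mulgA mulgK.
exists (m + 2)%N; split=> //.
have [s ts] := K1_Gam_coset_reps m0; have [s' ts'] := K1_Gam_coset_reps m20.
have c0 : (q * (q ^ 3 + 1))%:R != 0 :> R[i].
  by rewrite pnatr_eq0 muln_eq0 addn1 orbF -lt0n (ltn_trans _ (residue_card_gt1 un)).
apply: (mulfI c0); rewrite -avg_K1_mass //; last exact: rowhom_rtrans.
rewrite -avg_K1_mass //; congr (_ * _).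
apply: (avg_rmul gK1 (gGam m) (gGam (m + 2)) _ ts ts' (welw_K1 un) conjG (Gfix_rinv fm)).
by move=> g /(Gam_Iw un m0) /Iw_K1.
Qed.

Local Notation V := (IndB (sigma := sigma) v (fun a => (normabs v R a)%:C) (fun=> 1)).

(** The level is existential so that functions of different levels can be added; by [null_mass]
    every admissible level gives the same condition. *)
Definition null f : Prop := exists m, [/\ (0 < m)%N, Gfix v m f & mass m f = 0].

Lemma null_mass m f : null f -> Gfix v m f -> mass m f = 0.
Proof.
move=> [m' [_ fm' e]] fm; rewrite -(mass_refine (leq_maxl m m') fm).
by rewrite (mass_refine (leq_maxr m m') fm').
Qed.

Lemma avg0 (K H : set (U3 sigma)) : avg K H (fun=> 0 : R[i]) = 0.
Proof. by rewrite /avg big1 ?mulr0. Qed.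

Lemma null_lin a f1 f2 : null f1 -> null f2 -> null (fun g => a * f1 g + f2 g).
Proof.
move=> n1 n2; have [m1 [m10 fm1 _]] := n1; have [m2 [m20 fm2 _]] := n2.
have h1 := GfixW (leq_maxl m1 m2) fm1; have h2 := GfixW (leq_maxr m1 m2) fm2.
exists (maxn m1 m2); split; first by rewrite (leq_trans m10) ?leq_maxl.
  by move=> g h hh; rewrite h1 // h2.
by rewrite /mass avg_lin -!/(mass _ _) (null_mass n1) // (null_mass n2) // mulr0 addr0.
Qed.

(** A finite average is a linear combination of translates, so it stays in [W] without any limit. *)
Lemma subrep_avgf W X K H f : subrepresentation X W -> W f -> W (avgf K H f).
Proof.
move=> [_ W0 Wlin Wtr] Wf; rewrite /avgf /avg; set s := xget _ _.
suff h : W (fun g => \sum_(x <- s) f (g * x)%g).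
  by have := Wlin (size s)%:R^-1 _ _ h W0; congr W; apply: funext => g; rewrite addr0.
elim: s => [|x s IH]; first by move: W0; congr W; apply: funext => g; rewrite big_nil.
have := Wlin 1 _ _ (Wtr x _ Wf) IH; congr W; apply: funext => g.
by rewrite big_cons mul1r.
Qed.

(** An invariant function is constant, whereas [tel varpi] changes the value at 1 by the factor
    $q_E^{-2} \neq 1$. *)
Lemma IndB_invariant_eq0 f : V f -> (forall g h, f (g * h)%g = f g) -> f = fun=> 0.
Proof.
move=> Vf inv; have hf := IndB_rowhom un Vf.
have fc g : f g = f 1%g by rewrite -[g]mul1g inv.
have e : f (tel sigma w) = Q ^ (2 * v w^-1) * f 1%g.
  apply: hf; first by rewrite invr_eq0.
  by apply: ord3P; rewrite telE // !mx3E U3_1 ?mulr0 // mulr1 sigmaF.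
have Q1 : Q ^+ 2 != 1.
  rewrite -natrX pnatr_eq1 (residue_cardE un) -expnM.
  by rewrite -[1%N](exp1n (2 * 2)) eqn_exp2r // gtn_eqF // (residue_card_gt1 un).
have f1 : f 1%g = 0.
  move: e; rewrite fc dvalV // vw mulrN1 -exprnN => /esym/eqP.
  rewrite -subr_eq0 -{2}[f 1%g]mul1r -mulrBl mulf_eq0 => /orP[|/eqP //].
  by rewrite subr_eq0 invr_eq1 (negPf Q1).
by apply: funext => g; rewrite fc.
Qed.

Variable V1 : set (U3 sigma -> R[i]).
Hypothesis irrV1 : irreducible_subrep V V1.

Let V1V f : V1 f -> V f. Proof. by case: irrV1 => -[h _ _ _] _ _; apply: h. Qed.

Lemma irreducible_null f : V1 f -> null f.
Proof.
case: (irrV1) => subV1 V1n0 irr; have [_ V10 V1lin V1tr] := subV1.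
have [] := irr [set f | V1 f /\ null f].
- split=> [f0 []//| | |].
  + split=> //; exists 1%N; split=> //; exact: avg0.
  + by move=> a f1 f2 [h1 n1] [h2 n2]; split; [exact: V1lin | exact: null_lin].
  + move=> h f0 [h0 [m [m0 fm e]]]; split; first exact: V1tr.
    have [m' [m'0 fm' e']] := mass_invariant h (IndB_rowhom un (V1V h0)) m0 fm.
    by exists m'; split=> //; rewrite e' e.
- move=> W0; case: V1n0; apply/seteqP; split=> [f0 h0|_ -> //].
  apply: IndB_invariant_eq0; first exact: V1V.
  move=> g h; have [m0 fm0] := IndB_smooth un (V1V h0).
  have fm := GfixW (leqnSn m0) fm0.
  have [m' [m'0 fm' e']] := mass_invariant h (IndB_rowhom un (V1V h0)) (ltn0Sn m0) fm.
  (* Invariance of the mass makes $\pi(h)f_0 - f_0$ null. In the case at hand null functions of [V1]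
     vanish, so $f_0$ is invariant. *)
  have : [set f | V1 f /\ null f] (fun g => -1 * f0 g + rtrans h f0 g).
    split; first exact: V1lin (V1tr _ _ h0).
    exists (maxn m0.+1 m'); split; first by rewrite (leq_trans m'0) ?leq_maxr.
      by move=> x y hy; rewrite (GfixW (leq_maxl m0.+1 m') fm) // (GfixW (leq_maxr m0.+1 m') fm').
    rewrite /mass avg_lin -!/(mass _ _) (mass_refine (leq_maxr m0.+1 m') fm').
    by rewrite (mass_refine (leq_maxl m0.+1 m') fm) e' mulN1r addNr.
  rewrite W0 => /(congr1 (fun f : U3 sigma -> R[i] => f g)) /eqP.
  by rewrite /rtrans mulN1r addrC subr_eq0 => /eqP.
by move=> <- [].
Qed.

Lemma positive_eq0 f : V1 f ->
  (forall g, exists2 c, 0 < c & f g = c * f 1%g) -> f = fun=> 0.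
Proof.
move=> V1f hc; have [m [m0 fm e]] := irreducible_null V1f.
have [s ts] := K0_Gam_coset_reps un (sigma := sigma) m.
have [c hc'] : exists c : U3 sigma -> R[i], forall g, 0 < c g /\ f g = c g * f 1%g.
  have h g : exists c, 0 < c /\ f g = c * f 1%g by have [c c0 ec] := hc g; exists c.
  by have [c h'] := choice h; exists c.
have f1 : f 1%g = 0.
  move: e; rewrite /mass (avgE (gGam m) ts (Gfix_rinv fm)) => /eqP.
  have s0 : size s != 0%N by rewrite -lt0n (coset_reps_neq0 gK0 ts).
  rewrite mulf_eq0 invr_eq0 pnatr_eq0 (negPf s0) /=.
  rewrite (eq_bigr (fun x => c x * f 1%g)) => [|x _]; last by case: (hc' x).
  rewrite -mulr_suml mulf_eq0 => /orP[|/eqP //].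
  rewrite psumr_eq0 => [/allP h|x _]; last by case: (hc' x) => /ltW.
  case: s s0 {ts} h => // x s _ /(_ x (mem_head _ _)) /=.
  by case: (hc' x) => /lt0r_neq0/negPf->.
by apply: funext => g; case: (hc' g) => _ ->; rewrite f1 mulr0.
Qed.

End InvariantFunctional.


(** * Functions fixed by K_2 *)

Section LevelTwo.
Variables (R : realType) (F : fieldType) (E : splittingFieldType F) (vF : dvaluation F)
  (v : dvaluation E) (sigma : gal_of {:E}) (varpi : F) (delta : E).
Hypothesis un : unram vF v sigma varpi delta.
Implicit Types (g h k b : U3 sigma) (m n : nat) (f : U3 sigma -> R[i]).

Local Notation w := (varpi%:A : E).
Let sigmaK := un_sigmaK un.
Let sigmaV := un_sigmaV un.
Let two0 : (2%:R : E) != 0 := proj1 (un_two un).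
Let conj1 : sigma 1 = 1. Proof. exact: rmorph1. Qed.
Let conj0 : sigma 0 = 0. Proof. exact: rmorph0. Qed.

Local Notation q := (residue_card vF).
Local Notation Q := ((residue_card v)%:R : R[i]).

Let Q0 : Q != 0. Proof. by rewrite gt_eqF ?(Q_gt0 R un). Qed.
Let gK0 : subgrp (K0 v (sigma := sigma)) := K0_subgrp un.
Let gK2 : subgrp (K2 v (sigma := sigma)) := K2_subgrp un.
Let gIw : subgrp (Iw v (sigma := sigma)) := Iw_subgrp un.
Let gGam m : subgrp (Gam v (sigma := sigma) m) := Gam_subgrp un m.
Let one1 : ~ ppow v 1 1. Proof. by case: (unit_ppow (oner_neq0 E) (dval1 v)). Qed.

(** The element $\gamma_i$ for $i = 0$, to which conjugation by the torus carries $\gamma_1$. *)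
Definition gamma0 : U3 sigma := nlow sigma 1 (- 1 / 2%:R).

Lemma isotropic_gamma0 : isotropic sigma 1 (- 1 / 2%:R).
Proof. by rewrite /isotropic fmorph_div rmorphN rmorph_nat /= conj1; field. Qed.

Lemma gamma0_K0 : K0 v gamma0.
Proof.
apply: (nlow_K0 un); [exact: isotropic_gamma0 | exact: ppow1 |].
by apply/(ppow_half un)/ppowN/ppow1.
Qed.

Lemma gamma0_row2 : ((gamma0 2%:R 0 = - 1 / 2%:R) * (gamma0 2%:R 1 = - 1) *
  (gamma0 2%:R 2%:R = 1))%type.
Proof. by rewrite /gamma0 nlowE ?mx3E ?conj1 //; exact: isotropic_gamma0. Qed.

Lemma nlow_K2 y z : isotropic sigma y z -> ppow v 1 y -> ppow v 0 z -> K2 v (nlow sigma y z).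
Proof.
move=> yz hy hz; rewrite /K2 /Kexp /= nlowE // mx3E subrr; split; last exact: ppow0.
apply: ord3P; apply: ord3P; rewrite !mx3E //; (try exact: ppow0); (try exact: ppow1).
by apply: ppowN; rewrite (ppow_conj un).
Qed.

Lemma nup_K2 y z : isotropic sigma y z -> ppow v 1 y -> ppow v 0 z -> K2 v (nup sigma y z).
Proof.
move=> yz hy hz; rewrite /K2 /Kexp /= nupE // mx3E subrr; split; last exact: ppow0.
apply: ord3P; apply: ord3P; rewrite !mx3E //; (try exact: ppow0); (try exact: ppow1).
by apply: ppowN; rewrite (ppow_conj un).
Qed.

Lemma wel1_K2 : K2 v (wel sigma 1).
Proof.
rewrite /K2 /Kexp /= wel1E mx3E subrr; split; last exact: ppow0.
by apply: ord3P; apply: ord3P; rewrite !mx3E //; (try exact: ppow0); exact: ppow1.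
Qed.

Lemma row2_unit k : K0 v k -> ppow v 1 (k 2%:R 1) -> ppow v 1 (k 2%:R 2%:R) ->
  ~ ppow v 1 (k 2%:R 0).
Proof.
move=> Kk h1 h2 h0; apply: one1; have := row_rel k 2%:R 2%:R; rewrite rev3 eqxx mulr1n => <-.
by do 2?apply: ppowD; apply: ppowMr => //; rewrite (ppow_conj un); exact: Kk.
Qed.

(** The middle coordinate modulo $p$ separates the two orbits of [K2] on isotropic lines. When it
    vanishes, the unipotent representative has $y$ in $p$, as [K2] demands. *)
Lemma row2_K2 k : K0 v k -> ppow v 1 (k 2%:R 1) -> exists c k', [/\ K2 v k', c != 0, v c = 0 &
  forall j, k 2%:R j = c * k' 2%:R j].
Proof.
move=> Kk hY; have [hZ|hZ] := pselect (ppow v 1 (k 2%:R 2%:R)); last first.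
  have [Z0 vZ] := dval_unit (Kk 2%:R 2%:R) hZ.
  have ZV : ppow v 0 (k 2%:R 2%:R)^-1 by right; rewrite dvalV // vZ.
  have [iso e] := row2_nlow un Z0; do 2 eexists; split; [|exact: Z0|exact: vZ|exact: e].
  apply: nlow_K2 iso _ _; last exact: ppowMl.
  by apply: ppowN; rewrite (ppow_conj un); apply: ppowMr.
have [X0 vX] := dval_unit (Kk 2%:R 0) (row2_unit Kk hY hZ).
have XV : ppow v 0 (k 2%:R 0)^-1 by right; rewrite dvalV // vX.
have [iso e] := row2_nup un X0; set y := - _ in iso e; set z := _ / _ in iso e.
exists (k 2%:R 0), (wel sigma 1 * nup sigma y z)%g; split=> //.
  case: gK2 => _ KM _; apply: KM; first exact: wel1_K2.
  apply: nup_K2 iso _ _; last exact: ppowMl.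
  by apply: ppowN; rewrite (ppow_conj un); apply: ppowMr.
by move=> j; rewrite wel1_mul_row2.
Qed.

(** With the middle coordinate scaled to $-1$, the row $(x,-1,z)$ has $x\overline{z}$ of trace $-1$,
    so $z$ is a unit. A torus element makes it 1; the first coordinate then differs from $-1/2$ by
    an element $d$ of trace zero, which [nlow 0 d] accounts for. *)
Lemma row2_gamma0_K2 k : K0 v k -> ~ ppow v 1 (k 2%:R 1) ->
  exists c k', [/\ K2 v k', c != 0, v c = 0 &
    forall j, k 2%:R j = c * (gamma0 * k')%g 2%:R j].
Proof.
move=> Kk hY; have [Y0 vY] := dval_unit (Kk 2%:R 1) hY.
pose c := - k 2%:R 1; have c0 : c != 0 by rewrite oppr_eq0.
have vc : v c = 0 by rewrite dvalN.
have cV : ppow v 0 c^-1 by right; rewrite dvalV // vc.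
have sc0 : sigma c != 0 by rewrite fmorph_eq0.
pose x := k 2%:R 0 / c; pose z := k 2%:R 2%:R / c.
have ox : ppow v 0 x by apply: ppowMl.
have oz : ppow v 0 z by apply: ppowMl.
have iso : x * sigma z + 1 + sigma (x * sigma z) = 0.
  rewrite (rmorphM _ x (sigma z)) /= sigmaK.
  have -> : (0 : E) = 0 / (c * sigma c) by rewrite mul0r.
  have eY : k 2%:R 1 = - c by rewrite opprK.
  have := row2_isotropic k; rewrite eY rmorphN /= => e.
  rewrite -[X in X / _]e /x /z !fmorph_div /=; field; exact/andP.
have z1 : ~ ppow v 1 z.
  move=> hz; apply: one1.
  have -> : (1 : E) = - (x * sigma z + sigma (x * sigma z)).
    by rewrite -[RHS]add0r -[X in X - _]iso; ring.
  by apply/ppowN/ppowD; rewrite ?(ppow_conj un); apply: ppowMl; rewrite ?(ppow_conj un).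
have [z0 vz] := dval_unit oz z1.
have sz0 : sigma z != 0 by rewrite fmorph_eq0.
pose d := x * sigma z + 1 / 2%:R.
have isod : isotropic sigma 0 d.
  rewrite /isotropic /d mul0r addr0 rmorphD (fmorph_div _ 1) rmorph_nat /= conj1 -iso.
  by field.
have od : ppow v 0 d.
  apply: ppowD; last by apply/(ppow_half un)/ppow1.
  by apply: ppowMl; rewrite ?(ppow_conj un).
have szV0 : (sigma z)^-1 != 0 by rewrite invr_eq0.
exists c, (nlow sigma 0 d * tel sigma (sigma z)^-1)%g; split=> //.
  case: gK2 => _ KM _; apply: KM; first by apply: nlow_K2 => //; exact: ppow0.
  have ou : ppow v 0 (sigma z)^-1 by right; rewrite dvalV // sigmaV vz.
  rewrite /K2 /Kexp /= telE // mx3E subrr fmorphV invrK /= sigmaK; split; last exact: ppow0.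
  by apply: ord3P; apply: ord3P; rewrite !mx3E //; (try exact: ppow0); exact: ppow1.
have gn j : (gamma0 * nlow sigma 0 d)%g 2%:R j = mx3 0 0 0 0 0 0 (x * sigma z) (-1) 1 2%:R j.
  have [[g0 g1] g2] := gamma0_row2; move: gamma0 g0 g1 g2 => g g0 g1 g2; move: j.
  apply: ord3P; rewrite U3M g0 g1 g2 nlowE // !mx3E ?rmorph0 ?oppr0;
    rewrite !(mulr0, mulr1, mul1r, addr0, add0r) //.
  by rewrite /d addrCA -mulrDl addNr mul0r addr0.
have e j : (gamma0 * (nlow sigma 0 d * tel sigma (sigma z)^-1))%g 2%:R j =
    mx3 0 0 0 0 0 0 x (-1) z 2%:R j.
  rewrite mulgA; move: (gamma0 * _)%g gn => g gn; move: j.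
  apply: ord3P; rewrite tel_mulr // gn !mx3E ?mulfK //.
  by rewrite mul1r fmorphV invrK /= sigmaK.
by apply: ord3P; rewrite e !mx3E /x /z /c ?mulrN1 ?opprK // mulrC divfK.
Qed.

Definition K2_fixed f : Prop := forall g k, K2 v k -> f (g * k)%g = f g.

Lemma K2_fixed_Gfix f : K2_fixed f -> Gfix v 2 f.
Proof. by move=> hf g h hh; apply: hf; apply: (Gam_K2 un) hh. Qed.

Lemma K2_values f k : rowhom v f -> K2_fixed f -> K0 v k ->
  f k = if `[< ppow v 1 (k 2%:R 1) >] then f 1%g else f gamma0.
Proof.
move=> hf fK Kk; case: ifPn => /asboolP hY.
  have [c [k' [Kk' c0 vc e]]] := row2_K2 Kk hY.
  by rewrite (rowhom_unit hf c0 vc e) -[k']mul1g fK.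
have [c [k' [Kk' c0 vc e]]] := row2_gamma0_K2 Kk hY.
by rewrite (rowhom_unit hf c0 vc e) fK.
Qed.

Lemma rowhom_borel f b k : rowhom v f -> borel b -> f (b * k)%g = Q ^ (2 * v (b 2%:R 2%:R)) * f k.
Proof.
move=> hf bb; have [b10 b20 b21] := borel_entries bb.
have [_ b22 _] := borel_row2 b20 b21.
by apply: hf => // j; rewrite U3M b20 b21 !mul0r !add0r.
Qed.

Lemma K2_fixed_eq0 f : rowhom v f -> K2_fixed f -> f 1%g = 0 -> f gamma0 = 0 -> f = fun=> 0.
Proof.
move=> hf fK f1 fg; apply: funext => g; have [b [k [bb Kk ->]]] := Iwasawa un g.
by rewrite rowhom_borel // (K2_values hf fK Kk) f1 fg if_same mulr0.
Qed.

(** Modulo $p$ the bottom row of an element of [Iw] is a multiple of $(0,0,1)$, so left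
    multiplication only rescales the bottom row. *)
Lemma Iw_mul_row21 k i : Iw v i -> K0 v k ->
  ppow v 1 ((i * k)%g 2%:R 1) <-> ppow v 1 (k 2%:R 1).
Proof.
have h i' k' : Iw v i' -> K0 v k' -> ppow v 1 (k' 2%:R 1) -> ppow v 1 ((i' * k')%g 2%:R 1).
  move=> Ii Kk hk; rewrite U3M; have := Ii 2%:R 0; have := Ii 2%:R 1; rewrite !mx3E => h1 h0.
  apply: ppowD; first by apply: ppowD; apply: ppowMr => //; exact: Kk.
  by apply: ppowMl => //; exact: (Iw_K0 Ii).
move=> Ii Kk; split; last exact: h.
rewrite -{2}(mulKg i k); apply: h; first by case: gIw => _ _; apply.
by case: gK0 => _ KM _; apply: KM => //; exact: Iw_K0.
Qed.

(** On [K0] the value of [f] depends only on whether the middle entry of the bottom row lies in $p$,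
    so it is left invariant under [Iw]; inversion makes it a function on $K_0/Iw$. The Weyl coset
    and the $q$ cosets with $y$ in $p$ give $f(1)$, the remaining $q(q^2-1)$ give the other value,
    and $q + 1$ factors out. *)
Lemma mass_K2_fixed f : rowhom v f -> K2_fixed f ->
  (q ^ 3 + 1)%:R * mass v 2 f = (q%:R + 1) * (f 1%g + q%:R * (q%:R - 1) * f gamma0).
Proof.
move=> hf fK; have fG := K2_fixed_Gfix fK.
have [sF [rF sizeF]] := un_reps un; have [sE [rE sizeE]] := un_repsE un.
have [s ts] := K0_Gam_coset_reps un (sigma := sigma) 2.
have tr := K0_Iw_coset_reps un rE rF.
have [_ KM KV] := gK0.
rewrite /mass -(avg_inv gK0 (gGam 2) _ ts (Gfix_rinv fG)); last first.
  by move=> k h; apply: (Gam_normal un).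
have fV : rinv_on (K0 v) (Iw v) (fun x => f x^-1%g).
  move=> x i Kx Ii; have Iiv : Iw v i^-1%g by case: gIw => _ _; apply.
  have KxV := KV _ Kx; have KxiV := KV _ (KM _ _ Kx (Iw_K0 Ii)).
  rewrite (K2_values hf fK KxV) (K2_values hf fK KxiV) invgM; congr (if _ then _ else _).
  by apply: asbool_equiv_eq; apply: Iw_mul_row21 => //; exact: KV.
rewrite (avg_refine gK0 gIw (gGam 2) (@Iw_K0 _ _ _ _) (Gam_Iw un _) tr ts fV) //.
rewrite (avgE gIw tr fV) /= size_allpairs sizeF sizeE -expnSr addn1.
rewrite mulVKf ?pnatr_eq0 // big_cons big_allpairs_dep.
rewrite (K2_values hf fK (KV _ (wel1_K0 v sigma))).
rewrite U3V !rev3 wel1E mx3E conj0 asboolT; last exact: ppow0.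
have [uE oE dE covE] := rE; have [uF oF _ _] := rF.
have hy y : y \in sE -> \sum_(s <- sF) f (nlow sigma y (zpar sigma delta y s))^-1%g =
    q%:R * (if `[< ppow v 1 y >] then f 1%g else f gamma0).
  move=> ys; rewrite big_seq (eq_bigr (fun=> if `[< ppow v 1 y >] then f 1%g else f gamma0)).
    by rewrite -big_seq sum_const_seq sizeF.
  move=> x xs; have iso := isotropic_zpar un y x.
  have Kn : K0 v (nlow sigma y (zpar sigma delta y x)).
    apply: (nlow_K0 un) => //; first exact: oE.
    by apply: (zpar_ppow un); [exact: oE | exact: oF].
  rewrite (K2_values hf fK (KV _ Kn)) U3V !rev3 nlowE // mx3E; congr (if _ then _ else _).
  by apply: asbool_equiv_eq; exact: (ppow_conj un).
rewrite big_seq (eq_bigr _ hy) -big_seq -mulr_sumr.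
have [y0 y0s hy0] := covE 0 (ppow0 v 0); rewrite (big_rem _ y0s) /= asboolT; last first.
  by move/ppowN: hy0; rewrite sub0r opprK.
rewrite big_seq (eq_bigr (fun=> f gamma0)) => [|y]; last first.
  rewrite mem_rem_uniq // inE => /andP[/eqP yy0 ys]; rewrite asboolF // => y1; apply: yy0.
  by apply: dE => //; move: hy0; rewrite sub0r => /(ppowD y1).
rewrite -big_seq sum_const_seq size_rem // sizeE -subn1.
rewrite natrB ?expn_gt0 ?(ltnW (residue_card_gt1 un)) //.
rewrite natrX; ring.
Qed.

Lemma borel_subgrp : subgrp (@borel F E sigma).
Proof.
split=> [i j|g h bg bh i j ji|g bg i j ji].
- by rewrite U3_1 -val_eqE /= => ji; rewrite gtn_eqF.
- rewrite U3M -(sum3 (fun l => g i l * h l j)) big1 // => k _.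
  by have [ki|ik] := ltnP k i; [rewrite bg ?mul0r | rewrite bh ?mulr0 // (leq_trans ji)].
- by rewrite U3V bg ?rmorph0 // ltn_sub2l // (leq_ltn_trans ji).
Qed.

(** The extension to $G$, with the homogeneity of $V$, of the indicator function of [P] on [K0]. It
    is used to construct the functions $f_{2,i}$. *)
Definition rbump (P : set (U3 sigma)) g : R[i] :=
  let b := xget 1%g [set b | borel b /\ K0 v (b^-1 * g)%g] in
  if `[< P (b^-1 * g)%g >] then Q ^ (2 * v (b 2%:R 2%:R)) else 0.

Lemma borel_K0_unit b : borel b -> K0 v b -> b 2%:R 2%:R != 0 /\ v (b 2%:R 2%:R) = 0.
Proof.
move=> bb Kb; have [b10 b20 b21] := borel_entries bb; apply: dval_unit; first exact: Kb.
move=> h; apply: one1; have := row_rel b 2%:R 2%:R; rewrite rev3 eqxx mulr1n b20 b21 => <-.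
by rewrite !mul0r !add0r; apply: ppowMr => //; rewrite (ppow_conj un); exact: Kb.
Qed.

Section Bump.
Variable P : set (U3 sigma).
Hypothesis PB : forall b k, borel b -> K0 v b -> K0 v k -> P (b * k)%g <-> P k.

(** Two Iwasawa decompositions differ by an element of $B \cap K_0$, whose bottom right entry is a
    unit and under which [P] is invariant; the choice made by [xget] is therefore immaterial. *)
Lemma rbumpE b k : borel b -> K0 v k ->
  rbump P (b * k)%g = if `[< P k >] then Q ^ (2 * v (b 2%:R 2%:R)) else 0.
Proof.
move=> bb Kk; rewrite /rbump; set b' := xget _ _; have [_ BM BV] := borel_subgrp.
have [_ KM KV] := gK0.
have [bb' Kb'] : borel b' /\ K0 v (b'^-1 * (b * k))%g.
  apply: (@xgetPex _ 1%g [set b' | borel b' /\ K0 v (b'^-1 * (b * k))%g]).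
  by exists b; split=> //; rewrite mulKg.
pose a := (b'^-1 * b)%g; have ba : borel a by apply: BM => //; exact: BV.
have Ka : K0 v a by have := KM _ _ Kb' (KV _ Kk); rewrite mulgA mulgK.
have [a0 va] := borel_K0_unit ba Ka.
have [_ b'20 b'21] := borel_entries bb'.
have [_ b'22 _] := borel_row2 b'20 b'21.
have eb : b 2%:R 2%:R = b' 2%:R 2%:R * a 2%:R 2%:R.
  by rewrite -[b](mulVKg b') U3M b'20 b'21 !mul0r !add0r.
rewrite mulgA -/a eb dvalM // va addr0; congr (if _ then _ else _).
by apply: asbool_equiv_eq; exact: PB.
Qed.


Lemma rbump_neq0 b k : borel b -> K0 v k -> rbump P (b * k)%g != 0 <-> P k.
Proof.
move=> bb Kk; rewrite rbumpE //; case: ifPn => /asboolP h; last by rewrite eqxx; split.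
by rewrite expfz_neq0.
Qed.

Lemma rbump_rowhom : rowhom v (rbump P).
Proof.
move=> c g h c0 e; have [ba _] := row2_prop c0 e.
have a22 : (g * h^-1)%g 2%:R 2%:R = c.
  have -> : (g * h^-1)%g 2%:R 2%:R = c * (h * h^-1)%g 2%:R 2%:R.
    by rewrite !U3M !e; ring.
  by rewrite mulgV U3_1 mulr1.
rewrite -[g in LHS](mulgVK h); move: (g * h^-1)%g ba a22 => a ba a22.
have [b [k [bb Kk ->]]] := Iwasawa un h; have [_ BM _] := borel_subgrp.
rewrite mulgA !rbumpE //; last exact: BM.
have [_ a20 a21] := borel_entries ba; have [_ b20 b21] := borel_entries bb.
have [_ b22 _] := borel_row2 b20 b21.
case: ifP => _; last by rewrite mulr0.
by rewrite U3M a20 a21 !mul0r !add0r a22 dvalM // mulrDr expfzDr.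
Qed.

Lemma rbump_K2_fixed : (forall k k', K0 v k -> K2 v k' -> P (k * k')%g <-> P k) ->
  K2_fixed (rbump P).
Proof.
move=> PK g k' Kk'; have [b [k [bb Kk ->]]] := Iwasawa un g; have [_ KM _] := gK0.
rewrite -mulgA !rbumpE //; last by apply: KM => //; exact: K2_K0.
congr (if _ then _ else _); apply: asbool_equiv_eq; exact: PK.
Qed.

End Bump.

(** Modulo $p$ column 1 of an element of [K2] is that of the identity. *)
Lemma K2_row21 k k' : K0 v k -> K2 v k' ->
  ppow v 1 ((k * k')%g 2%:R 1) <-> ppow v 1 (k 2%:R 1).
Proof.
have h l l' : K0 v l -> K2 v l' -> ppow v 1 (l 2%:R 1) -> ppow v 1 ((l * l')%g 2%:R 1).
  move=> Kl [Kl' _] hl; rewrite U3M; have := Kl' 0 1; have := Kl' 1 1; have := Kl' 2%:R 1.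
  rewrite !mx3E => h2 h1 h0; apply: ppowD; last by apply: ppowMl => //; exact: Kl.
  by apply: ppowD; [apply: ppowMl => //; exact: Kl | exact: ppowMr].
move=> Kk Kk'; split; last exact: h.
rewrite -{2}(mulgK k' k); apply: h; last by case: gK2 => _ _; apply.
by case: gK0 => _ KM _; apply: KM => //; exact: K2_K0.
Qed.

Lemma borel_row21 b k : borel b -> K0 v b -> K0 v k ->
  ppow v 1 ((b * k)%g 2%:R 1) <-> ppow v 1 (k 2%:R 1).
Proof.
move=> bb Kb; apply: Iw_mul_row21; apply: (K0_Iw un) => //.
by have [_ -> _] := borel_entries bb; left.
Qed.

End LevelTwo.


(** * The Steinberg representation *)

Section Newforms.
Variables (R : realType) (F : fieldType) (E : splittingFieldType F) (vF : dvaluation F)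
  (v : dvaluation E) (sigma : gal_of {:E}) (varpi : F) (delta : E).
Hypothesis un : unram vF v sigma varpi delta.
Implicit Types (g h k b : U3 sigma) (m n : nat) (f : U3 sigma -> R[i]).

Local Notation w := (varpi%:A : E).
Let sigmaK := un_sigmaK un.
Let w_neq0 : w != 0 := proj1 (un_varpi un).
Let conj0 : sigma 0 = 0. Proof. exact: rmorph0. Qed.

Local Notation q := (residue_card vF).
Local Notation Q := ((residue_card v)%:R : R[i]).
Local Notation V := (IndB (sigma := sigma) v (fun a => (normabs v R a)%:C) (fun=> 1)).
Local Notation K2_fixed := (K2_fixed (sigma := sigma) (R := R) v).
Local Notation gamma0 := (gamma0 sigma).

Let Q0 : Q != 0. Proof. by rewrite gt_eqF ?(Q_gt0 R un). Qed.
Let gK0 : subgrp (K0 v (sigma := sigma)) := K0_subgrp un.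
Let gK2 : subgrp (K2 v (sigma := sigma)) := K2_subgrp un.
Let gIw : subgrp (Iw v (sigma := sigma)) := Iw_subgrp un.
Let gGam m : subgrp (Gam v (sigma := sigma) m) := Gam_subgrp un m.

Section Steinberg.
Variable V1 : set (U3 sigma -> R[i]).
Hypothesis irrV1 : irreducible_subrep V V1.

Let subV1 : subrepresentation V V1. Proof. by case: irrV1. Qed.
Let V1V f : V1 f -> V f. Proof. by case: subV1 => h _ _ _; apply: h. Qed.
Let V1hom f : V1 f -> rowhom v f. Proof. by move=> h; apply: (IndB_rowhom un) (V1V h). Qed.

Lemma V1_relation f : V1 f -> K2_fixed f -> f 1%g = - (q%:R * (q%:R - 1)) * f gamma0.
Proof.
move=> Vf fK; have := mass_K2_fixed un (V1hom Vf) fK.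
rewrite (null_mass un (irreducible_null un irrV1 Vf)); last exact: (K2_fixed_Gfix un).
rewrite mulr0 => /esym/eqP; rewrite mulf_eq0 natr1 pnatr_eq0 /= addr_eq0 => /eqP ->.
by rewrite mulNr.
Qed.

(* Translating by a high power of tel varpi makes f constant on Iw. *)
Lemma V1_Iw_fixed : exists f, [/\ V1 f, Iw_fixed v f & f 1%g != 0].
Proof.
have [f [g [Vf fg]]] : exists f g, V1 f /\ f g != 0.
  apply: contrapT => h; case: irrV1 => [[_ V0 _ _]] n0 _; apply: n0.
  apply/seteqP; split=> [f Vf|_ -> //]; apply: funext => g; apply/eqP/negPn/negP => fg.
  by apply: h; exists f, g.
have [_ _ _ Vtr] := subV1.
pose f' := rtrans g f; have Vf' : V1 f' by exact: Vtr.
have [m fm] := IndB_smooth un (V1V Vf').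
pose t := tel sigma (w ^ m%:Z).
pose f1 := rtrans t f'; have Vf1 : V1 f1 by exact: Vtr.
have wm0 (n : int) : w ^ n != 0 by rewrite expfz_neq0.
pose c := w ^ (- m%:Z).
(* The contraction: the bottom row of [nlow y z * t] is $w^{-m}$ times that of [nlow y' z'], an
   element of [Gam m]. *)
have f1n y z : isotropic sigma y z -> ppow v 0 y -> ppow v 0 z ->
    f1 (nlow sigma y z) = Q ^ (2 * v c) * f' 1%g.
  move=> iso hy hz; pose y' := w ^ m%:Z * y; pose z' := w ^ m%:Z * w ^ m%:Z * z.
  have sy' : sigma y' = w ^ m%:Z * sigma y by rewrite rmorphM /= (conj_varpi un).
  have sz' : sigma z' = w ^ m%:Z * w ^ m%:Z * sigma z by rewrite !rmorphM /= (conj_varpi un).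
  have iso' : isotropic sigma y' z'.
    rewrite /isotropic sy' sz' /y' /z' -[RHS](mulr0 (w ^ m%:Z * w ^ m%:Z)) -iso.
    by move: (w ^ m%:Z) (sigma y) (sigma z) => W sy sz; ring.
  have hy' : ppow v m%:Z y' by apply: ppowMr => //; exact: (ppow_varpi un).
  have hz' : ppow v m%:Z z'.
    apply: ppowMr => //; apply: ppowMr; first exact: (ppow_varpi un).
    exact: ppowW (ppow_varpi un _).
  have Gn : Gam v m (nlow sigma y' z').
    apply/GamE; apply: ord3P; apply: ord3P; rewrite nlowE // !mx3E ?subrr ?subr0 //;
      (try exact: ppow0).
    by apply: ppowN; rewrite (ppow_conj un).
  rewrite -(fm 1%g _ Gn) mul1g.
  have -> : f1 (nlow sigma y z) = f' (nlow sigma y z * t)%g by [].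
  apply: (V1hom Vf' (wm0 (- m%:Z))).
  apply: ord3P; rewrite tel_mulr // !nlowE // !mx3E ?(conj_varpi un) ?mulr1.
  - by rewrite /z' !mulrA -expfzDr // addNr expr0z mul1r mulrC.
  - by rewrite sy' mulrN mulrA -expfzDr // addNr expr0z mul1r.
  - by rewrite mul1r /c invr_expz.
have n1 : nlow sigma 0 0 = 1%g.
  apply: U3P; apply: ord3P; apply: ord3P; rewrite nlowE ?mx3E ?U3_1 ?conj0 ?oppr0 //;
  by rewrite /isotropic conj0; ring.
have f11 : f1 1%g = Q ^ (2 * v c) * f' 1%g.
  rewrite -{1}n1 f1n //; try exact: ppow0.
  by rewrite /isotropic conj0; ring.
have f1I i : Iw v i -> f1 i = f1 1%g.
  move=> Ii; have Ki := Iw_K0 Ii; have := Ii 2%:R 0; have := Ii 2%:R 1; rewrite !mx3E => h1 h0.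
  have hZ : ~ ppow v 1 (i 2%:R 2%:R) by move=> h2; apply: (row2_unit un Ki h1 h2).
  have [Z0 vZ] := dval_unit (Ki 2%:R 2%:R) hZ.
  have ZV : ppow v 0 (i 2%:R 2%:R)^-1 by right; rewrite dvalV // vZ.
  have [iso e] := row2_nlow un Z0; rewrite (rowhom_unit (V1hom Vf1) Z0 vZ e) f1n //.
    by apply: ppowN; rewrite (ppow_conj un); apply: ppowMl => //; exact: Ki.
  by apply: ppowMl => //; exact: Ki.
have [m1 fm1] := IndB_smooth un (V1V Vf1).
have fm2 := GfixW (leqnSn m1) fm1.
have [s ts] := Iw_Gam_coset_reps un (ltn0Sn m1).
exists (avgf (Iw v) (Gam v m1.+1) f1); split.
- exact: subrep_avgf subV1 Vf1.
- by move=> x i Ii; apply: (avgf_rinv un) => //; exists s.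
rewrite /avgf (eq_avg (f2 := fun=> f1 1%g) ts) => [|i Ii]; last by rewrite mul1g f1I.
by rewrite (avg_const _ gIw ts) f11 mulf_neq0 ?expfz_neq0 // /f' /rtrans mul1g.
Qed.

(** Mass zero reads $f(1) + q^3 f(w) = 0$, so $f(w) \neq 0$. The average over [K2] is evaluated at
    [gamma0] because [gamma0 * k] never lies in [Iw], so that every term equals $f(w)$. *)
Lemma V1_K2_fixed_ex : exists f, [/\ V1 f, K2_fixed f & f gamma0 != 0].
Proof.
have [f [Vf fI f1]] := V1_Iw_fixed; have hf := V1hom Vf.
have fm : Gfix v 2 f by move=> g h hh; apply: fI; exact: (Gam_Iw un) hh.
have fw : f (wel sigma 1) != 0.
  apply/eqP => fw; have [sF [rF _]] := un_reps un; have [sE [rE _]] := un_repsE un.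
  have [s ts] := K0_Gam_coset_reps un (sigma := sigma) 2.
  have := avg_K0_Iw un hf fI; rewrite fw mulr0 addr0.
  have fI' : rinv_on (K0 v) (Iw v) f by move=> x i _; apply: fI.
  rewrite -(avg_refine gK0 gIw (gGam 2) (@Iw_K0 _ _ _ _) (Gam_Iw un _)
    (K0_Iw_coset_reps un rE rF) ts fI') //.
  rewrite -/(mass v 2 f) (null_mass un (irreducible_null un irrV1 Vf)) // mulr0 => /esym/eqP.
  by rewrite (negPf f1).
have G2K2 : Gam v (sigma := sigma) 2 `<=` K2 v by apply: (Gam_K2 un).
have [s ts] := Gam_coset_reps un gK2 (@K2_K0 _ _ _ _) G2K2.
exists (avgf (K2 v) (Gam v 2) f); split.
- exact: subrep_avgf subV1 Vf.
- by move=> x k Kk; apply: (avgf_rinv un) => //; exists s.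
rewrite /avgf (eq_avg (f2 := fun=> f (wel sigma 1)) ts) ?(avg_const _ gK2 ts) // => k Kk.
have Kg := gamma0_K0 un; have Kgk : K0 v (gamma0 * k)%g.
  by case: gK0 => _ KM _; apply: KM => //; exact: K2_K0.
apply: (Iw_values un) => // /(_ 2%:R 1); rewrite mx3E (K2_row21 un) //.
rewrite (gamma0_row2 un) => /ppowN; rewrite opprK.
by have [_] := unit_ppow (oner_neq0 E) (dval1 v).
Qed.

Lemma V1_K2_fixedP f : V f -> K2_fixed f ->
  V1 f <-> f 1%g = - (q%:R * (q%:R - 1)) * f gamma0.
Proof.
move=> Vf fK; split=> [Wf|e]; first exact: V1_relation.
have [g [Vg gK g0]] := V1_K2_fixed_ex; have eg := V1_relation Vg gK.
(* This multiple of [g] agrees with [f] at [gamma0], hence also at 1 by the relation. *)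
pose c := f gamma0 / g gamma0.
have h0 : (fun x => f x - c * g x) = fun=> 0.
  apply: (K2_fixed_eq0 un).
  - move=> a x y a0 exy; rewrite (IndB_rowhom un Vf a0 exy) (V1hom Vg a0 exy); ring.
  - by move=> x k Kk; rewrite fK // gK.
  - by rewrite e eg /c; field.
  - by rewrite /c divfK // subrr.
case: subV1 => _ V0 Vlin _; have := Vlin c _ _ Vg V0; congr V1; apply: funext => x.
have /eqP := congr1 (fun f : U3 sigma -> R[i] => f x) h0.
by rewrite subr_eq0 addr0 => /eqP.
Qed.

(** Since $1 + p^0$ is the ring of integers, [Kgrp] at level 0 contains [K0] and the Iwasawa
    decomposition applies. *)
Lemma K0_fixed_eq0 f : V1 f -> (forall g k, Kgrp v 0 k -> f (g * k)%g = f g) -> f = fun=> 0.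
Proof.
move=> Vf fK; apply: (positive_eq0 un irrV1 Vf) => g.
have [b [k [bb Kk ->]]] := Iwasawa un g; exists (Q ^ (2 * v (b 2%:R 2%:R))).
  by rewrite exprz_gt0 // (Q_gt0 R un).
rewrite (rowhom_borel k (V1hom Vf) bb) -[k in LHS]mul1g fK //.
apply: ord3P; apply: ord3P; rewrite !mx3E ?subr0 ?oppr0; (try exact: Kk).
by apply: ppowB; [exact: Kk | exact: ppow1].
Qed.

(** In [row2_split] with $n = 1$, the first case gives an element of $K_1$ directly; in the second,
    [wel varpi] and the upper unipotent both lie in $K_1$, and dividing the scalar by [varpi]
    corrects the bottom row. *)
Lemma K1_fixed_eq0 f : V1 f -> (forall g k, Kgrp v 1 k -> f (g * k)%g = f g) -> f = fun=> 0.
Proof.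
move=> Vf fK; apply: (positive_eq0 un irrV1 Vf) => g; have hf := V1hom Vf.
have [[c [y [z [c0 iso hy hz e]]]]|[c [y [z [c0 iso hy hz e]]]]] :=
    @row2_split _ _ _ _ _ _ _ un 1 g isT isT.
  exists (Q ^ (2 * v c)); first by rewrite exprz_gt0 // (Q_gt0 R un).
  rewrite (hf _ _ _ c0 e) -[nlow _ _ _]mul1g fK //.
  rewrite /Kgrp /= nlowE //; apply: ord3P; apply: ord3P; rewrite !mx3E ?subr0 ?subrr //;
    (try exact: ppow0); (try exact: ppow1); (try by apply: ppowW (ppow0 _ 0)).
  by apply: ppowN; rewrite (ppow_conj un).
rewrite subrr in hy hz.
exists (Q ^ (2 * v (c / w))); first by rewrite exprz_gt0 // (Q_gt0 R un).
have cw0 : c / w != 0 by rewrite mulf_neq0 // invr_eq0.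
rewrite (hf (c / w) _ (wel sigma w * nup sigma y z)%g) //; last first.
  move=> j; rewrite e U3M (welwE un) !mx3E !mul0r !addr0.
  by rewrite mulrA divfK.
rewrite fK; last first.
  rewrite /Kgrp /= nupE //; apply: ord3P; apply: ord3P; rewrite !mx3E ?subr0 ?subrr //;
    (try exact: ppow0); (try exact: ppow1).
  - by apply: ppowN; rewrite (ppow_conj un).
  - by apply: ppowW hz.
rewrite -[wel _ _]mul1g fK // /Kgrp /= (welwE un).
apply: ord3P; apply: ord3P; rewrite !mx3E ?subr0 ?subrr //; (try exact: ppow0).
- exact: (ppow_varpi un (-1)).
- exact: (ppow_varpi un 1).
Qed.

End Steinberg.
End Newforms.


(** * The functions f_{2,i} *)

Section Transport.
Variables (R : realType) (F : fieldType) (E : splittingFieldType F) (vF : dvaluation F)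
  (v : dvaluation E) (sigma : gal_of {:E}) (varpi : F) (delta : E).
Hypothesis un : unram vF v sigma varpi delta.
Implicit Types (g h k b : U3 sigma) (m n : nat) (f : U3 sigma -> R[i]).

Local Notation w := (varpi%:A : E).
Let sigmaK := un_sigmaK un.
Let sigmaF := un_sigmaF un.
Let w_neq0 : w != 0 := proj1 (un_varpi un).
Let vw : v w = 1 := proj2 (un_varpi un).
Let two0 : (2%:R : E) != 0 := proj1 (un_two un).
Let conj1 : sigma 1 = 1. Proof. exact: rmorph1. Qed.

Local Notation Q := ((residue_card v)%:R : R[i]).
Local Notation V := (IndB (sigma := sigma) v (fun a => (normabs v R a)%:C) (fun=> 1)).
Local Notation K2_fixed := (K2_fixed (sigma := sigma) (R := R) v).
Local Notation gamma0 := (gamma0 sigma).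
Local Notation t := (tel sigma w).

Let Q0 : Q != 0. Proof. by rewrite gt_eqF ?(Q_gt0 R un). Qed.
Let wV0 : w^-1 != 0. Proof. by rewrite invr_eq0. Qed.
Let gK0 : subgrp (K0 v (sigma := sigma)) := K0_subgrp un.
Let gK2 : subgrp (K2 v (sigma := sigma)) := K2_subgrp un.

Lemma rtransK h f : rtrans h^-1%g (rtrans h f) = f.
Proof. by apply: funext => x; rewrite /rtrans mulgVK. Qed.

Lemma IndB_rowhomP f : V f <-> rowhom v f /\ exists m, Gfix v m f.
Proof.
split=> [Vf|[hf [m fm]]]; last exact: (rowhom_IndB un hf (Gfix_locally_constant un fm)).
by split; [exact: (IndB_rowhom un) | exact: (IndB_smooth un)].
Qed.

Lemma IndB_rtrans h f : V f -> V (rtrans h f).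
Proof.
move=> /IndB_rowhomP[hf [m fm]]; apply/IndB_rowhomP; split; first exact: rowhom_rtrans.
have [m' [_ fm' _]] := mass_invariant un h hf (ltn0Sn m) (GfixW (leqnSn m) fm).
by exists m'.
Qed.

Lemma IndB_lin a f1 f2 : V f1 -> V f2 -> V (fun g => a * f1 g + f2 g).
Proof.
move=> /IndB_rowhomP[h1 [m1 fm1]] /IndB_rowhomP[h2 [m2 fm2]]; apply/IndB_rowhomP; split.
  by move=> c g h c0 e; rewrite (h1 _ _ _ c0 e) (h2 _ _ _ c0 e); ring.
exists (maxn m1 m2) => x y hy.
by rewrite (GfixW (leq_maxl m1 m2) fm1) // (GfixW (leq_maxr m1 m2) fm2).
Qed.

Lemma tel_varpiV : (t^-1 = tel sigma w^-1)%g.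
Proof.
apply: (@mulgI _ t); rewrite mulgV telM // mulfV //.
by apply: U3P; apply: ord3P; apply: ord3P; rewrite telE ?oner_neq0 // mx3E U3_1 ?conj1 ?invr1.
Qed.

Lemma borel_tel a : a != 0 -> borel (tel sigma a).
Proof. by move=> a0; apply: ord3P; apply: ord3P; rewrite telE // mx3E. Qed.

(** Conjugation by $t$ shifts the valuation of the entry $(i,j)$ by $d_i - d_j$ with $d = (1,0,-1)$,
    which makes the corner entry in $p^{-2}$ integral. *)
Lemma Kgrp2_conj k : Kgrp v 2 k <-> K2 v (t * k * t^-1)%g.
Proof.
have cl (n : int) x : ppow v n (w * x) <-> ppow v (n - 1) x.
  split=> h; last by rewrite -(subrKC 1 n); apply: ppowM => //; right; rewrite vw.
  rewrite -[x](mulKf w_neq0) addrC; apply: ppowM => //; right; rewrite dvalV // vw //.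
have clV (n : int) x : ppow v n (w^-1 * x) <-> ppow v (n + 1) x.
  by rewrite -[n in X in X <-> _](addrK 1) -cl mulVKf.
have e i : ((t * k * t^-1)%g i 0 = w^-1 * (t * k)%g i 0) *
    ((t * k * t^-1)%g i 1 = (t * k)%g i 1) * ((t * k * t^-1)%g i 2%:R = w * (t * k)%g i 2%:R).
  by rewrite tel_varpiV !tel_mulr // fmorphV /= sigmaF invrK mulrC [w * _]mulrC.
have e' j : ((t * k)%g 0 j = w * k 0 j) * ((t * k)%g 1 j = k 1 j) *
    ((t * k)%g 2%:R j = w^-1 * k 2%:R j).
  by rewrite !tel_mull // sigmaF.
have k11 : ppow v 2 (k 1 1 - 1) -> ppow v 0 (k 1 1).
  by move=> h; rewrite -[k 1 1](subrK 1); apply: ppowD (ppow1 v); apply: ppowW h.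
split=> [Kk|[Kk]].
  split; last by rewrite e e'; have := Kk 1 1; rewrite !mx3E.
  apply: ord3P; apply: ord3P; rewrite !mx3E e e' ?(cl, clV).
  - by have := Kk 0 0; rewrite !mx3E subr0.
  - by have := Kk 0 1; rewrite !mx3E subr0.
  - by have := Kk 0 2%:R; rewrite !mx3E subr0.
  - by have := Kk 1 0; rewrite !mx3E subr0.
  - by apply: k11; have := Kk 1 1; rewrite !mx3E.
  - by have := Kk 1 2%:R; rewrite !mx3E subr0.
  - by have := Kk 2%:R 0; rewrite !mx3E subr0.
  - by have := Kk 2%:R 1; rewrite !mx3E subr0.
  - by have := Kk 2%:R 2%:R; rewrite !mx3E subr0.
rewrite e e' => h11; apply: ord3P; apply: ord3P; rewrite !mx3E ?subr0 //.
- by have := Kk 0 0; rewrite !mx3E e e' ?(cl, clV).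
- by have := Kk 0 1; rewrite !mx3E e e' ?(cl, clV).
- by have := Kk 0 2%:R; rewrite !mx3E e e' ?(cl, clV).
- by have := Kk 1 0; rewrite !mx3E e e' ?(cl, clV).
- by have := Kk 1 2%:R; rewrite !mx3E e e' ?(cl, clV).
- by have := Kk 2%:R 0; rewrite !mx3E e e' ?(cl, clV).
- by have := Kk 2%:R 1; rewrite !mx3E e e' ?(cl, clV).
- by have := Kk 2%:R 2%:R; rewrite !mx3E e e' ?(cl, clV).
Qed.

Lemma Kgrp2_fixedP f : (forall k, Kgrp v 2 k -> rtrans k f = f) <-> K2_fixed (rtrans t f).
Proof.
split=> [fK g k Kk|fK k Kk].
  have Kk' : Kgrp v 2 (t^-1 * k * t)%g by rewrite Kgrp2_conj !mulgA mulgV mul1g mulgK.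
  rewrite /rtrans -[in RHS](fK _ Kk') /rtrans !mulgA; congr f.
  by rewrite mulgK.
apply: funext => x; move/Kgrp2_conj: Kk => /(fK (x * t^-1)%g).
by rewrite /rtrans !mulgA !mulgVK.
Qed.

Local Notation gam := (gamma sigma varpi).

Section Gamma.
Hypothesis galE : sigma \in 'Gal({:E} / 1)%g.

Lemma isotropic_gamma (i : int) : isotropic sigma (w ^ i) (- w ^ (2 * i) / 2%:R).
Proof.
rewrite /isotropic fmorph_div rmorphN rmorph_nat /= !(conj_varpi un).
have -> : w ^ (2 * i) = w ^ i * w ^ i by rewrite mulrC -exprz_exp.
by move: (w ^ i) => x; field.
Qed.

Lemma gammaN (i : int) : gam i = nlow sigma (w ^ i) (- w ^ (2 * i) / 2%:R).
Proof.
apply: U3P => j l; rewrite gammaE // nlowE //; last exact: isotropic_gamma.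
by rewrite (conj_varpi un).
Qed.

Lemma gamma_conj (i : int) : (t * gam (i + 1) * t^-1)%g = gam i.
Proof.
have alg2 (x W : E) : W != 0 -> W^-1 * (- (x * (W * W)) / 2%:R) * W^-1 = - x / 2%:R.
  by move=> W0; field; exact/andP.
have alg1 (x W : E) : W != 0 -> W^-1 * - (x * W) = - x by move=> W0; field.
have e2 : w ^ (2 * (i + 1)) = w ^ (2 * i) * (w * w).
  by rewrite mulrDr mulr1 expfzDr.
rewrite !gammaN tel_varpiV; apply: U3P => l; apply: ord3P;
  rewrite tel_mulr //; move: l; apply: ord3P; rewrite tel_mull // !nlowE ?mx3E //;
  try exact: isotropic_gamma; rewrite ?fmorphV /= ?sigmaF ?invrK ?(conj_varpi un).
- by rewrite mulr1 mulfV.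
- by rewrite expfzDr // expr1z mulfK.
- by rewrite e2; exact: alg2.
- by rewrite mulr0.
- by rewrite expfzDr // expr1z; exact: alg1.
- by rewrite mulr0 mul0r.
- by rewrite mul0r.
by rewrite mulr1 mulVf.
Qed.

Lemma gamma_0 : gam 0 = gamma0.
Proof. by rewrite gammaN mulr0 !expr0z. Qed.

Lemma gamma1_K2 : K2 v (gam 1).
Proof.
rewrite gammaN; apply: (nlow_K2 un); [exact: isotropic_gamma | exact: (ppow_varpi un) |].
by apply/(ppow_half un)/ppowN; apply: ppowW (ppow_varpi un _).
Qed.

(** Hence $f_{2,2}(1) = f_{2,2}(\gamma_2) = 1$. *)
Lemma gamma2_Kgrp : Kgrp v 2 (gam 2).
Proof. by rewrite Kgrp2_conj (gamma_conj 1); exact: gamma1_K2. Qed.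

Lemma rowhom_tel_mul f g : rowhom v f -> f (t * g)%g = Q ^ (2 * v w^-1) * f g.
Proof.
move=> hf; rewrite (rowhom_borel g hf (borel_tel w_neq0)) telE // mx3E sigmaF //.
Qed.

Lemma rtrans_t1 f : rowhom v f -> rtrans t f 1%g = Q ^ (2 * v w^-1) * f 1%g.
Proof. by move=> hf; rewrite /rtrans mul1g -[t]mulg1 rowhom_tel_mul. Qed.

(** The factor is the one of [rtrans_t1], so a homogeneous relation between the two values survives
    the passage to [K2]. *)
Lemma rtrans_tgamma0 f : rowhom v f -> rtrans t f gamma0 = Q ^ (2 * v w^-1) * f (gam 1).
Proof. by move=> hf; rewrite -rowhom_tel_mul // /rtrans -gamma_0 -(gamma_conj 0) mulgVK. Qed.

Lemma Kgrp2_double_coset (i : int) g :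
  (exists b k, [/\ borel b, Kgrp v 2 k & g = (b * gam (i + 1) * k)%g]) <->
  (exists b k, [/\ borel b, K2 v k & (g * t^-1)%g = (b * gam i * k)%g]).
Proof.
have [_ BM BV] := borel_subgrp sigma; have Bt := borel_tel w_neq0.
split=> [[b [k [bb Kk ->]]]|[b [k [bb Kk e]]]].
  exists (b * t^-1)%g, (t * k * t^-1)%g; split; [|exact/Kgrp2_conj|].
    by apply: BM => //; exact: BV.
  by rewrite -(gamma_conj i) !mulgA !mulgVK.
exists (b * t)%g, (t^-1 * k * t)%g; split; first exact: BM.
  by rewrite Kgrp2_conj !mulgA mulgV mul1g mulgK.
by rewrite -[g](mulgVK t) e -(gamma_conj i) !mulgA.
Qed.

(** Within [K0], the sets [PA] and [PB] are the traces of $B\gamma_1 K$ and $B\gamma_0 K$, where $K$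
    is the conjugated group [K2]. *)
Let PA : set (U3 sigma) := [set k | ppow v 1 (k 2%:R 1)].
Let PB : set (U3 sigma) := [set k | ~ ppow v 1 (k 2%:R 1)].

Let PAborel b k : borel b -> K0 v b -> K0 v k -> PA (b * k)%g <-> PA k.
Proof. exact: (borel_row21 un). Qed.

Let PBborel b k : borel b -> K0 v b -> K0 v k -> PB (b * k)%g <-> PB k.
Proof. by move=> bb Kb Kk; rewrite /PB /= (borel_row21 un bb Kb Kk). Qed.

Let PAK2 k k' : K0 v k -> K2 v k' -> PA (k * k')%g <-> PA k.
Proof. exact: (K2_row21 un). Qed.

Let PBK2 k k' : K0 v k -> K2 v k' -> PB (k * k')%g <-> PB k.
Proof. by move=> Kk Kk'; rewrite /PB /= (K2_row21 un Kk Kk'). Qed.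


Let PA_1 : PA 1%g.
Proof.
have [one _ _] := borel_subgrp sigma; have [_ _ e] := borel_entries one.
by rewrite /PA /= e; exact: ppow0.
Qed.

Let PA_gamma0 : ~ PA gamma0.
Proof.
rewrite /PA /= (gamma0_row2 un) => /ppowN; rewrite opprK.
by have [_] := unit_ppow (oner_neq0 E) (dval1 v).
Qed.

Lemma rbumpA_neq0 g : rbump R v PA g != 0 <->
  exists b k, [/\ borel b, K2 v k & g = (b * gam 1 * k)%g].
Proof.
have [_ BM BV] := borel_subgrp sigma; have [_ K2M K2V] := gK2.
split=> [|[b [k [bb Kk ->]]]]; last first.
  have K1 := K2M _ _ gamma1_K2 Kk; rewrite -mulgA (rbump_neq0 R un PAborel bb (K2_K0 K1)).
  by have [one _ _] := gK0; rewrite -[(_ * k)%g]mul1g (PAK2 one K1).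
have [b [k [bb Kk ->]]] := Iwasawa un g; rewrite (rbump_neq0 R un PAborel bb Kk) => Pk.
have [c [k' [Kk' c0 _ e]]] := row2_K2 un Kk Pk; have [bb' _] := row2_prop c0 e.
exists (b * (k * k'^-1))%g, ((gam 1)^-1 * k')%g; split; first exact: BM.
  by apply: K2M => //; apply: K2V; exact: gamma1_K2.
by rewrite !mulgA mulgK mulgVK.
Qed.

Lemma rbumpB_neq0 g : rbump R v PB g != 0 <->
  exists b k, [/\ borel b, K2 v k & g = (b * gam 0 * k)%g].
Proof.
have [_ BM BV] := borel_subgrp sigma; have [_ K0M K0V] := gK0; have Kg := gamma0_K0 un.
rewrite gamma_0; split=> [|[b [k [bb Kk ->]]]]; last first.
  rewrite -mulgA (rbump_neq0 R un PBborel bb); last by apply: K0M => //; exact: K2_K0.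
  exact/(PBK2 Kg Kk).
have [b [k [bb Kk ->]]] := Iwasawa un g; rewrite (rbump_neq0 R un PBborel bb Kk) => Pk.
have [c [k' [Kk' c0 _ e]]] := row2_gamma0_K2 un Kk Pk; have [bb' _] := row2_prop c0 e.
exists (b * (k * (gamma0 * k')^-1))%g, k'; split=> //; first exact: BM.
by rewrite -!mulgA; congr (_ * _)%g; rewrite mulVg mulg1.
Qed.

(** As [f2] is a definite description, a function meeting it must be exhibited: the bump on [P],
    translated by $t^{-1}$ and divided by its value at $\gamma_j$. The shift [j = i + 1] is that of
    [gamma_conj]. *)
Lemma f2_spec_of P (i j : int) : j = i + 1 ->
  (forall b k, borel b -> K0 v b -> K0 v k -> P (b * k)%g <-> P k) ->
  (forall k k', K0 v k -> K2 v k' -> P (k * k')%g <-> P k) ->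
  (forall g, rbump R v P g != 0 <-> exists b k, [/\ borel b, K2 v k & g = (b * gam i * k)%g]) ->
  let f := f2 v V varpi j in
  [/\ Kfixed v V 2 f, f (gam j) = 1 & forall g, f g != 0 <-> rbump R v P (g * t^-1)%g != 0].
Proof.
move=> -> PB' PK2 supp f; pose phi := rbump R v P.
have hphi : rowhom v phi by exact: (rbump_rowhom R un PB').
have phiK : K2_fixed phi by exact: (rbump_K2_fixed R un PB' PK2).
have Vphi : V phi by apply/IndB_rowhomP; split=> //; exists 2%N; exact: (K2_fixed_Gfix un).
pose f' := rtrans t^-1%g phi; have Vf' : V f' by exact: IndB_rtrans.
have f'K k : Kgrp v 2 k -> rtrans k f' = f'.
  move: k; apply/Kgrp2_fixedP; rewrite (_ : rtrans t f' = phi) //.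
  by have := rtransK t^-1%g phi; rewrite invgK.
have supp' g : f' g != 0 <-> exists b k, [/\ borel b, Kgrp v 2 k & g = (b * gam (i + 1) * k)%g].
  by rewrite Kgrp2_double_coset -supp.
have [B1 _ _] := borel_subgrp sigma.
have fg0 : f' (gam (i + 1)) != 0.
  apply/supp'; exists 1%g, 1%g; split; [exact: B1 | | by rewrite mul1g mulg1].
  by rewrite Kgrp2_conj mulg1 mulgV; case: gK2.
have [] : [set f | [/\ Kfixed v V 2 f, f (gam (i + 1)) = 1 & [set g | f g != 0] =
    [set g | exists b k, [/\ borel b, Kgrp v 2 k & g = (b * gam (i + 1) * k)%g]]]] f.
  apply: xgetPex; exists (fun g => (f' (gam (i + 1)))^-1 * f' g); split.
  - split.
      have V0 : V (fun=> 0).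
        apply/IndB_rowhomP; split=> [c g h _ _|]; first by rewrite mulr0.
        by exists 0%N.
      have := IndB_lin (f' (gam (i + 1)))^-1 Vf' V0; congr V; apply: funext => g.
      by rewrite addr0.
    move=> k /f'K e; apply: funext => g; rewrite /rtrans; congr (_ * _).
    exact: (congr1 (fun f : U3 sigma -> R[i] => f g) e).
  - by rewrite mulVf.
  - by apply/seteqP; split=> g /=; rewrite mulf_eq0 invr_eq0 (negPf fg0) /= => /supp'.
move=> Kf f1 sf; split=> // g.
have -> : (f g != 0) <-> [set g | f g != 0] g by [].
by rewrite sf /= -supp'.
Qed.

Lemma f2_values :
  let f1 := f2 v V varpi 1 in let f2 := f2 v V varpi 2 in
  [/\ Kfixed v V 2 f1 /\ Kfixed v V 2 f2, f1 1%g = 0, f1 (gam 1) = 1, f2 1%g = 1 & f2 (gam 1) = 0].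
Proof.
move=> f1 f2'.
have e1 : (1 : int) = 0 + 1 by [].
have e2 : (2%:R : int) = 1 + 1 by [].
(* The index drops by one under conjugation: $f_{2,1}$ comes from $\gamma_0$, hence from [PB], and
   $f_{2,2}$ from $\gamma_1$, hence from [PA]. *)
have [K1 v1 s1] := f2_spec_of e1 PBborel PBK2 rbumpB_neq0.
have [K2' v2 s2] := f2_spec_of e2 PAborel PAK2 rbumpA_neq0.
have [one _ _] := gK0; have btV : borel t^-1%g by rewrite tel_varpiV; exact: borel_tel.
split; [exact: (conj K1 K2') | | exact: v1 | |].
- apply/eqP/negPn/negP => /s1; rewrite mul1g -[(t^-1)%g]mulg1.
  by move/(rbump_neq0 R un PBborel btV one); apply.
- have [_ h] := K2'; have := h _ gamma2_Kgrp.
  move=> /(congr1 (fun f : U3 sigma -> R[i] => f 1%g)); rewrite /rtrans mul1g => e.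
  by rewrite /f2' -e v2.
apply/eqP/negPn/negP => /s2; have -> : (gam 1 * t^-1 = t^-1 * gamma0)%g.
  by rewrite -gamma_0 -(gamma_conj 0) !mulgA mulVg mul1g.
by move/(rbump_neq0 R un PAborel btV (gamma0_K0 un)).
Qed.

End Gamma.

End Transport.

(** * The criterion for $V_1(2)$, the conductor and the newform *)

Theorem proposition4p2 (R : realType) (F : fieldType) (E : splittingFieldType F)
  (vF : dvaluation F) (vE : dvaluation E) (sigma : gal_of {:E})
  (p : nat) (varpi : F) (V1 : set (U3 sigma -> R[i]))
  (charF : [pchar F] =i pred0)
  (localF : nonarch_local_field vF)
  (res_p : residue_char vF p) (odd_p : odd p)
  (unramE : unramified_quadratic vF vE)
  (galE : sigma \in 'Gal({:E} / 1)%g) (sigma_neq1 : sigma != 1%g)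
  (varpi_neq0 : varpi != 0) (varpi_unif : vF varpi = 1) :
  let V : set (U3 sigma -> R[i]) :=
    IndB vE (fun a => (normabs vE R a)%:C) (fun=> 1) in
  unique_irreducible_subrep V V1 ->
  let q : R[i] := (residue_card vF)%:R in
  let newf := fun g => q * (q - 1) * f2 vE V varpi 2 g - f2 vE V varpi 1 g in
  [/\ forall f, Kfixed vE V 2 f ->
        (Kfixed vE V1 2 f <-> f 1%g = - (q * (q - 1)) * f (gamma sigma varpi 1)),
      is_conductor vE V1 2,
      Kfixed vE V1 2 newf &
      newf <> (fun=> 0)].
Proof.
move=> V [irrV1 _] q newf.
have [delta un] := unram_exists localF res_p odd_p unramE sigma_neq1 varpi_neq0 varpi_unif.
have [subV1 _ _] := irrV1; have [V1V V10 V1lin V1tr] := subV1.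
have [w0 _] := un_varpi un.
pose t := tel sigma (varpi%:A : E).
have Q0 : (residue_card vE)%:R != 0 :> R[i] by rewrite gt_eqF ?(Q_gt0 R un).
have rel f : Kfixed vE V 2 f ->
    (Kfixed vE V1 2 f <-> f 1%g = - (q * (q - 1)) * f (gamma sigma varpi 1)).
  move=> [Vf fK]; have hf := IndB_rowhom un Vf.
  have tK := (Kgrp2_fixedP un f).1 fK.
  have := V1_K2_fixedP un irrV1 (IndB_rtrans un t Vf) tK.
  (* [mulrCA] moves the common power of $q_E$ to the front of both sides, where it can be
     cancelled. *)
  rewrite (rtrans_t1 un hf) (rtrans_tgamma0 un galE hf) mulrCA => -[h1 h2].
  split=> [[V1f _]|e].
    by apply: (mulfI (expfz_neq0 _ Q0)); apply: h1; exact: V1tr.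
  split=> //; rewrite -(rtransK t f); apply: V1tr; apply: h2.
  by rewrite e.
have [[Kf1 Kf2] f11 f1g f21 f2g] := f2_values R un galE.
have Knew : Kfixed vE V 2 newf.
  have [Vf1 f1K] := Kf1; have [Vf2 f2K] := Kf2; split.
    have -> : newf = fun g => -1 * f2 vE V varpi 1 g + (q * (q - 1) * f2 vE V varpi 2 g + 0).
      by apply: funext => g; rewrite addr0 mulN1r [RHS]addrC.
    exact: (IndB_lin un _ Vf1 (IndB_lin un _ Vf2 (V1V _ V10))).
  move=> k Kk; apply: funext => g; rewrite /rtrans /newf.
  have e1 := congr1 (fun f : U3 sigma -> R[i] => f g) (f1K k Kk).
  have e2 := congr1 (fun f : U3 sigma -> R[i] => f g) (f2K k Kk).
  by rewrite /rtrans in e1 e2; rewrite e1 e2.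
have newg : newf (gamma sigma varpi 1) = - 1 by rewrite /newf f1g f2g mulr0 add0r.
have newn0 : newf <> fun=> 0.
  move=> /(congr1 (fun f : U3 sigma -> R[i] => f (gamma sigma varpi 1))).
  by rewrite newg => /eqP; rewrite oppr_eq0 oner_eq0.
(* The function takes the values $q(q-1)$ at 1 and $-1$ at $\gamma_1$, which satisfy the
   criterion. *)
have K1new : Kfixed vE V1 2 newf.
  by apply/(rel _ Knew); rewrite newg /newf f11 f21; ring.
split=> //; split=> [e|n n2].
  by move: K1new; rewrite e.
apply/seteqP; split=> [f [V1f fK]|_ ->]; last by split.
have fK' g k : Kgrp vE n k -> f (g * k)%g = f g.
  by move=> /fK/(congr1 (fun f : U3 sigma -> R[i] => f g)).
case: n n2 {fK} fK' => [|[|//]] _ fK'; first exact: (K0_fixed_eq0 un irrV1).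
exact: (K1_fixed_eq0 un irrV1).
Qed.
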